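(* Let $d\in\mathbb{N}$, $\varepsilon=100^{-d^2}$, and let $p\in\mathbb{Z}[x]$ be given by $$p(x)=b_1x^d+b_2x^{d-1}+\cdots+b_{d-1}x^2+ux,\qquad b_1,\dots,b_{d-1}\in\mathbb{Z},\ b_1>0,\ u\in\{-1,1\}$$ (when $d=1$, $p(x)=x$). There exists $w_0=w_0(p)\in\mathbb{N}$ such that, for all $w,N\in\mathbb{N}$ satisfying $w\geq w_0$ and $1\leq w\leq\lfloor\varepsilon^3\log(N)\rfloor$, the following holds. Define $W=\mathrm{lcm}(1,2,\dots,w)$ and $P(n)=p(Wn)\in\mathbb{Z}[x]$. Then, for all measure-preserving systems $(\mathcal{X},\mathcal{B},\mu,T)$ and all $f\in L^2(\mu)$, $$\left\|\frac{1}{P(N)}\sum_{1\leq n<N}P'(n)T^{P(n)}f-\frac{W}{P(N)}\sum_{1\leq m<\frac{P(N)}{W}}T^{Wm}f\right\|_2\ll_d\frac{\|f\|_2}{w^{\frac1d-\varepsilon}}.$$ More generally, for all real $Y$ with $1\leq Y\leq N-N^{1-\varepsilon}$, $$\left\|\frac{1}{P(N)-P(Y)}\sum_{Y\leq n<N}P'(n)T^{P(n)}f-\frac{W}{P(N)-P(Y)}\sum_{\frac{P(Y)}{W}\leq m<\frac{P(N)}{W}}T^{Wm}f\right\|_2\ll_d\frac{\|f\|_2}{w^{\frac1d-\varepsilon}}.$$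
   Context: $\mathbb{N}=\{1,2,\dots\}$. A measure-preserving system is a quadruple $(\mathcal{X},\mathcal{B},\mu,T)$ where $(\mathcal{X},\mathcal{B},\mu)$ is a probability space and $T:\mathcal{X}\to\mathcal{X}$ is measurable and invertible with measurable inverse, and $\mu(T(A))=\mu(A)$ for all $A\in\mathcal{B}$. For $k\in\mathbb{Z}$, $T^kf:=f\circ T^k$. $X\ll_d Z$ means $X\leq C_dZ$ for a constant $C_d>0$ depending only on $d$. The sums are over integers $n$, $m$ in the indicated ranges. *)

(* Defs.v *)
From HB Require Import structures.
From mathcomp Require Export all_boot all_order all_algebra.
From mathcomp Require Export all_classical all_reals all_analysis.
From mathcomp Require Export complex.

Set Implicit Arguments.
Unset Strict Implicit.
Unset Printing Implicit Defensive.

Export Order.TTheory GRing.Theory Num.Theory.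
Export numFieldNormedType.Exports.

Local Open Scope classical_set_scope.
Local Open Scope ring_scope.

(* b_1 X^d + b_2 X^(d-1) + ... + b_(d-1) X^2 + u X *)
Definition poly_with_coefs (d : nat) (b : nat -> int) (u : int) : {poly int} :=
  \sum_(1 <= i < d) b i *: 'X^(d.+1 - i) + u *: 'X.

Definition admissible (d : nat) (p : {poly int}) : Prop :=
  if d == 1%N then p = 'X
  else exists (b : nat -> int) (u : int),
    [/\ 0 < b 1%N, u = 1 \/ u = -1 & p = poly_with_coefs d b u].

Definition lcm_upto (w : nat) : nat := \big[lcmn/1%N]_(1 <= i < w.+1) i.

Definition dilate (W : nat) (p : {poly int}) : {poly int} :=
  p \Po (W%:Z *: 'X).

Definition eval_real (R : realType) (P : {poly int}) (y : R) : R :=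
  (map_poly intr P).[y].

Record mp_map (disp : measure_display) (X : measurableType disp)
    (R : realType) (mu : probability X R) := MPMap {
  mp_fun :> X -> X;
  mp_inv : X -> X;
  mp_funK : cancel mp_fun mp_inv;
  mp_invK : cancel mp_inv mp_fun;
  measurable_mp_fun : measurable_fun setT mp_fun;
  measurable_mp_inv : measurable_fun setT mp_inv;
  mp_preserves : forall A : set X, measurable A -> mu (mp_fun @` A) = mu A }.

Section MeasurePreserving.
Context (disp : measure_display) (X : measurableType disp) (R : realType).
Context (mu : probability X R) (T : mp_map mu).

(* Negz n stands for - n.+1 *)
Definition mp_iter (k : int) : X -> X :=
  match k with
  | Posz n => iter n T
  | Negz n => iter n.+1 (mp_inv T)
  end.

Definition koopman (k : int) (f : X -> R[i]) : X -> R[i] := f \o mp_iter k.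

(* The sums range over a bounded, hence finite, set of integers, so that the
   finitely supported sums are the genuine ones. *)
Definition int_co (a b : R) : set int := [set n : int | a <= n%:~R < b].

Definition poly_sum (P : {poly int}) (a b : R) (f : X -> R[i]) : X -> R[i] :=
  fun x => \sum_(n \in int_co a b) (P^`().[n])%:~R * koopman P.[n] f x.

Definition linear_sum (W : nat) (a b : R) (f : X -> R[i]) : X -> R[i] :=
  fun x => \sum_(m \in int_co a b) koopman (W%:Z * m) f x.

End MeasurePreserving.

Section L2.
Context (disp : measure_display) (X : measurableType disp) (R : realType).
Context (mu : probability X R).

Definition L2norm (f : X -> R[i]) : \bar R :=
  Lnorm mu 2%:E (fun x => (Normc.normc (f x))%:E).

Definition in_L2 (f : X -> R[i]) : Prop :=
  [/\ measurable_fun setT (fun x => complex.Re (f x)),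
      measurable_fun setT (fun x => complex.Im (f x)) &
      (L2norm f < +oo)%E].

End L2.

(* Main.v *)
(* Write e(t) = exp(2 pi i t). The L2 operator norm of a sum of c_k T^k is at most the
   supremum over t of |sum c_k e(k t)|. With the integer polynomial Q = P / W it
   therefore suffices to compare, uniformly in t, the sum of Q'(n) e(t Q(n)) over n
   with the sum of e(t m) over m. For d = 1 both averages coincide. For d >= 2
   Dirichlet's theorem approximates d! lead(Q) t by a fraction a/q. If q is large,
   Weyl's inequality and Abel summation bound the first sum, and the second is a
   short geometric sum. If q is small, then t = b/r + beta with r small and beta
   tiny, and the first sum is close to S/r times the sum of e(beta m), where S is
   the complete sum of e(b Q(n) / r) over n mod r. If r has a prime factor l <= w,
   then l divides W, so that Q = +-X mod l and S = 0. Otherwise all primes dividing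
   r exceed w; Mordell's bound for prime moduli and a stationary phase descent for
   prime powers give |S| <= r^(1 - 1/d + eps), which is at most r w^(-1/d + eps).
   The bound W <= 16^w keeps the coefficients of Q below N^eps. *)

Require Import Defs.
From mathcomp Require Import perm fingroup measurable_realfun.
From mathcomp Require Import ring lra zify.

Set Implicit Arguments.
Unset Strict Implicit.
Unset Printing Implicit Defensive.

Local Open Scope ring_scope.

(** * Exponentials and trigonometric sums *)

Section ComplexModulus.
Context (R : realType).
Implicit Types (z : R[i]) (x y t : R).

(** Two features of the statement shape the estimates: the main term is normalised by Q(N) - Q(Y),
    only known to be at least N^d / (2v) with v = N^eps, and the constant may depend on d alone. So
    every error of analytic origin is pushed below a constant times N^d / v^2: after division it
    costs O(1/v), at most O(1/w), and the loss w^(-1/d + eps) comes from the complete sums. The tiny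
    eps leaves room for this, since Weyl differencing saves y = N^(1/(8 * 2^(d-1))) and v^6 <= y.
    The range w <= eps^3 log N is what gives W^d <= v. The coefficients of p and Mordell's constant
    are absorbed by w0: a constant lost at a prime l > w is at most l^eps. Mordell's exponent 1 -
    1/k comes from a mean value: the 2k-th moment of the character sums of all polynomials of degree
    at most k counts tuples with equal power sums, and affine substitutions repeat the modulus of
    one sum at no fewer than l(l-1)/k of these polynomials. The operator norm is bounded without a
    spectral measure, by Parseval on a finite cyclic group along orbit segments. *)

Definition cabs z : R := Normc.normc z.

Lemma cabsE z : `|z| = (cabs z)%:C%C.
Proof. by rewrite normc_def; case: z. Qed.

Lemma cabs_sqr z : cabs z ^+ 2 = complex.Re z ^+ 2 + complex.Im z ^+ 2.
Proof. by case: z => a b /=; rewrite sqr_sqrtr // addr_ge0 ?sqr_ge0. Qed.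

Lemma cabs_ge0 z : 0 <= cabs z.
Proof. by case: z => a b; exact: sqrtr_ge0. Qed.

Lemma cabs0 : cabs 0 = 0.
Proof. exact: Normc.normc0. Qed.

Lemma cabs1 : cabs 1 = 1.
Proof. exact: Normc.normc1. Qed.

Lemma cabsM z1 z2 : cabs (z1 * z2) = cabs z1 * cabs z2.
Proof. exact: Normc.normcM. Qed.

Lemma cabsN z : cabs (- z) = cabs z.
Proof. exact: normcN. Qed.

Lemma cabsD z1 z2 : cabs (z1 + z2) <= cabs z1 + cabs z2.
Proof. exact: le_normcD. Qed.

Lemma cabsB z1 z2 : cabs (z1 - z2) <= cabs z1 + cabs z2.
Proof. by rewrite -[cabs z2]cabsN cabsD. Qed.

Lemma cabs_distC z1 z2 : cabs (z1 - z2) = cabs (z2 - z1).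
Proof. by rewrite -cabsN opprB. Qed.

Lemma cabs_real x : cabs x%:C%C = `|x|.
Proof. by rewrite /cabs /= expr0n /= addr0 sqrtr_sqr. Qed.

Lemma cabs_nat n : cabs n%:R = n%:R.
Proof. by rewrite -(rmorph_nat (real_complex R)) cabs_real ger0_norm. Qed.

Lemma cabs_sum (I : Type) (r : seq I) (P : pred I) (F : I -> R[i]) :
  cabs (\sum_(i <- r | P i) F i) <= \sum_(i <- r | P i) cabs (F i).
Proof.
elim/big_rec2: _ => [|i x y _ le_yx]; first by rewrite cabs0.
by apply: (le_trans (cabsD _ _)); rewrite lerD2l.
Qed.

Lemma cabs_le_sum (I : Type) (r : seq I) (P : pred I) (F : I -> R[i])
    (G : I -> R) : (forall i, P i -> cabs (F i) <= G i) ->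
  cabs (\sum_(i <- r | P i) F i) <= \sum_(i <- r | P i) G i.
Proof. by move=> FG; apply: (le_trans (cabs_sum _ _ _)); exact: ler_sum. Qed.

Lemma mulC_conj z : z * z^*%C = (cabs z ^+ 2)%:C%C.
Proof. by rewrite -sqr_normc cabsE -rmorphXn. Qed.

Lemma abs_Re_le z : `|complex.Re z| <= cabs z.
Proof. by rewrite -lecR -cabsE normc_ge_Re. Qed.

Lemma conjcM z1 z2 : (z1 * z2)^*%C = z1^*%C * z2^*%C.
Proof. exact: rmorphM. Qed.

Definition cexp x : R[i] := (cos (2 * pi * x) +i* sin (2 * pi * x))%C.

Lemma cexpD x y : cexp (x + y) = cexp x * cexp y.
Proof.
rewrite /cexp mulrDr cosD sinD; apply/eqP; rewrite eq_complex /=.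
by apply/andP; split; apply/eqP => //; ring.
Qed.

Lemma cexp0 : cexp 0 = 1.
Proof. by rewrite /cexp mulr0 cos0 sin0. Qed.

Lemma cabs_cexp x : cabs (cexp x) = 1.
Proof. by rewrite /cabs /= cos2Dsin2 sqrtr1. Qed.

Lemma cexpN x : cexp (- x) = (cexp x)^*%C.
Proof. by rewrite /cexp mulrN cosN sinN. Qed.

Lemma cexpMn x n : cexp (x *+ n) = cexp x ^+ n.
Proof. by elim: n => [|n IH]; rewrite ?mulr0n ?cexp0 // mulrS cexpD IH exprS. Qed.

Lemma cexp_nat n : cexp n%:R = 1.
Proof.
have h1 : cexp 1 = 1.
  by rewrite /cexp mulr1 mulr_natl cos2pi sin2pi.
by rewrite cexpMn h1 expr1n.
Qed.

Lemma cexp_int (k : int) : cexp k%:~R = 1.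
Proof.
by case: k => n; rewrite ?NegzE ?mulrNz -pmulrn ?cexpN ?cexp_nat // conjc1.
Qed.

Lemma cexp_periodic x (k : int) : cexp (x + k%:~R) = cexp x.
Proof. by rewrite cexpD cexp_int mulr1. Qed.

Lemma cexp_eq x y (k : int) : x = y + k%:~R -> cexp x = cexp y.
Proof. by move=> ->; exact: cexp_periodic. Qed.

Lemma MVT_lip (f g : R -> R) : (forall x, is_derive x 1 f (g x)) ->
  (forall x, `|g x| <= 1) -> forall x y, `|f x - f y| <= `|x - y| :> R.
Proof.
move=> fg g1 x y; wlog le_xy : x y / x <= y.
  move=> H; have [/H//|/ltW/H] := leP x y.
  by rewrite distrC [X in _ <= X -> _]distrC.
have cf : {within `[x, y], continuous f}%classic.
  by apply: derivable_within_continuous => t _; case: (fg t).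
have [c _ fyx] := MVT_segment le_xy (fun t _ => fg t) cf.
by rewrite distrC fyx distrC normrM ler_piMl.
Qed.

Lemma cexp_lip x y : cabs (cexp x - cexp y) <= 16 * `|x - y|.
Proof.
(* The crude bound pi <= 4 gives 8 in each coordinate, hence the constant 16. *)
have hpi : 2 * pi <= 8 :> R.
  by have [/andP[_ h] _] := pihalf_02_cos_pihalf R; lra.
have h : `|2 * pi * x - 2 * pi * y| <= 8 * `|x - y|.
  rewrite -mulrBr normrM ger0_norm ?ler_wpM2r //.
  by rewrite mulr_ge0 // pi_ge0.
have -> : cexp x - cexp y
    = ((cos (2 * pi * x) - cos (2 * pi * y))%:C
       + 'i * (sin (2 * pi * x) - sin (2 * pi * y))%:C)%C.
  by rewrite /cexp; simpc.
apply: (le_trans (cabsD _ _)); rewrite cabsM !cabs_real.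
have -> : cabs 'i%C = 1 by rewrite /cabs /= expr0n /= add0r expr1n sqrtr1.
rewrite mul1r.
have hc := @MVT_lip cos (fun x => - sin x) (fun x => is_derive_cos x).
have hs := @MVT_lip sin cos (fun x => is_derive_sin x).
have sin1 t : `|- sin t| <= 1 by rewrite normrN ler_norml sin_geN1 sin_le1.
have cos1 t : `|cos t| <= 1 by rewrite ler_norml cos_geN1 cos_le1.
have h2 := lerD (hc sin1 (2 * pi * x) (2 * pi * y)) (hs cos1 (2 * pi * x) (2 * pi * y)).
by apply: le_trans h2 _; lra.
Qed.

End ComplexModulus.

(** * Distance to the nearest integer and geometric sums *)

Section NearestInteger.
Context (R : realType).
Implicit Types (x y t : R).

Definition nint x : int := Num.floor (x + 2^-1).

Definition dist_int x : R := `|x - (nint x)%:~R|.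

Lemma dist_int_half x : dist_int x <= 2^-1.
Proof.
rewrite /dist_int /nint; have /andP[h1 h2] := floor_itv (x + 2^-1).
by rewrite ler_norml; move: h1 h2; rewrite rmorphD /=; lra.
Qed.

Lemma int_ge1 (k : int) : k != 0 -> 1 <= `|k%:~R| :> R.
Proof. by move=> k0; rewrite -intr_norm ler1z; lia. Qed.

Lemma dist_int_le x (k : int) : dist_int x <= `|x - k%:~R|.
Proof.
have [->|ne] := eqVneq k (nint x); first by [].
have h := dist_int_half x.
have : 1 <= `|(k - nint x)%:~R| :> R by apply: int_ge1; rewrite subr_eq0.
rewrite rmorphB /= => h1.
have := ler_distD x (k%:~R) ((nint x)%:~R : R).
by rewrite -/(dist_int x) (distrC k%:~R x); lra.
Qed.

Lemma dist_int_periodic x (k : int) : dist_int (x + k%:~R) = dist_int x.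
Proof.
apply/eqP; rewrite eq_le; apply/andP; split.
  have := dist_int_le (x + k%:~R) (nint x + k); rewrite rmorphD /=.
  by congr (_ <= `|_|); ring.
have := dist_int_le x (nint (x + k%:~R) - k); rewrite rmorphB /=.
by congr (_ <= `|_|); ring.
Qed.

Lemma dist_intN x : dist_int (- x) = dist_int x.
Proof.
suff H y : dist_int (- y) <= dist_int y.
  by apply/eqP; rewrite eq_le H -{1}(opprK x) H.
apply: (le_trans (dist_int_le (- y) (- nint y))).
by rewrite rmorphN /= -opprB opprK normrN addrC.
Qed.

Lemma dist_intD x y : dist_int (x + y) <= dist_int x + dist_int y.
Proof.
apply: (le_trans (dist_int_le (x + y) (nint x + nint y))).
rewrite rmorphD /=; apply: le_trans (ler_normD _ _).
by rewrite le_eqVlt; apply/orP; left; apply/eqP; congr `|_|; ring.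
Qed.

Lemma dist_intB x y : dist_int (x - y) <= dist_int x + dist_int y.
Proof. by rewrite -[dist_int y]dist_intN dist_intD. Qed.

Lemma dist_int_abs x : dist_int x <= `|x|.
Proof. by have := dist_int_le x 0; rewrite subr0. Qed.

Lemma cos_le0 x : 4^-1 <= `|x| <= 2^-1 -> cos (2 * pi * x) <= 0.
Proof.
move=> hx; have -> : cos (2 * pi * x) = cos (2 * pi * `|x|).
  by have [//|_] := ger0P x; rewrite mulrN cosN.
rewrite -[2 * pi * _](subrK pi) cosDpi oppr_le0 cos_ge0_pihalf //.
by have := pi_ge0 R; move: hx; move: `|x| pi => u v; nra.
Qed.

(** Induction on the number [k] of doublings available to bring |x| into [1/4, 1/2]. There the
    cosine is nonpositive, so the real part alone has modulus at least 1. Each doubling costs at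
    most a factor 2, because e(2x) - 1 = (e(x) - 1)(e(x) + 1). *)
Lemma cexp_sub1_ge_aux k x : 4^-1 <= 2 ^+ k * `|x| -> `|x| <= 2^-1 ->
  2 * `|x| <= cabs (cexp x - 1).
Proof.
elim: k x => [|k IH] x h1 h2.
  have := abs_Re_le (cexp x - 1); have := @cos_le0 x.
  rewrite expr0 mul1r in h1; rewrite h1 h2 => /(_ isT) h3 h4.
  have : - complex.Re (cexp x - 1) <= `|complex.Re (cexp x - 1)|.
    by rewrite -normrN ler_norm.
  have re1 : complex.Re (cexp x - 1) = cos (2 * pi * x) - 1 by [].
  by rewrite re1 in h4 *; lra.
have [h3|h3] := leP (4^-1) `|x|; first apply: IH => //.
  by apply: le_trans h3 _; rewrite ler_peMl // exprn_ege1 // ler1n.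
have h4 : 4^-1 <= 2 ^+ k * `|2%:R * x|.
  by rewrite normrM normr_nat mulrA -exprSr.
have h5 : `|2%:R * x| <= 2^-1 by rewrite normrM normr_nat; lra.
have {h4 h5} := IH _ h4 h5; rewrite normrM normr_nat.
have -> : cexp (2%:R * x) - 1 = (cexp x - 1) * (cexp x + 1).
  by rewrite mulr_natl mulr2n cexpD; ring.
rewrite cabsM.
have : cabs (cexp x + 1) <= 2.
  by have := cabsD (cexp x) 1; rewrite cabs_cexp cabs1.
have := cabs_ge0 (cexp x - 1); nra.
Qed.

Lemma cexp_sub1_ge x : 2 * dist_int x <= cabs (cexp x - 1).
Proof.
set y := x - (nint x)%:~R.
have <- : cexp y = cexp x by rewrite /y -rmorphN cexp_periodic.
have -> : dist_int x = `|y| by [].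
have [->|y0] := eqVneq y 0; first by rewrite normr0 mulr0 cabs_ge0.
have ypos : 0 < `|y| by rewrite normr_gt0.
(* Any k > 1 / (4|y|) will do, as 2^k > k. *)
apply: (@cexp_sub1_ge_aux (Num.truncn (4^-1 / `|y|)).+1); last exact: dist_int_half.
rewrite -ler_pdivrMr //; apply: ltW; apply: (lt_le_trans (truncnS_gt _)).
by rewrite -natrX ler_nat ltnW // ltn_expl.
Qed.

(** Multiplication by e(x) - 1 telescopes the sum to two terms of modulus 1. The product form avoids
    a division when x is an integer. *)
Lemma geom_sum_bound c x a b :
  dist_int x * cabs (\sum_(a <= i < b) cexp (c + x * i%:R)) <= 1.
Proof.
have h : cabs (cexp x - 1) * cabs (\sum_(a <= i < b) cexp (c + x * i%:R)) <= 2.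
  rewrite -cabsM; have [le_ba|/ltnW le_ab] := leqP b a.
    by rewrite big_geq // mulr0 cabs0.
  rewrite mulr_sumr (eq_bigr (fun i => cexp (c + x * i.+1%:R) - cexp (c + x * i%:R))).
    rewrite telescope_sumr //.
    by have := cabsB (cexp (c + x * b%:R)) (cexp (c + x * a%:R)); rewrite !cabs_cexp.
  by move=> i _; rewrite mulrBl mul1r -cexpD; congr (cexp _ - _); rewrite -natr1; ring.
have := cexp_sub1_ge x; have := cabs_ge0 (\sum_(a <= i < b) cexp (c + x * i%:R)).
by nra.
Qed.

End NearestInteger.

(** * Fourier analysis on Z/n *)

Section Fourier.
Context (R : realType).
Implicit Types (x y t : R).

Lemma cexp_eq1 x : cexp x = 1 -> exists k : int, x = k%:~R.
Proof.
move=> h; exists (nint x); apply/eqP; rewrite -subr_eq0 -normr_eq0.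
have := cexp_sub1_ge x; rewrite h subrr cabs0 => h2.
by rewrite eq_le normr_ge0 andbT -/(dist_int x); lra.
Qed.

Lemma cexp_orthogonality (n : nat) (m : int) : (0 < n)%N ->
  \sum_(t < n) cexp (m%:~R * t%:R / n%:R : R) = if (n%:Z %| m)%Z then n%:R else 0.
Proof.
move=> n0; have nR : n%:R != 0 :> R by rewrite pnatr_eq0 -lt0n.
pose z := cexp (m%:~R / n%:R : R).
have zt (t : nat) : cexp (m%:~R * t%:R / n%:R : R) = z ^+ t.
  by rewrite -cexpMn; congr cexp; rewrite -mulr_natr; field.
under eq_bigr do rewrite zt.
have [/dvdzP[k mk]|ndvd] := boolP (n%:Z %| m)%Z.
  have z1 : z = 1 by rewrite /z mk rmorphM /= -pmulrn mulfK // cexp_int.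
  by under eq_bigr do rewrite z1 expr1n; rewrite sumr_const card_ord.
have z1 : z - 1 != 0.
  rewrite subr_eq0; apply/eqP => /cexp_eq1[k] hk; case/negP: ndvd.
  apply/dvdzP; exists k; apply/eqP; rewrite -(eqr_int R) rmorphM /= -pmulrn.
  by rewrite -hk divfK.
apply: (mulfI z1); rewrite mulr0 -subrX1 -zt mulfK // cexp_int.
by rewrite subrr.
Qed.

Definition dft n (F : nat -> R[i]) (t : nat) : R[i] :=
  \sum_(j < n) F j * cexp (- (j%:R * t%:R / n%:R)).

Lemma dft_parseval n (F : nat -> R[i]) : (0 < n)%N ->
  \sum_(t < n) cabs (dft n F t) ^+ 2 = n%:R * \sum_(j < n) cabs (F j) ^+ 2.
Proof.
move=> n0; apply: (@complexI R); rewrite rmorph_sum rmorphM rmorph_nat rmorph_sum /=.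
under eq_bigr => t _ do rewrite -mulC_conj /dft rmorph_sum mulr_suml.
rewrite exchange_big mulr_sumr; apply: eq_bigr => j _ /=.
under eq_bigr => t _ do rewrite mulr_sumr.
rewrite exchange_big (bigD1 j) //= [X in _ + X]big1 ?addr0; last first.
  move=> k kj; pose m := k%:Z - j%:Z.
  rewrite (eq_bigr (fun t : 'I_n =>
      F j * (F k)^*%C * cexp (m%:~R * t%:R / n%:R))); last first.
    move=> t _; rewrite conjcM -cexpN opprK mulrACA -cexpD.
    by congr (_ * cexp _); rewrite /m rmorphB /=; ring.
  rewrite -mulr_sumr cexp_orthogonality // ifF ?mulr0 //.
  apply/negP => /dvdzP[q]; rewrite /m => hq.
  have := ltn_ord k; have := ltn_ord j; move/eqP: kj => kj.
  have : (k : nat) <> j by move=> /val_inj.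
  have [q0|q0] := eqVneq q 0; first by move: hq; rewrite q0 mul0r; lia.
  by move: hq q0; nia.
rewrite (eq_bigr (fun=> F j * (F j)^*%C)).
  by rewrite sumr_const card_ord mulC_conj mulr_natl.
move=> t _; rewrite conjcM -cexpN opprK mulrACA -cexpD addNr cexp0.
by rewrite mulr1.
Qed.

Lemma dft_shift n (F : nat -> R[i]) (k t : nat) : (0 < n)%N ->
  dft n (fun j => F ((j + k) %% n)%N) t = cexp (k%:R * (t%:R / n%:R)) * dft n F t.
Proof.
case: n => // n _; rewrite /dft mulr_sumr.
rewrite [RHS](reindex_inj (addIr (inord (k %% n.+1) : 'I_n.+1))) /=.
apply: eq_bigr => j _.
have -> : ((j + (inord (k %% n.+1) : 'I_n.+1)) %% n.+1 = (j + k) %% n.+1)%N.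
  by rewrite inordK ?ltn_pmod // modnDmr.
rewrite mulrCA; congr (_ * _); rewrite -cexpD.
pose q := ((j + k) %/ n.+1)%N.
have e : (j + k)%:R = q%:R * n.+1%:R + ((j + k) %% n.+1)%:R :> R.
  by rewrite {1}(divn_eq (j + k) n.+1) natrD natrM.
have -> : ((j + k) %% n.+1)%:R = j%:R + k%:R - q%:R * n.+1%:R :> R.
  by rewrite -natrD e addrAC subrr add0r.
apply: (@cexp_eq _ _ _ (- (q * t)%N%:Z)).
rewrite mulrNz -pmulrn natrM.
by field; rewrite nat1r pnatr_eq0.
Qed.

(** The transform turns the operator into multiplication, at frequency t, by the trigonometric
    polynomial evaluated at t/n, whose modulus is at most [M]; Parseval does the rest. *)
Lemma cyclic_convolution_bound n (F : nat -> R[i]) (s : seq (R[i] * nat)) (M : R) :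
    (0 < n)%N -> 0 <= M ->
    (forall t, cabs (\sum_(c <- s) c.1 * cexp (c.2%:R * t)) <= M) ->
  \sum_(j < n) cabs (\sum_(c <- s) c.1 * F ((j + c.2) %% n)%N) ^+ 2 <=
    M ^+ 2 * \sum_(j < n) cabs (F j) ^+ 2.
Proof.
move=> n0 M0 hM; pose H j := \sum_(c <- s) c.1 * F ((j + c.2) %% n)%N.
have nR : 0 < n%:R :> R by rewrite ltr0n.
rewrite -(ler_pM2l nR) mulrCA -(dft_parseval F n0) -(dft_parseval H n0) mulr_sumr.
apply: ler_sum => t _.
have -> : dft n H t =
    (\sum_(c <- s) c.1 * cexp (c.2%:R * (t%:R / n%:R))) * dft n F t.
  rewrite mulr_suml /dft /H; under eq_bigr do rewrite mulr_suml.
  rewrite exchange_big; apply: eq_bigr => c _ /=.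
  rewrite -mulrA -(dft_shift F c.2 t n0) /dft mulr_sumr.
  by apply: eq_bigr => j _; rewrite mulrA.
rewrite cabsM exprMn ler_wpM2r ?sqr_ge0 //.
by rewrite lerXn2r ?nnegrE ?cabs_ge0.
Qed.

(** On the cyclic group of order L + K the shifts by at most [K] do not wrap around at the first [L]
    positions; the other positions contribute nonnegative terms and are dropped. *)
Lemma orbit_convolution_bound L K (F : nat -> R[i]) (s : seq (R[i] * nat)) (M : R) :
    (0 < L)%N -> 0 <= M -> (forall c, c \in s -> (c.2 <= K)%N) ->
    (forall t, cabs (\sum_(c <- s) c.1 * cexp (c.2%:R * t)) <= M) ->
  \sum_(j < L) cabs (\sum_(c <- s) c.1 * F (j + c.2)%N) ^+ 2 <=
    M ^+ 2 * \sum_(j < (L + K)) cabs (F j) ^+ 2.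
Proof.
move=> L0 M0 sK hM; apply: le_trans (cyclic_convolution_bound F _ M0 hM); last by lia.
rewrite big_split_ord /= -[leLHS]addr0 lerD //.
  apply: ler_sum => j _; rewrite le_eqVlt; apply/orP; left; apply/eqP.
  congr (cabs _ ^+ 2); apply: eq_big_seq => c /sK cK.
  by rewrite modn_small //= -addSn leq_add.
by apply: sumr_ge0 => j _; exact: sqr_ge0.
Qed.

End Fourier.

(** * Transference *)

Section Transference.
Context (disp : measure_display) (X : measurableType disp) (R : realType).
Context (mu : probability X R) (T : mp_map mu).
Implicit Types (f g : X -> R[i]).

Definition cmeasurable f :=
  measurable_fun setT (fun x => complex.Re (f x)) /\
  measurable_fun setT (fun x => complex.Im (f x)).

Lemma measurable_cabs_sqr f : cmeasurable f ->
  measurable_fun setT (fun x => cabs (f x) ^+ 2).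
Proof.
move=> [mre mim]; under eq_fun do rewrite cabs_sqr.
by apply: measurable_funD; apply: measurable_funX.
Qed.

Lemma measurable_iter n : measurable_fun setT (iter n T : X -> X).
Proof.
elim: n => [|n IH] /=; first exact: measurable_id.
by apply: (measurableT_comp (measurable_mp_fun T) IH).
Qed.

Lemma cmeasurable_iter n f : cmeasurable f -> cmeasurable (f \o iter n T).
Proof.
by move=> [mre mim]; split; [apply: (measurableT_comp mre) | apply: (measurableT_comp mim)];
  exact: measurable_iter.
Qed.

Lemma cmeasurable_sum (s : seq (R[i] * nat)) f : cmeasurable f ->
  cmeasurable (fun x => \sum_(c <- s) c.1 * f (iter c.2 T x)).
Proof.
move=> mf; elim: s => [|c s [mre mim]].
  by split; under eq_fun do rewrite big_nil; exact: measurable_cst.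
have [mre' mim'] := cmeasurable_iter c.2 mf; split.
- under eq_fun => x do rewrite big_cons.
  rewrite (_ : (fun x => _) = (fun x =>
    (complex.Re c.1 * complex.Re (f (iter c.2 T x))
     - complex.Im c.1 * complex.Im (f (iter c.2 T x)))
    + complex.Re (\sum_(c <- s) c.1 * f (iter c.2 T x)))).
    apply: measurable_funD => //; apply: measurable_funB;
    by apply: measurable_funM => //; exact: measurable_cst.
  apply/funext => x; case: (\sum_(_ <- _) _) => a b.
  by case: (c.1) => ? ?; case: (f _).
- under eq_fun => x do rewrite big_cons.
  rewrite (_ : (fun x => _) = (fun x =>
    (complex.Re c.1 * complex.Im (f (iter c.2 T x))
     + complex.Im c.1 * complex.Re (f (iter c.2 T x)))
    + complex.Im (\sum_(c <- s) c.1 * f (iter c.2 T x)))).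
    apply: measurable_funD => //; apply: measurable_funD;
    by apply: measurable_funM => //; exact: measurable_cst.
  apply/funext => x; case: (\sum_(_ <- _) _) => a b.
  by case: (c.1) => ? ?; case: (f _).
Qed.

(** Invariance is assumed for images; surjectivity of [T] makes the image of the preimage equal to
    [A]. *)
Lemma mp_preimage (A : set X) : measurable A -> mu (T @^-1` A)%classic = mu A.
Proof.
move=> mA; rewrite -(mp_preserves T); last first.
  by rewrite -[X in measurable X]setTI; apply: measurable_mp_fun.
congr (mu _); apply/seteqP; split=> [_ [x Ax <-]//|x Ax].
by exists (mp_inv T x); rewrite ?/preimage /= mp_invK.
Qed.

Lemma integral_mp (h : X -> \bar R) : measurable_fun setT h ->
  (forall x, 0 <= h x)%E -> (\int[mu]_x h (T x) = \int[mu]_x h x)%E.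
Proof.
move=> mh h0; have mT := measurable_mp_fun T.
rewrite -[LHS](ge0_integral_pushforward mT mu measurableT) //.
apply: (@eq_measure_integral _ _ _ _ mu) => A mA _.
exact: mp_preimage.
Qed.

Lemma integral_mp_iter n (h : X -> \bar R) : measurable_fun setT h ->
  (forall x, 0 <= h x)%E -> (\int[mu]_x h (iter n T x) = \int[mu]_x h x)%E.
Proof.
elim: n h => // n IH h mh h0; rewrite -[RHS]integral_mp //=.
have mhT := measurableT_comp mh (measurable_mp_fun T).
exact: (IH (h \o T) mhT (fun x => h0 (T x))).
Qed.

Definition L2sqr f : \bar R := (\int[mu]_x (cabs (f x) ^+ 2)%:E)%E.

Lemma L2sqr_ge0 f : (0 <= L2sqr f)%E.
Proof. by apply: integral_ge0 => x _; rewrite lee_fin sqr_ge0. Qed.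

Lemma L2normE f : L2norm mu f = (L2sqr f `^ 2^-1)%E.
Proof.
rewrite /L2norm unlock; congr (_ `^ _)%E; apply: eq_integral => x _.
rewrite -/(cabs _) abse_EFin ger0_norm ?cabs_ge0 //.
by rewrite poweR_EFin -powR_mulrn ?cabs_ge0.
Qed.

(* The finite Fourier inequality is applied along the orbit segment
   x, T x, ..., T^(L+K-1) x, integrated over x, divided by L, and L tends to infinity. *)
Lemma transference (s : seq (R[i] * nat)) f (M : R) : in_L2 mu f -> 0 <= M ->
    (forall t, cabs (\sum_(c <- s) c.1 * cexp (c.2%:R * t)) <= M) ->
  (L2norm mu (fun x => \sum_(c <- s) c.1 * f (iter c.2 T x))%R
    <= M%:E * L2norm mu f)%E.
Proof.
move=> [mre mim f2] M0 hM; have mf : cmeasurable f by split.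
set g := fun x => _; have mg : cmeasurable g by exact: cmeasurable_sum.
have h_f : L2sqr f \is a fin_num.
  rewrite ge0_fin_numE ?L2sqr_ge0 //; move: f2; rewrite L2normE.
  by move/lty_poweRy; apply; rewrite invr_eq0.
pose K := (\sum_(c <- s) c.2)%N.
have sK c : c \in s -> (c.2 <= K)%N.
  by move=> cs; rewrite /K (big_rem c) //= leq_addr.
have mfE n : measurable_fun setT (fun x => (cabs (f (iter n T x)) ^+ 2)%:E).
  apply/measurable_EFinP; apply: (@measurable_cabs_sqr (f \o iter n T)).
  exact: cmeasurable_iter.
have mgE n : measurable_fun setT (fun x => (cabs (g (iter n T x)) ^+ 2)%:E).
  apply/measurable_EFinP; apply: (@measurable_cabs_sqr (g \o iter n T)).
  exact: cmeasurable_iter.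
have sumI (h : X -> R[i]) n :
    (forall n, measurable_fun setT (fun x => (cabs (h (iter n T x)) ^+ 2)%:E)) ->
    (\int[mu]_x (\sum_(j < n) cabs (h (iter j T x)) ^+ 2)%:E = n%:R%:E * L2sqr h)%E.
  move=> mh; under eq_integral do rewrite -sumEFin.
  rewrite ge0_integral_sum //; last first.
    by move=> j x _; rewrite lee_fin sqr_ge0.
  rewrite (eq_bigr (fun=> L2sqr h)); last first.
    move=> j _; apply: (integral_mp_iter j (mh 0%N)) => x.
    by rewrite lee_fin sqr_ge0.
  by rewrite big_const_ord iter_addr_0 mule_natl.
have key L : (0 < L)%N ->
    (L%:R%:E * L2sqr g <= (M ^+ 2)%:E * ((L + K)%:R%:E * L2sqr f))%E.
  move=> L0; rewrite -!sumI // -ge0_integralZl_EFin ?sqr_ge0 //; last 2 first.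
  - by move=> x _; rewrite lee_fin sumr_ge0 // => i _; exact: sqr_ge0.
  - under eq_fun do rewrite -sumEFin.
    exact: emeasurable_sum.
  apply: ge0_le_integral => //.
  - by move=> x _; rewrite lee_fin sumr_ge0 // => i _; exact: sqr_ge0.
  - by under eq_fun do rewrite -sumEFin; exact: emeasurable_sum.
  - by apply: measurable_funeM; under eq_fun do rewrite -sumEFin; exact: emeasurable_sum.
  move=> x _; rewrite -EFinM lee_fin.
  have := orbit_convolution_bound (fun j => f (iter j T x)) L0 M0 sK hM.
  apply: le_trans; rewrite le_eqVlt; apply/orP; left; apply/eqP.
  apply: eq_bigr => j _; rewrite /g; congr (cabs _ ^+ 2); apply: eq_bigr => c _.
  by rewrite -iterD addnC.
(* The case L = 1 of [key] already shows finiteness, so that the limit in L can be taken among real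
   numbers. *)
have h_g : L2sqr g \is a fin_num.
  rewrite ge0_fin_numE ?L2sqr_ge0 //; have := key 1%N isT; rewrite mul1e.
  by move/le_lt_trans; apply; rewrite -(fineK h_f) -!EFinM ltry.
have fin : fine (L2sqr g) <= M ^+ 2 * fine (L2sqr f).
  have key' L : (0 < L)%N ->
      L%:R * fine (L2sqr g) <= M ^+ 2 * ((L + K)%:R * fine (L2sqr f)).
    by move=> /key; rewrite -{1}(fineK h_g) -{1}(fineK h_f) -!EFinM lee_fin.
  rewrite leNgt; apply/negP => lt_fg.
  set a := fine (L2sqr g) in lt_fg key' *; set b := fine (L2sqr f) in lt_fg key' *.
  have e0 : 0 < a - M ^+ 2 * b by rewrite subr_gt0.
  (* Were a > M^2 b, the boundary term M^2 K b would have to be at least L (a - M^2 b); this [L] is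
     too large for that. *)
  set e := a - _ in e0; pose L := (Num.truncn (M ^+ 2 * K%:R * b / e)).+1.
  have hL : M ^+ 2 * K%:R * b < L%:R * e by rewrite -ltr_pdivrMr // truncnS_gt.
  by have := key' L isT; rewrite natrD; move: hL; rewrite /e; lra.
rewrite !L2normE.
have -> : M%:E = ((M ^+ 2)%:E `^ 2^-1)%E.
  by rewrite poweR_EFin -powR_mulrn // -powRrM mulfV // powRr1.
rewrite -poweRM ?L2sqr_ge0 ?lee_fin ?sqr_ge0 //.
apply: gt0_ler_poweR; rewrite ?invr_ge0 ?in_itv /= ?leey ?andbT ?L2sqr_ge0 //.
  by rewrite mule_ge0 ?L2sqr_ge0 // lee_fin sqr_ge0.
by rewrite -(fineK h_g) -(fineK h_f) -EFinM lee_fin.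
Qed.

End Transference.

(** * Character sums over finite fields *)

Section AffineComposition.
Context (A : comNzRingType).

Lemma coef_affine_exp (a b : A) i j :
  ((a *: 'X + b%:P) ^+ i)`_j = (a ^+ j * b ^+ (i - j)) *+ 'C(i, j).
Proof.
rewrite addrC exprDn coef_sum.
have e (l : nat) : (b%:P ^+ (i - l) * (a *: 'X) ^+ l *+ 'C(i, l))`_j =
    (b ^+ (i - l) * (a ^+ l * (j == l)%:R)) *+ 'C(i, l).
  by rewrite coefMn -rmorphXn /= exprZn coefCM coefZ coefXn.
have [lt_ij|le_ji] := ltnP i j.
  rewrite bin_small // mulr0n big1 // => l _; rewrite e.
  by rewrite (_ : (j == l) = false) ?mulr0 ?mul0rn //; have := ltn_ord l; lia.
rewrite (bigD1 (Ordinal (le_ji : (j < i.+1)%N))) //= e eqxx mulr1 big1 ?addr0 ?[_ * b ^+ _]mulrC //.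
move=> l lj; rewrite e (_ : (j == l) = false) ?mulr0 ?mul0rn //.
by apply: contraNF lj => /eqP jl; apply/eqP/val_inj.
Qed.

Lemma coef_comp_affine (f : {poly A}) (a b : A) n j : (size f <= n)%N ->
  (f \Po (a *: 'X + b%:P))`_j =
    \sum_(i < n) f`_i * ((a ^+ j * b ^+ (i - j)) *+ 'C(i, j)).
Proof.
move=> sf; have {1}-> : f = \sum_(i < n) f`_i *: 'X^i.
  by rewrite -poly_def; apply/polyP => i; rewrite coef_poly; case: ltnP => // ni;
    rewrite nth_default // (leq_trans sf).
rewrite rmorph_sum coef_sum; apply: eq_bigr => i _ /=.
by rewrite comp_polyZ comp_Xn_poly coefZ coef_affine_exp.
Qed.

Lemma coef_comp_affine_top (f : {poly A}) (a b : A) k : (size f <= k.+1)%N ->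
  (f \Po (a *: 'X + b%:P))`_k = f`_k * a ^+ k.
Proof.
move=> sf; rewrite (coef_comp_affine a b k sf) big_ord_recr big1 /= ?add0r.
  by rewrite subnn mulr1 binn mulr1n.
by move=> i _; rewrite bin_small // mulr0n mulr0.
Qed.

(** The two top coefficients pin down the pair (a, b) in Mordell's argument; with a = 1 they give
    the degree and the leading coefficient of a differenced polynomial. *)
Lemma coef_comp_affine_subtop (f : {poly A}) (a b : A) k : (size f <= k.+2)%N ->
  (f \Po (a *: 'X + b%:P))`_k = a ^+ k * (f`_k + k.+1%:R * b * f`_k.+1).
Proof.
move=> sf; rewrite (coef_comp_affine a b k sf) !big_ord_recr big1 /= ?add0r.
  rewrite subnn binn subSnn expr1 expr0 mulr1 mulr1n -bin_sub // subSnn bin1.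
  by rewrite -[_ *+ k.+1]mulr_natr; ring.
by move=> i _; rewrite bin_small // mulr0n mulr0.
Qed.

End AffineComposition.

(** * Power sums determine a multiset *)

Section PowerSums.
Context (F : fieldType).
Implicit Types (s t : seq F) (p q : {poly F}).

Lemma coefM_top p q a b : (size p <= a.+1)%N -> (size q <= b.+1)%N ->
  (p * q)`_(a + b) = p`_a * q`_b.
Proof.
move=> sp sq; have ha : (a < (a + b).+1)%N by lia.
rewrite coefM (bigD1 (Ordinal ha)) //= addKn big1 ?addr0 // => j ja.
have [lt_aj|le_ja] := ltnP a j; first by rewrite (nth_default _ (leq_trans sp lt_aj)) mul0r.
rewrite [X in _ * X]nth_default ?mulr0 //; apply: leq_trans sq _.
have : (j : nat) != a by apply: contraNneq ja => e; apply/eqP/val_inj.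
lia.
Qed.

Lemma coefX_deriv p i : ('X * p^`())`_i = p`_i *+ i.
Proof. by rewrite coefXM; case: i => [|i] //=; rewrite ?mulr0n // coef_deriv. Qed.

Definition prodX s : {poly F} := \prod_(x <- s) ('X - x%:P).

Definition power_sum s j : F := \sum_(x <- s) x ^+ j.

Lemma size_prodX s : size (prodX s) = (size s).+1.
Proof. exact: size_prod_XsubC. Qed.

(* Logarithmic derivative at infinity: up to the factor 'X^n,
   A'/A = sum_j p_j X^(-j-1). *)
Lemma prodX_log_deriv n s : exists2 r : {poly F}, (size r <= size s)%N &
  'X^n * (prodX s)^`() =
    prodX s * (\sum_(j < n) power_sum s j *: 'X^(n.-1 - j)) + r.
Proof.
elim: s => [|x s [r sr IH]].
  exists 0; rewrite ?size_poly0 // /prodX big_nil derivC mulr0 mul1r addr0 big1 //.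
  by move=> j _; rewrite /power_sum big_nil scale0r.
exists (x%:P ^+ n * prodX s + ('X - x%:P) * r).
  rewrite (leq_trans (size_polyD _ _)) // geq_max; apply/andP; split.
    by rewrite -rmorphXn mul_polyC (leq_trans (size_scale_leq _ _)) ?size_prodX.
  by rewrite (leq_trans (size_polyMleq _ _)) // size_XsubC.
have -> : prodX (x :: s) = ('X - x%:P) * prodX s by rewrite /prodX big_cons.
rewrite derivM derivXsubC mul1r mulrDr mulrCA IH.
have -> : \sum_(j < n) power_sum (x :: s) j *: 'X^(n.-1 - j) =
    \sum_(j < n) 'X^(n.-1 - j) * x%:P ^+ j
    + \sum_(j < n) power_sum s j *: 'X^(n.-1 - j) :> {poly F}.
  rewrite -big_split; apply: eq_bigr => j _ /=.
  by rewrite /power_sum big_cons scalerDl -rmorphXn mulrC mul_polyC.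
set S := \sum_(j < n) 'X^(n.-1 - j) * _.
have hS : 'X^n - x%:P ^+ n = ('X - x%:P) * S := subrXX _ _ _.
have -> : 'X^n = ('X - x%:P) * S + x%:P ^+ n by rewrite -hS subrK.
ring.
Qed.

(* A'/A and B'/B agree up to X^(-k-2), so A' B - A B' has size less than k; the
   leading coefficient of A - B would contribute at degree at least k - 1. *)
Lemma prodX_power_sum_inj s t : size s = size t ->
    (forall j, (0 < j <= size s)%N -> j%:R != 0 :> F) ->
    (forall j, (0 < j <= size s)%N -> power_sum s j = power_sum t j) ->
  prodX s = prodX t.
Proof.
move=> st char0 ps; set k := size s in st char0 ps *.
have ps' j : (j <= k)%N -> power_sum s j = power_sum t j.
  case: j => [_|j jk]; last by apply: ps.
  rewrite /power_sum; under eq_bigr do rewrite expr0.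
  under [RHS]eq_bigr do rewrite expr0.
  by rewrite !big_const_seq !count_predT -st.
have [r sr hr] := prodX_log_deriv k.+1 s.
have [r' sr' hr'] := prodX_log_deriv k.+1 t.
set A := prodX s in hr *; set B := prodX t in hr' *.
have sA : size A = k.+1 by rewrite size_prodX.
have sB : size B = k.+1 by rewrite size_prodX -st.
set S := \sum_(j < k.+1) power_sum s j *: _ in hr.
have hS : \sum_(j < k.+1) power_sum t j *: 'X^(k - j) = S.
  by apply: eq_bigr => j _; rewrite ps' // -ltnS.
rewrite {}hS in hr'.
pose D := A^`() * B - A * B^`().
(* Cross multiplication cancels the common term [A * B * S]; only the remainders survive. *)
have hD : 'X^(k.+1) * D = r * B - r' * A.
  rewrite /D mulrBr mulrA hr [_ * (A * _)]mulrCA hr'; ring.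
have sD : (size D <= k.-1)%N.
  have [->|D0] := eqVneq D 0; first by rewrite size_poly0.
  have : (size ('X^(k.+1) * D)%R <= k + k)%N.
    rewrite hD (leq_trans (size_polyD _ _)) // size_polyN geq_max.
    have rk : (size r <= k)%N by [].
    have rk' : (size r' <= k)%N by rewrite st.
    apply/andP; split; apply: (leq_trans (size_polyMleq _ _)); rewrite ?sA ?sB addnS /=.
      by rewrite leq_add2r.
    by rewrite leq_add2r.
  rewrite ['X^_ * _]mulrC size_mulXn //; have := D0; rewrite -size_poly_gt0.
  by move: (size D) => n; lia.
apply/eqP; rewrite -subr_eq0; apply/eqP; apply/eqP/negP => /negP E0.
set E := A - B in E0; pose m := (size E).-1.
have sE : (size E <= m.+1)%N by rewrite /m; lia.
have lE : E`_m != 0 by rewrite -[E`_m]/(lead_coef E) lead_coef_eq0.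
have mk : (m < k)%N.
  have Ek : E`_k = 0.
    rewrite coefB; have := monic_prod_XsubC s predT id => /monicP.
    rewrite -/(prodX s) /lead_coef sA /= => ->.
    have := monic_prod_XsubC t predT id => /monicP.
    by rewrite -/(prodX t) /lead_coef sB /= => ->; rewrite subrr.
  have : (size E <= k)%N.
    apply/leq_sizeP => j; rewrite leq_eqVlt => /orP[/eqP <- //|kj].
    by rewrite coefB !nth_default ?subrr ?sA ?sB.
  have : (0 < size E)%N by rewrite size_poly_gt0.
  by rewrite /m; move: (size E) => n; lia.
have hB : B`_k = 1.
  have := monic_prod_XsubC t predT id => /monicP.
  by rewrite -/(prodX t) /lead_coef sB.
(* Since B is monic of degree k, the coefficient of 'X * D at m + k is E_m (m - k), and 0 < k - m <=
   k is invertible in F by [char0]. *)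
have DE : 'X * D = ('X * E^`()) * B - E * ('X * B^`()).
  by rewrite /D /E derivB; ring.
have sXd p n : (size p <= n.+1)%N -> (size ('X * p^`())%R <= n.+1)%N.
  move=> sp; apply/leq_sizeP => j nj; rewrite coefX_deriv nth_default ?mul0rn //.
  exact: leq_trans sp nj.
have : ('X * D)`_(m + k) = 0.
  by rewrite coefXM; case: ifP => // _; rewrite nth_default // (leq_trans sD); lia.
rewrite DE coefB !coefM_top ?sXd ?sB // !coefX_deriv hB mulr1.
rewrite -[X in X - _]mulr_natr -mulrBr => /eqP; rewrite mulf_eq0 (negPf lE) /=.
rewrite subr_eq0 eq_sym -subr_eq0 -natrB; last lia.
by apply/negP; apply: char0; lia.
Qed.

End PowerSums.

(** * Mordell's bound for character sums *)

Section Mordell.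
Context (R : realType) (F : finFieldType) (psi : F -> R[i]).
Hypothesis psiD : forall x y, psi (x + y) = psi x * psi y.
Hypothesis cabs_psi : forall x, cabs (psi x) = 1.
Hypothesis psi_orthogonality :
  forall a, \sum_x psi (a * x) = if a == 0 then #|F|%:R else 0.

Definition char_sum (f : {poly F}) : R[i] := \sum_x psi f.[x].

Lemma psi0 : psi 0 = 1.
Proof.
have := cabs_psi 0; have := psiD 0 0; rewrite addr0 => h h1.
have n0 : psi 0 != 0.
  by apply/eqP => e; move: h1; rewrite e cabs0 => /eqP; rewrite eq_sym oner_eq0.
by apply: (mulfI n0); rewrite mulr1 -h.
Qed.

Lemma psiN x : psi (- x) = (psi x)^*%C.
Proof.
have h : psi x * (psi x)^*%C = 1 by rewrite mulC_conj cabs_psi expr1n.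
have n0 : psi x != 0.
  by apply/eqP => e; move: h; rewrite e mul0r => /eqP; rewrite eq_sym oner_eq0.
by apply: (mulfI n0); rewrite h -psiD subrr psi0.
Qed.

Lemma psi_sum (I : finType) (x : I -> F) : psi (\sum_i x i) = \prod_i psi (x i).
Proof. by apply: (big_morph psi psiD psi0). Qed.

(** The constant term is left out because it changes a character sum only by a factor of modulus 1;
    the [k] coefficients that remain match the [k] power sums of the mean value. *)
Definition pol_of k (a : {ffun 'I_k -> F}) : {poly F} := \sum_(i < k) a i *: 'X^(i.+1).

(** Expand S^k and its conjugate over k-tuples [x] and [y]. The coefficient [a j] then multiplies a
    difference of power sums, so that summing over [a] detects tuples with equal power sums. *)
Lemma char_sum_pow k (a : {ffun 'I_k -> F}) :
  (cabs (char_sum (pol_of a)) ^+ (2 * k))%:C%C =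
  \sum_(x : {ffun 'I_k -> F}) \sum_(y : {ffun 'I_k -> F})
    \prod_(j < k) psi (a j * (\sum_i x i ^+ j.+1 - \sum_i y i ^+ j.+1)).
Proof.
have G_k (g : {poly F}) : char_sum g ^+ k =
    \sum_(x : {ffun 'I_k -> F}) psi (\sum_i g.[x i]).
  rewrite -{1}(card_ord k) -prodr_const bigA_distr_bigA /=.
  by apply: eq_bigr => x _; rewrite psi_sum.
rewrite exprM rmorphXn /= -mulC_conj exprMn.
have -> : (char_sum (pol_of a))^*%C ^+ k = ((char_sum (pol_of a)) ^+ k)^*%C.
  by rewrite rmorphXn.
rewrite G_k mulr_suml; apply: eq_bigr => x _.
rewrite (rmorph_sum (@conjc _)) mulr_sumr; apply: eq_bigr => y _ /=.
rewrite -psiN -psiD -psi_sum; congr psi.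
have e (z : {ffun 'I_k -> F}) :
    \sum_i (pol_of a).[z i] = \sum_(j < k) a j * \sum_i z i ^+ j.+1.
  under eq_bigr do rewrite horner_sum.
  rewrite exchange_big; apply: eq_bigr => j _; rewrite mulr_sumr.
  by apply: eq_bigr => i _; rewrite hornerZ hornerXn.
rewrite !e -sumrB; apply: eq_bigr => j _; by rewrite mulrBr.
Qed.

(** Equal power sums of orders 1 to k force equal multisets, so every such [y] is a permutation of
    [x]. *)
Lemma card_equal_power_sums k (x : {ffun 'I_k -> F}) :
    (forall j, (0 < j <= k)%N -> j%:R != 0 :> F) ->
  (#|[set y : {ffun 'I_k -> F} |
      [forall j : 'I_k, (\sum_i x i ^+ j.+1 == \sum_i y i ^+ j.+1)%R]]| <= k`!)%N.
Proof.
move=> char0; set S := [set y | _].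
pose h (s : {perm 'I_k}) : {ffun 'I_k -> F} := [ffun i => x (s i)].
have sub : S \subset [set h s | s : {perm 'I_k}].
  apply/fintype.subsetP => y; rewrite inE => /forallP hy.
  have : perm_eq (mktuple x) (mktuple y).
    apply: prod_XsubC_eq; apply: prodX_power_sum_inj; rewrite ?size_tuple //.
    move=> j /andP[j0 jk]; have j1k : (j.-1 < k)%N by lia.
    by have /eqP := hy (Ordinal j1k); rewrite /power_sum !big_map /= prednK //.
  rewrite perm_sym => /tuple_permP[s hs]; apply/imsetP; exists s => //.
  apply/ffunP => i; rewrite ffunE -[LHS](tnth_mktuple y).
  have -> : mktuple y = [tuple tnth (mktuple x) (s i) | i < k].
    by apply: val_inj.
  by rewrite !tnth_mktuple.
apply: (leq_trans (subset_leq_card sub)).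
by apply: (leq_trans (leq_imset_card _ _)); rewrite card_Sn.
Qed.

(** Orthogonality in each coefficient gives |F|^k for a pair of tuples with equal power sums and 0
    for any other; each of the |F|^k tuples [x] has at most k! partners. *)
Lemma char_sum_mean_value k : (forall j, (0 < j <= k)%N -> j%:R != 0 :> F) ->
  \sum_(a : {ffun 'I_k -> F}) cabs (char_sum (pol_of a)) ^+ (2 * k) <=
    (k`! * #|F| ^ (2 * k))%:R.
Proof.
move=> char0; rewrite -lecR rmorph_nat rmorph_sum [leLHS]/=.
under eq_bigr do rewrite char_sum_pow.
rewrite exchange_big /=; under eq_bigr do rewrite exchange_big /=.
pose c (x y : {ffun 'I_k -> F}) (j : 'I_k) := \sum_i x i ^+ j.+1 - \sum_i y i ^+ j.+1.
have e x y : \sum_(a : {ffun 'I_k -> F}) \prod_(j < k) psi (a j * c x y j) =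
    if [forall j, c x y j == 0] then (#|F| ^ k)%:R else 0.
  rewrite -(bigA_distr_bigA (fun j t => psi (t * c x y j))) /=.
  under eq_bigr => j _ do under eq_bigr => t _ do rewrite mulrC.
  under eq_bigr => j _ do rewrite psi_orthogonality.
  case: forallP => [h|h].
    rewrite (eq_bigr (fun=> #|F|%:R)); last by move=> j _; rewrite h.
    by rewrite prodr_const card_ord natrX.
  have [j hj] : exists j, c x y j != 0.
    by apply/existsP; rewrite -negb_forall; apply/forallP.
  by rewrite (bigD1 j) //= (negPf hj) mul0r.
have -> : (k`! * #|F| ^ (2 * k))%N =
    (\sum_(x : {ffun 'I_k -> F}) k`! * #|F| ^ k)%N.
  by rewrite sum_nat_const card_ffun card_ord mul2n -addnn expnD; ring.
rewrite natr_sum.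
apply: ler_sum => x _; under eq_bigr do rewrite e.
rewrite -big_mkcond /= sumr_const -mulrnA ler_nat mulnC leq_mul2r.
apply/orP; right; rewrite -cardsE; apply: leq_trans (card_equal_power_sums x char0).
apply: subset_leq_card; apply/fintype.subsetP => y; rewrite !inE => /forallP h.
by apply/forallP => j; rewrite -subr_eq0; exact: h.
Qed.

Lemma size_comp_affine (f : {poly F}) (a b : F) : a != 0 ->
  size (f \Po (a *: 'X + b%:P)) = size f.
Proof.
move=> a0; rewrite size_comp_poly2 // -mul_polyC size_MXaddC.
by rewrite polyC_eq0 (negPf a0) size_polyC a0.
Qed.

Lemma char_sum_affine (f : {poly F}) (a b : F) : a != 0 ->
  char_sum (f \Po (a *: 'X + b%:P)) = char_sum f.
Proof.
move=> a0; rewrite /char_sum [RHS](reindex_inj (h := fun x => a * x + b)) /=.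
  by apply: eq_bigr => x _; rewrite horner_comp !hornerE.
by move=> x y /addIr /(mulfI a0).
Qed.

Lemma cabs_char_sum_coef k (g : {poly F}) : (size g <= k.+1)%N ->
  cabs (char_sum g) = cabs (char_sum (pol_of [ffun i : 'I_k => g`_i.+1])).
Proof.
move=> sg; suff -> : char_sum g = psi g`_0 * char_sum (pol_of [ffun i : 'I_k => g`_i.+1]).
  by rewrite cabsM cabs_psi mul1r.
rewrite /char_sum mulr_sumr; apply: eq_bigr => x _; rewrite -psiD; congr psi.
rewrite (horner_coef_wide _ sg) big_ord_recl expr0 mulr1 horner_sum; congr (_ + _).
by apply: eq_bigr => i _; rewrite hornerZ hornerXn ffunE.
Qed.

Section Orbit.
Variables (f : {poly F}) (k : nat).
Hypotheses (sf : size f = k.+1) (k2 : (2 <= k)%N).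
Hypothesis char0 : forall j, (0 < j <= k)%N -> j%:R != 0 :> F.

Let lcf : f`_k != 0.
Proof.
have -> : f`_k = lead_coef f by rewrite /lead_coef sf.
by rewrite lead_coef_eq0 -size_poly_gt0 sf.
Qed.

Definition affine_coefs (ab : F * F) : {ffun 'I_k -> F} :=
  [ffun i : 'I_k => (f \Po (ab.1 *: 'X + ab.2%:P))`_i.+1].

(** The top coefficient fixes a^k, which leaves at most k values of a; given a, the next coefficient
    fixes b because k is invertible in F. *)
Lemma card_affine_fiber (c : {ffun 'I_k -> F}) :
  (#|[set ab : F * F | (ab.1 != 0)%R && (affine_coefs ab == c)]| <= k)%N.
Proof.
set S := [set ab | _].
have k1k : (k.-1 < k)%N by lia.
have k2k : (k.-2 < k)%N by lia.
have inS a b : (a, b) \in S -> [/\ a != 0, f`_k * a ^+ k = c (Ordinal k1k)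
    & a ^+ k.-1 * (f`_k.-1 + k%:R * b * f`_k) = c (Ordinal k2k)].
  rewrite inE /= => /andP[a0 /eqP <-]; have k1 : (0 < k)%N by exact: ltnW.
  have k1' : k.-1.+1 = k by rewrite prednK.
  have k2' : k.-2.+1 = k.-1 by rewrite prednK // -ltnS k1'.
  rewrite !ffunE /= k1' k2' coef_comp_affine_top ?sf // coef_comp_affine_subtop ?sf ?k1' //.
have inj : {in S &, injective (fun ab : F * F => ab.1)}.
  move=> [a b] [a' b'] /inS[a0 _ h] /inS[_ _ h'] /= e; rewrite -{}e in h' *.
  have /mulfI/(_ _ _ (etrans h (esym h')))/addrI/(mulIf lcf)/mulfI : a ^+ k.-1 != 0.
    by rewrite expf_neq0.
  by move=> -> //; apply: char0; lia.
rewrite -(card_in_imset inj); set A := [set _ | _ in _].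
pose g := f`_k *: 'X^k - (c (Ordinal k1k))%:P : {poly F}.
have sg : size g = k.+1.
  rewrite /g size_polyDl size_scale ?size_polyXn // size_polyN size_polyC.
  by case: eqP; lia.
have g0 : g != 0 by rewrite -size_poly_gt0 sg.
rewrite cardE -ltnS -sg max_poly_roots ?enum_uniq //.
apply/allP => x; rewrite mem_enum => /imsetP[[a b] /inS[_ h _] ->] /=.
by rewrite /root /g !hornerE h subrr.
Qed.

(* All polynomials f(aX + b) have character sums of the same modulus, and at
   most k pairs (a, b) give the same nonconstant coefficients, so |S(f)|^(2k)
   is counted at least |F| (|F| - 1) / k times in the mean value. *)
Lemma mordell_orbit :
  cabs (char_sum f) ^+ (2 * k) * (#|F| * #|F|.-1)%:R <= (k * k`! * #|F| ^ (2 * k))%:R.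
Proof.
pose A := [set ab : F * F | ab.1 != 0].
have cardA : #|A| = (#|F| * #|F|.-1)%N.
  have -> : A = finset.setX [set~ 0] [set: F].
    by apply/setP => -[a b]; rewrite !inE andbT.
  by rewrite cardsX cardsC1 cardsT mulnC.
rewrite -cardA mulr_natr -sumr_const.
rewrite (eq_bigr (fun ab => cabs (char_sum (pol_of (affine_coefs ab))) ^+ (2 * k))); last first.
  move=> [a b]; rewrite inE /= => a0; congr (_ ^+ _).
  by rewrite -(char_sum_affine f b a0) (@cabs_char_sum_coef k) ?size_comp_affine ?sf.
rewrite (partition_big affine_coefs predT) //=.
rewrite -mulnA natrM; apply: le_trans (ler_wpM2l (ler0n _ _) (char_sum_mean_value char0)).
rewrite mulr_sumr; apply: ler_sum => c _.
rewrite (eq_bigr (fun=> cabs (char_sum (pol_of c)) ^+ (2 * k))); last first.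
  by move=> ab /andP[_ /eqP ->].
rewrite sumr_const -[leLHS]mulr_natl ler_wpM2r ?exprn_ge0 ?cabs_ge0 // ler_nat.
rewrite -cardsE; apply: leq_trans (card_affine_fiber c).
apply: subset_leq_card; apply/fintype.subsetP => ab.
by rewrite !inE unfold_in /= inE.
Qed.

End Orbit.

End Mordell.

(** * Complete exponential sums *)

Section IntegerPolynomials.
Implicit Types (f g : {poly int}).

Lemma horner_sub_dvdz f (a b : int) : (a - b %| f.[a] - f.[b])%Z.
Proof.
have /factor_theorem[g hg] : root (f - (f.[b])%:P) b.
  by rewrite /root !hornerE subrr.
apply/dvdzP; exists g.[a]; have := congr1 (fun p => p.[a]) hg.
by rewrite !hornerE.
Qed.

Lemma taylor2 f (x h : int) : exists c, f.[x + h] = f.[x] + h * f^`().[x] + h ^+ 2 * c.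
Proof.
elim/poly_ind: f => [|f b [c hc]].
  by exists 0; rewrite deriv0 !horner0 !mulr0 !addr0.
exists (f^`().[x] + c * (x + h)).
by rewrite derivD derivC derivM derivX !hornerE hc; ring.
Qed.

Definition red (p : nat) f : {poly 'F_p} := map_poly intr f.

Lemma coef_red p f i : (red p f)`_i = (f`_i)%:~R.
Proof. by rewrite coef_map. Qed.

Lemma horner_red p f (a : int) : (red p f).[a%:~R] = (f.[a])%:~R.
Proof. by rewrite horner_map. Qed.

Lemma Fp_int_eq0 p (k : int) : prime p -> (k%:~R == 0 :> 'F_p) = (p%:Z %| k)%Z.
Proof.
move=> pp; rewrite dvdzE /=; case: k => n /=; last rewrite NegzE mulrNz oppr_eq0;
by rewrite -pmulrn -(dvdn_pcharf (pchar_Fp pp)).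
Qed.

Definition nonconst_mod p f := (1 < size (red p f))%N.

End IntegerPolynomials.

Section CompleteSums.
Context (R : realType).
Implicit Types (f g : {poly int}).

Definition complete_sum (q : nat) f : R[i] :=
  \sum_(n < q) cexp ((f.[n%:Z])%:~R / q%:R).

Lemma cexp_congr (q : nat) (a b : int) : (0 < q)%N -> (q%:Z %| a - b)%Z ->
  cexp (a%:~R / q%:R : R) = cexp (b%:~R / q%:R).
Proof.
move=> q0 /dvdzP[c hc]; apply: (@cexp_eq _ _ _ c).
have -> : a = b + c * q%:Z by rewrite -hc; ring.
by rewrite rmorphD rmorphM /= -pmulrn; field; rewrite pnatr_eq0 -lt0n.
Qed.

Lemma complete_term_periodic (q m n : nat) f : (0 < q)%N -> (m = n %[mod q])%N ->
  cexp ((f.[m%:Z])%:~R / q%:R : R) = cexp ((f.[n%:Z])%:~R / q%:R).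
Proof.
move=> q0 mn; apply: cexp_congr => //; apply: dvdz_trans (horner_sub_dvdz _ _ _).
rewrite (divn_eq m q) (divn_eq n q) mn; apply/dvdzP.
exists ((m %/ q)%N%:Z - (n %/ q)%N%:Z); lia.
Qed.

Lemma sum_crt (p q : nat) (e1 e2 : nat -> R[i]) : (0 < p)%N -> (0 < q)%N ->
    coprime p q -> (forall n, e1 (n %% p)%N = e1 n) -> (forall n, e2 (n %% q)%N = e2 n) ->
  \sum_(n < p * q) e1 n * e2 n = (\sum_(n < p) e1 n) * (\sum_(n < q) e2 n).
Proof.
move=> p0 q0 cpq h1 h2; rewrite big_distrlr pair_bigA /=.
pose h (n : 'I_(p * q)) : 'I_p * 'I_q :=
  (Ordinal (ltn_pmod n p0), Ordinal (ltn_pmod n q0)).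
have hbij : bijective h.
  apply: inj_card_bij; last by rewrite card_prod !card_ord.
  move=> m n [/eqP mp /eqP nq]; apply/val_inj.
  have := chinese_remainder cpq m n; rewrite mp nq => /eqP.
  by rewrite !modn_small.
rewrite (reindex h) /=; last exact: onW_bij.
by apply: eq_bigr => n _; rewrite h1 h2.
Qed.

(** A Bezout relation u q + v p = 1 splits 1/(p q) into u/p + v/q, and the Chinese remainder theorem
    separates the two factors. *)
Lemma complete_sum_mul (p q : nat) f : (0 < p)%N -> (0 < q)%N -> coprime p q ->
  exists u v : int, [/\ coprimez u p, coprimez v q &
    complete_sum (p * q) f = complete_sum p (u *: f) * complete_sum q (v *: f)].
Proof.
move=> p0 q0 cpq; have /coprimezP[[u v] /= huv] : coprimez q p.
  by rewrite coprimezE /= coprime_sym.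
exists u, v; split.
- by apply/coprimezP; exists (q%:Z, v); rewrite -huv /=; ring.
- by apply/coprimezP; exists (p%:Z, u); rewrite -huv /=; ring.
rewrite /complete_sum.
rewrite -(@sum_crt p q (fun n => cexp (((u *: f).[n%:Z])%:~R / p%:R))
  (fun n => cexp (((v *: f).[n%:Z])%:~R / q%:R))) //; first last.
- by move=> n; apply: complete_term_periodic => //; rewrite modn_mod.
- by move=> n; apply: complete_term_periodic => //; rewrite modn_mod.
apply: eq_bigr => n _; rewrite -cexpD; congr cexp; rewrite !hornerZ !rmorphM /=.
have huvR : u%:~R * q%:R + v%:~R * p%:R = 1 :> R.
  by have := congr1 (fun z : int => z%:~R : R) huv; rewrite rmorphD !rmorphM.
have p0R : p%:R != 0 :> R by rewrite pnatr_eq0 -lt0n.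
have q0R : q%:R != 0 :> R by rewrite pnatr_eq0 -lt0n.
rewrite ?natrM; move: (f.[n%:Z]) => k.
transitivity (k%:~R / (p%:R * q%:R) * (u%:~R * q%:R + v%:~R * p%:R) : R).
  by rewrite huvR mulr1.
by field; rewrite p0R q0R.
Qed.

Lemma sum_block (m n : nat) (F : nat -> R[i]) :
  \sum_(k < m * n) F k = \sum_(i < m) \sum_(j < n) F (i * n + j)%N.
Proof.
elim: m => [|m IH]; first by rewrite mul0n !big_ord0.
rewrite big_ord_recr /= -IH -(big_mkord predT F) mulSnr.
rewrite (@big_cat_nat _ _ _ (m * n)%N) ?leq_addr //= big_mkord; congr (_ + _).
rewrite -{1}[(m * n)%N]add0n big_addn addKn big_mkord.
by apply: eq_bigr => i _; rewrite addnC.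
Qed.

Lemma sum_periodic (m n : nat) (F : nat -> R[i]) : (forall k, F (k %% n)%N = F k) ->
  \sum_(k < m * n) F k = m%:R * \sum_(k < n) F k.
Proof.
move=> h; rewrite sum_block (eq_bigr (fun=> \sum_(k < n) F k)).
  by rewrite sumr_const card_ord mulr_natl.
move=> i _; apply: eq_bigr => j _; rewrite -h modnMDl.
by rewrite h.
Qed.

(* Writing n = x + p t y, the inner sum over y mod p kills every x with
   f'(x) nonzero mod p. *)
Lemma complete_sum_stationary (p t : nat) f : (0 < p)%N -> (0 < t)%N ->
  complete_sum (p * (t * p)) f =
    p%:R * \sum_(x < p | (p%:Z %| f^`().[x%:Z])%Z)
      \sum_(z < t) cexp ((f.[x%:Z + p%:Z * z%:Z])%:~R / (p * (t * p))%:R).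
Proof.
move=> p0 t0; set q := (p * (t * p))%N.
have q0 : (0 < q)%N by rewrite /q !muln_gt0 p0 t0.
have p0R : p%:R != 0 :> R by rewrite pnatr_eq0 -lt0n.
have t0R : t%:R != 0 :> R by rewrite pnatr_eq0 -lt0n.
have := @sum_block p (t * p) (fun n => cexp ((f.[n%:Z])%:~R / q%:R)).
rewrite -/q -/(complete_sum q f) exchange_big => -> /=.
pose G (x : nat) : R[i] := if (p%:Z %| f^`().[x%:Z])%Z
  then p%:R * cexp ((f.[x%:Z])%:~R / q%:R) else 0.
have inner (x : nat) : \sum_(y < p) cexp ((f.[(y * (t * p) + x)%N%:Z])%:~R / q%:R) = G x.
  have e (y : 'I_p) : cexp ((f.[(y * (t * p) + x)%N%:Z])%:~R / q%:R : R) =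
      cexp ((f.[x%:Z])%:~R / q%:R) * cexp ((f^`().[x%:Z])%:~R * y%:R / p%:R).
    (* The quadratic Taylor term is a multiple of (t p)^2, hence of q = t p^2, and drops out of the
       phase. *)
    have [c hc] := taylor2 f x%:Z (y * (t * p))%N%:Z.
    rewrite -cexpD; apply: (@cexp_eq _ _ _ (y%:Z * y%:Z * t%:Z * c)).
    rewrite PoszD addrC hc !rmorphD !rmorphM /= ?rmorphXn /= -?pmulrn /q ?natrM.
    by field; rewrite p0R t0R.
  under eq_bigr do rewrite e.
  rewrite -mulr_sumr cexp_orthogonality // /G; case: ifP => _; last by rewrite mulr0.
  by rewrite mulrC.
under eq_bigr do rewrite inner.
rewrite sum_block exchange_big /= [RHS]mulr_sumr [RHS]big_mkcond /=.
apply: eq_bigr => x _.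
have dvdE (z : nat) : (p%:Z %| f^`().[(z * p + x)%N%:Z])%Z = (p%:Z %| f^`().[x%:Z])%Z.
  have h : (p%:Z %| f^`().[(z * p + x)%N%:Z] - f^`().[x%:Z])%Z.
    apply: dvdz_trans (horner_sub_dvdz _ _ _); apply/dvdzP; exists z%:Z; lia.
  by rewrite -[in LHS](subrK (f^`().[x%:Z]) (f^`().[(z * p + x)%N%:Z])) rpredDl.
case: ifP => hx; last by rewrite big1 // => z _; rewrite /G dvdE hx.
rewrite mulr_sumr; apply: eq_bigr => z _; rewrite /G dvdE hx.
by congr (_ * cexp (f.[_]%:~R / _)); lia.
Qed.

End CompleteSums.

(** * Prime moduli *)

Section PrimeModulus.
Context (R : realType) (p : nat).
Hypothesis pp : prime p.
Implicit Types (f g : {poly int}).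

Definition Fp_char (x : 'F_p) : R[i] := cexp ((x : nat)%:R / p%:R).

Lemma Fp_char_int (k : int) : Fp_char k%:~R = cexp (k%:~R / p%:R).
Proof.
set x : 'F_p := k%:~R; rewrite /Fp_char pmulrn; apply: cexp_congr.
  exact: prime_gt0.
by rewrite -(Fp_int_eq0 _ pp) rmorphB /= -pmulrn natr_Zp subrr.
Qed.

Lemma sum_Fp (G : nat -> R[i]) : \sum_(x : 'F_p) G x = \sum_(t < p) G t.
Proof. by rewrite -!(big_mkord predT G) Fp_cast. Qed.

Lemma Fp_charD x y : Fp_char (x + y) = Fp_char x * Fp_char y.
Proof.
rewrite -[x]natr_Zp -[y]natr_Zp -natrD !pmulrn !Fp_char_int -cexpD.
by rewrite -mulrDl -!pmulrn natrD.
Qed.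

Lemma cabs_Fp_char x : cabs (Fp_char x) = 1.
Proof. exact: cabs_cexp. Qed.

Lemma Fp_char_orthogonality (a : 'F_p) :
  \sum_x Fp_char (a * x) = if a == 0 then #|'F_p|%:R else 0.
Proof.
pose k : int := (a : nat)%:Z.
have ak : a = k%:~R by rewrite -pmulrn natr_Zp.
rewrite (eq_bigr (fun x : 'F_p => cexp (k%:~R * (x : nat)%:R / p%:R))); last first.
  move=> x _; rewrite {1}ak -{1}[x]natr_Zp [(nat_of_ord x)%:R]pmulrn -rmorphM Fp_char_int.
  by rewrite rmorphM.
rewrite (sum_Fp (fun t => cexp (k%:~R * t%:R / p%:R))) cexp_orthogonality ?prime_gt0 //.
by rewrite -(Fp_int_eq0 _ pp) -ak card_Fp.
Qed.

Lemma complete_sum_Fp f : complete_sum R p f = char_sum Fp_char (red p f).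
Proof.
rewrite /complete_sum /char_sum.
rewrite -(sum_Fp (fun t => cexp ((f.[t%:Z])%:~R / p%:R))); apply: eq_bigr => x _.
have e : x = ((x : nat)%:Z)%:~R by rewrite -pmulrn natr_Zp.
by rewrite [in RHS]e horner_red Fp_char_int.
Qed.

Lemma char_sum_linear (f : {poly 'F_p}) : size f = 2 -> char_sum Fp_char f = 0.
Proof.
move=> sf; have f1 : f`_1 != 0.
  have -> : f`_1 = lead_coef f by rewrite /lead_coef sf.
  by rewrite lead_coef_eq0 -size_poly_gt0 sf.
rewrite /char_sum (eq_bigr (fun x => Fp_char f`_0 * Fp_char (f`_1 * x))).
  by rewrite -mulr_sumr Fp_char_orthogonality (negPf f1) mulr0.
move=> x _; rewrite -Fp_charD (horner_coef_wide x (eq_leq sf)).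
by rewrite !big_ord_recl big_ord0 expr0 mulr1 expr1 addr0.
Qed.

(** The factor d * d! majorises the k * k! of the orbit argument; the 2 comes from p <= 2 (p -
    1). *)
Definition mordell_const (d : nat) : R := (2 * d * d`!)%:R.

(** Reduction mod p may lower the degree to some k with 1 <= k <= d. For k = 1 the sum vanishes; for
    larger k the orbit bound applies, its hypothesis on the characteristic being d < p, and p^(1 -
    1/k) <= p^(1 - 1/d). *)
Lemma mordell d f : (d < p)%N -> (size f <= d.+1)%N -> nonconst_mod p f ->
  cabs (complete_sum R p f) <= mordell_const d * p%:R `^ (1 - d%:R^-1).
Proof.
move=> dp sf nc; rewrite complete_sum_Fp; set g := red p f.
pose k := (size g).-1; have sg : size g = k.+1.
  by move: nc; rewrite /nonconst_mod -/g /k; case: (size g).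
have k1 : (1 <= k)%N by move: nc; rewrite /nonconst_mod -/g sg.
have kd : (k <= d)%N.
  have : (size g <= size f)%N by apply: size_poly.
  by rewrite sg; move: sf; move: (size f); lia.
have p1 : 1 <= p%:R :> R by rewrite ler1n prime_gt0.
have [k2|] := leqP 2 k; last first.
  move=> k2; have e : k = 1%N by lia.
  rewrite char_sum_linear ?sg ?e // cabs0 mulr_ge0 ?powR_ge0 //.
have char0 j : (0 < j <= k)%N -> j%:R != 0 :> 'F_p.
  move=> /andP[j0 jk]; rewrite -(dvdn_pcharf (pchar_Fp pp)).
  by rewrite gtnNdvd //; lia.
have := mordell_orbit Fp_charD cabs_Fp_char Fp_char_orthogonality sg k2 char0.
rewrite card_Fp //; set x := cabs _ => H.
have x0 : 0 <= x by exact: cabs_ge0.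
have D1 : 1 <= mordell_const d.
  by rewrite ler1n !muln_gt0 fact_gt0 /= (leq_trans k1).
apply: (@le_trans _ _ (mordell_const d * p%:R `^ (1 - k%:R^-1))); last first.
  rewrite ler_wpM2l ?(le_trans ler01) // ler_powR // lerD2l lerN2.
  by rewrite lef_pV2 ?posrE ?ltr0n ?ler_nat // (leq_trans k1).
have k0 : (0 < 2 * k)%N by lia.
have D0 : 0 <= mordell_const d by exact: le_trans ler01 D1.
rewrite -(ler_pXn2r k0) ?nnegrE ?mulr_ge0 ?powR_ge0 //.
rewrite exprMn -[X in _ * X]powR_mulrn ?powR_ge0 // -powRrM.
have -> : (1 - k%:R^-1) * (2 * k)%N%:R = (2 * k.-1)%:R :> R.
  have kR : k%:R != 0 :> R by rewrite pnatr_eq0; lia.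
  have e : k%:R = k.-1%:R + 1 :> R by rewrite natr1 prednK.
  have -> : (1 - k%:R^-1) * (2 * k)%N%:R = 2 * (k%:R - 1) :> R.
    by rewrite natrM; field.
  by rewrite natrM e; ring.
rewrite powR_mulrn ?ler0n // => {k0}.
have p2 : (p <= 2 * p.-1)%N by have := prime_gt1 pp; lia.
have ppos : 0 < p%:R ^+ 2 :> R by rewrite exprn_gt0 // ltr0n prime_gt0.
apply: (@le_trans _ _ ((2 * k * k`!)%:R * p%:R ^+ (2 * k.-1))); last first.
  rewrite ler_wpM2r ?exprn_ge0 //; apply: (@le_trans _ _ (mordell_const d)).
    rewrite ler_nat !leq_mul // ?(leq_fact) //.
  by rewrite ler_eXnr //; lia.
rewrite -(ler_pM2r ppos).
have -> : (2 * k * k`!)%:R * p%:R ^+ (2 * k.-1) * p%:R ^+ 2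
    = 2 * (k * k`! * p ^ (2 * k))%:R :> R.
  rewrite -mulrA -exprD (_ : (2 * k.-1 + 2 = 2 * k)%N); last by lia.
  by rewrite -natrX -!natrM !mulnA.
apply: (le_trans _ (ler_wpM2l _ H)) => //.
rewrite [leRHS]mulrCA ler_wpM2l ?exprn_ge0 // expr2 -!natrM ler_nat.
by rewrite mulnCA leq_mul2l p2 orbT.
Qed.

End PrimeModulus.

(** * Reduction mod p and local expansions *)

Section NonconstMod.
Implicit Types (f g : {poly int}).

Lemma nonconst_modP p f : prime p ->
  reflect (exists2 i, (0 < i)%N & ~~ (p%:Z %| f`_i)%Z) (nonconst_mod p f).
Proof.
move=> pp; apply: (iffP idP) => [h|[i i0 h]].
  exists (size (red p f)).-1; first by move: h; rewrite /nonconst_mod; case: size => // -[].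
  rewrite -(Fp_int_eq0 _ pp) -coef_red -[_`_ _]/(lead_coef _) lead_coef_eq0.
  by rewrite -size_poly_gt0 (leq_trans _ h).
rewrite /nonconst_mod ltnNge; apply/negP => h1.
have : (red p f)`_i = 0 by apply: nth_default; apply: leq_trans h1 _.
by rewrite coef_red => /eqP; rewrite Fp_int_eq0 // (negPf h).
Qed.

Lemma nonconst_modZ p f (u : int) : prime p -> coprimez u p ->
  nonconst_mod p f -> nonconst_mod p (u *: f).
Proof.
move=> pp cup /(nonconst_modP _ pp)[i i0 h]; apply/nonconst_modP => //.
by exists i => //; rewrite coefZ Gauss_dvdzr // coprimez_sym.
Qed.

Lemma nonconst_mod_shift p f (b : int) :
  nonconst_mod p f -> nonconst_mod p (f \Po ('X + b%:P)).
Proof.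
rewrite /nonconst_mod /red map_comp_poly rmorphD /= map_polyX map_polyC /=.
by rewrite size_comp_poly2 // size_XaddC.
Qed.

Lemma coef_comp_scaleX (A : comNzRingType) (f : {poly A}) (a : A) j :
  (f \Po (a *: 'X))`_j = f`_j * a ^+ j.
Proof.
rewrite comp_polyE coef_sum.
under eq_bigr => i _ do rewrite coefZ exprZn coefZ coefXn.
have [lt_j|le_j] := ltnP j (size f).
  rewrite (bigD1 (Ordinal lt_j)) //= eqxx mulr1 big1 ?addr0 // => i ij.
  rewrite (_ : (j == i) = false) ?mulr0 //.
  by apply: contraNF ij => /eqP ji; apply/eqP/val_inj.
rewrite nth_default // mul0r big1 // => i _.
by rewrite (_ : (j == i) = false) ?mulr0 //; have := ltn_ord i; lia.
Qed.

(** Because d < p, no factor j brought down by differentiation vanishes mod p, so the derivative is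
    a nonzero polynomial mod p. *)
Lemma card_deriv_roots p d f : prime p -> (d < p)%N -> (size f <= d.+1)%N ->
    nonconst_mod p f ->
  (#|[pred x : 'I_p | (p%:Z %| f^`().[x%:Z])%Z]| <= d)%N.
Proof.
move=> pp dp sf /(nonconst_modP _ pp)[j j0 hj].
have jd : (j <= d)%N.
  rewrite leqNgt; apply/negP => dj; move/negP: hj; apply.
  by rewrite nth_default ?dvdz0 //; apply: leq_trans sf dj.
pose h := red p f^`().
have h0 : h != 0.
  apply/eqP => /(congr1 (fun r : {poly 'F_p} => r`_j.-1)).
  rewrite coef_red coef0 coef_deriv prednK //.
  move/eqP; rewrite Fp_int_eq0 // -mulr_natr Gauss_dvdzl ?(negPf hj) //.
  by rewrite natz coprimezE prime_coprime // gtnNdvd //; lia.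
have sh : (size h <= d)%N.
  apply: leq_trans (size_poly _ _) _.
  have [->|f0] := eqVneq f 0; first by rewrite deriv0 size_poly0.
  by have := lt_size_deriv f0; move: sf; move: (size f) (size f^`()); lia.
set P := [pred x | _]; pose s := [seq ((nat_of_ord x)%:R : 'F_p) | x <- enum P].
have : (size s < size h)%N.
  apply: max_poly_roots => //.
    apply/allP => _ /mapP[x + ->]; rewrite mem_enum inE => hx.
    by rewrite /root pmulrn /h horner_red Fp_int_eq0.
  rewrite map_inj_in_uniq ?enum_uniq // => x y _ _ /(congr1 (@nat_of_ord _)).
  by rewrite !val_Fp_nat // !modn_small // => /val_inj.
by rewrite size_map -cardE => /ltnW /leq_trans; apply.
Qed.

(* f(xi + p z) = f(xi) + p^s g(z), with p^s the largest power of p dividing q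
   and all the nonconstant coefficients. *)
Lemma local_expansion p d q f (xi : int) : prime p -> (d < p)%N ->
    (size f <= d.+1)%N -> nonconst_mod p f -> (0 < q)%N -> (p ^ 2 %| q)%N ->
    (p%:Z %| f^`().[xi])%Z ->
  exists s g, [/\ (2 <= s <= d)%N, (p ^ s %| q)%N, (size g <= d.+1)%N,
    forall z, f.[xi + p%:Z * z] = f.[xi] + (p ^ s)%:Z * g.[z] &
    forall l, prime l -> (l %| q %/ p ^ s)%N -> nonconst_mod l f -> nonconst_mod l g].
Proof.
move=> pp dp sf nc q0 p2q hxi; have p0 := prime_gt0 pp.
have pX a : (p ^ a)%N%:Z = p%:Z ^+ a by rewrite -natz natrX natz.
pose c := f \Po ('X + xi%:P).
have ncc : nonconst_mod p c by exact: nonconst_mod_shift.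
have sc : (size c <= d.+1)%N by rewrite /c size_comp_poly2 ?size_XaddC.
have c1 : c`_1 = f^`().[xi].
  have := deriv_comp f ('X + xi%:P); rewrite -/c derivD derivX derivC addr0 mulr1.
  move/(congr1 (fun r : {poly int} => r.[0])); rewrite horner_comp !hornerE horner_coef0 coef_deriv.
  by rewrite mulr1n.
pose h := c \Po (p%:Z *: 'X).
have hE j : h`_j = c`_j * p%:Z ^+ j by exact: coef_comp_scaleX.
have hz z : h.[z] = f.[xi + p%:Z * z].
  by rewrite /h /c !horner_comp !hornerE addrC.
pose P s := ((p ^ s %| q)%N && [forall j : 'I_d.+1, (0 < j)%N ==> ((p ^ s)%:Z %| h`_j)%Z]).
(* In degree 1 one factor p comes from p | f'(xi) and one from the substitution; higher degrees
   already carry p^2. *)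
have P2 : P 2.
  rewrite /P p2q; apply/forallP => -[[|[|j]] jd] //=; rewrite hE.
    by rewrite c1 expr1 pX expr2 dvdz_mul.
  by rewrite dvdz_mull // pX -[j.+2]/(2 + j)%N exprD dvdz_mulr.
have Pq s : P s -> (s <= q)%N.
  move=> /andP[psq _]; apply: leq_trans (dvdn_leq q0 psq).
  by rewrite ltnW // ltn_expl // prime_gt1.
have [s /andP[psq /forallP hs] smax] := ex_maxnP (ex_intro P 2%N P2) Pq.
pose g := \poly_(j < d.+1) (if j == 0%N then 0 else (h`_j %/ (p ^ s)%:Z)%Z).
have hg j : (0 < j)%N -> h`_j = (p ^ s)%:Z * g`_j.
  move=> j0; rewrite coef_poly; case: ltnP => [jd|dj].
    rewrite (gtn_eqF j0); have /implyP/(_ j0) := hs (Ordinal jd).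
    by move=> /divzK /= {1}<-; rewrite mulrC.
  by rewrite hE nth_default ?mul0r ?mulr0 //; apply: leq_trans sc dj.
exists s, g; split.
(* Some c_j with 0 < j <= d is prime to p. If s > d, then p^s | c_j p^j would force p | c_j. *)
- rewrite smax //=; rewrite leqNgt; apply/negP => ds.
  have /(nonconst_modP _ pp)[j j0 hj] := ncc; case/negP: hj.
  have [jd|dj] := ltnP j d.+1; last by rewrite nth_default ?dvdz0 // (leq_trans sc).
  have /implyP/(_ j0) := hs (Ordinal jd); rewrite hE /=.
  have -> : (p ^ s)%N%:Z = p%:Z ^+ (s - j) * p%:Z ^+ j.
    by rewrite -exprD subnK ?pX //; apply: ltnW; apply: leq_trans ds.
  rewrite dvdz_mul2r ?expf_neq0 //; last by lia.
  apply: dvdz_trans; rewrite (_ : (s - j = (s - j).-1.+1)%N); last by lia.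
  by rewrite exprS dvdz_mulr.
- exact: psq.
- exact: size_poly.
- move=> z; rewrite -hz.
  have -> : f.[xi] = h`_0.
    by rewrite -horner_coef0 hz mulr0 addr0.
  have sh : (size h <= d.+1)%N.
    by apply/leq_sizeP => j dj; rewrite hE nth_default ?mul0r // (leq_trans sc).
  rewrite (horner_coef_wide z sh) (horner_coef_wide z (size_poly _ _)).
  have g0 : g`_0 = 0 by rewrite coef_poly.
  rewrite -/g !big_ord_recl !expr0 !mulr1 g0 add0r mulr_sumr.
  by congr (_ + _); apply: eq_bigr => j _; rewrite hg // mulrA.
(* For l = p, maximality of s provides a coefficient not divisible by p^(s+1), since p^(s+1) still
   divides q. For l different from p, the powers of p are units mod l. *)
- move=> l lp ldvd ncl; apply/nonconst_modP => //.
  have [lE|lp'] := eqVneq l p.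
    have : ~~ P s.+1 by apply/negP => /smax; rewrite ltnn.
    rewrite /P; have -> : (p ^ s.+1 %| q)%N.
      by rewrite -(divnK psq) expnS dvdn_pmul2r ?expn_gt0 ?p0 //; rewrite lE in ldvd.
    move=> /forallPn[[j jd]]; rewrite negb_imply /= => /andP[j0 hj]; exists j => //.
    apply: contra hj; rewrite hg // expnSr PoszM lE => hd; exact: dvdz_mul.
  have cpl a : coprime (p ^ a) l.
    by rewrite coprimeXl // prime_coprime // dvdn_prime2 // eq_sym.
  have /(nonconst_modP _ lp)[j j0 hj] : nonconst_mod l c by exact: nonconst_mod_shift.
  exists j => //; apply: contra hj => hd.
  have : (l%:Z %| h`_j)%Z by rewrite hg // dvdz_mull.
  rewrite hE -pX Gauss_dvdzl //.
  by rewrite coprimez_sym coprimezE; exact: cpl.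
Qed.

End NonconstMod.

(** * Complete sums to composite moduli *)

Section CompleteSumBound.
Context (R : realType).
Implicit Types (f g : {poly int}) (e : R).

Lemma cabs_stationary_le p d t f (B : R) : prime p -> (d < p)%N ->
    (size f <= d.+1)%N -> nonconst_mod p f -> (0 < t)%N -> 0 <= B ->
    (forall x : int, (p%:Z %| f^`().[x])%Z ->
      cabs (\sum_(z < t) cexp ((f.[x + p%:Z * z%:Z])%:~R / (p * (t * p))%:R : R)) <= B) ->
  cabs (complete_sum R (p * (t * p)) f) <= p%:R * (d%:R * B).
Proof.
move=> pp dp sf nc t0 B0 hB; have p0 := prime_gt0 pp; rewrite complete_sum_stationary //.
rewrite cabsM cabs_nat ler_wpM2l //.
apply: le_trans.
  by apply: (@cabs_le_sum _ _ _ _ _ (fun=> B)) => x; exact: hB.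
rewrite sumr_const -[leLHS]mulr_natl ler_wpM2r // ler_nat.
exact: card_deriv_roots pp dp sf nc.
Qed.

(** Strong induction on [q] through its least prime p. A simple prime splits off by multiplicativity
    and is bounded by Mordell; a repeated one leaves at most d stationary classes, each passing to
    the modulus q / p^a with 2 <= a <= d. The condition on [mordell_const] lets p^e pay for the
    constant lost at each step. *)
Lemma complete_sum_bound d e q f : (0 < d)%N -> 0 < e -> e <= d%:R^-1 ->
    (0 < q)%N -> (size f <= d.+1)%N ->
    (forall p, prime p -> (p %| q)%N ->
      [/\ (d < p)%N, mordell_const R d <= p%:R `^ e & nonconst_mod p f]) ->
  cabs (complete_sum R q f) <= q%:R `^ (1 - (d%:R^-1 - e)).
Proof.
move=> d0 e0 ed; set s := _ - e; have s0 : 0 <= s by rewrite subr_ge0.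
have dR : 0 < d%:R :> R by rewrite ltr0n.
elim/ltn_ind: q f => q IH f q0 sf hp.
have [q1|q1] := leqP q 1.
  have -> : q = 1%N by lia.
  rewrite powR1 /complete_sum big_ord1.
  by rewrite cabs_cexp.
pose p := pdiv q; have pp : prime p by exact: pdiv_prime.
have pq : (p %| q)%N by exact: pdiv_dvd.
have p0 := prime_gt0 pp; have p1 : 1 <= p%:R :> R by rewrite ler1n.
have [dp Dp nc] := hp p pp pq.
have powp x y : p%:R `^ (x + y) = p%:R `^ x * p%:R `^ y :> R.
  by rewrite powRD // pnatr_eq0 -lt0n p0 implybT.
have [r qE] : exists r, q = (p * r)%N.
  by exists (q %/ p)%N; rewrite mulnC divnK.
have r0 : (0 < r)%N by move: q0; rewrite qE muln_gt0 => /andP[].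
have rq : (r < q)%N by rewrite qE ltn_Pmull // prime_gt1.
have [pr|npr] := boolP (p %| r)%N; last first.
  have cpr : coprime p r by rewrite prime_coprime.
  have [u [v [cu cv hS]]] := complete_sum_mul R f p0 r0 cpr.
  rewrite qE hS cabsM natrM powRM // ler_pM ?cabs_ge0 //.
    apply: le_trans (mordell R pp dp _ _) _.
    - exact: leq_trans (size_scale_leq _ _) sf.
    - exact: nonconst_modZ.
    by rewrite /s opprB addrCA [leRHS]powp ler_wpM2r ?powR_ge0.
  apply: IH => //; first exact: leq_trans (size_scale_leq _ _) sf.
  move=> l lp lr; have lq : (l %| q)%N by rewrite qE dvdn_mull.
  have [hl1 hl2 hl3] := hp l lp lq.
  split=> //; apply: nonconst_modZ => //.
  by move: cv; rewrite !coprimezE => /coprime_dvdr; apply.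
have [t rE] : exists t, r = (t * p)%N by exists (r %/ p)%N; rewrite divnK.
have t0 : (0 < t)%N by move: r0; rewrite rE muln_gt0 => /andP[].
have qE2 : q = (p * (t * p))%N by rewrite qE rE.
have p2q : (p ^ 2 %| q)%N by rewrite qE2 mulnCA mulnC mulnn dvdn_mulr.
(* Chosen so that p * (d * B) is exactly the bound claimed. *)
pose B : R := p%:R^-1 * (d%:R^-1 * q%:R `^ (1 - s)).
have B0 : 0 <= B by rewrite !mulr_ge0 ?invr_ge0 ?powR_ge0.
have -> : q%:R `^ (1 - s) = p%:R * (d%:R * B).
  have p0R : p%:R != 0 :> R by rewrite pnatr_eq0 -lt0n.
  by rewrite /B; field; rewrite p0R gt_eqF.
rewrite {1}qE2; apply: cabs_stationary_le => // x hx; rewrite -qE2.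
have [a [g [/andP[a2 ad] paq sg hg hl]]] := local_expansion pp dp sf nc q0 p2q hx.
have a1 : (0 < a)%N by exact: ltnW.
pose q' := (q %/ p ^ a)%N.
have qq' : q = (q' * p ^ a)%N by rewrite divnK.
have q'0 : (0 < q')%N by move: q0; rewrite {1}qq' muln_gt0 => /andP[].
have pa0 : (0 < p ^ a)%N by rewrite expn_gt0 p0.
have tE : t = (p ^ (a - 2) * q')%N.
  have : (p ^ 2 * t = p ^ 2 * (p ^ (a - 2) * q'))%N.
    by rewrite mulnA -expnD subnKC // [RHS]mulnC -qq' qE2 expnS expn1; ring.
  by move/eqP; rewrite eqn_pmul2l ?expn_gt0 ?p0 // => /eqP.
(* The p^a extracted by the expansion cancels against q, and t = p^(a-2) q' consists of p^(a-2) full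
   periods mod q'. *)
have -> : \sum_(z < t) cexp ((f.[x + p%:Z * z%:Z])%:~R / q%:R : R) =
    cexp ((f.[x])%:~R / q%:R) * ((p ^ (a - 2))%:R * complete_sum R q' g).
  rewrite /complete_sum -(@sum_periodic R _ _ (fun z => cexp ((g.[z%:Z])%:~R / q'%:R))).
    rewrite -tE mulr_sumr; apply: eq_bigr => z _; rewrite -cexpD hg rmorphD rmorphM /=.
    have n1 : q'%:R != 0 :> R by rewrite pnatr_eq0 -lt0n.
    have n2 : (p ^ a)%:R != 0 :> R by rewrite pnatr_eq0 -lt0n.
    have qR : q%:R = q'%:R * (p ^ a)%:R :> R by rewrite -natrM -qq'.
    rewrite -pmulrn; congr cexp; rewrite mulrDl; congr (_ + _).
    by rewrite qR; move: (p ^ a)%:R n2 => u n2; field; rewrite n1 n2.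
  by move=> z; apply: complete_term_periodic => //; rewrite modn_mod.
rewrite !cabsM cabs_cexp mul1r cabs_nat.
have hS : cabs (complete_sum R q' g) <= q'%:R `^ (1 - s).
  apply: IH => //.
    by rewrite [X in (_ < X)%N]qq' ltn_Pmulr // -{1}(exp1n a) ltn_exp2r ?prime_gt1.
  move=> l lp lq'; have lq : (l %| q)%N by rewrite qq' dvdn_mulr.
  by have [h1 h2 h3] := hp l lp lq; split=> //; exact: hl.
apply: (le_trans (ler_wpM2l (ler0n _ _) hS)).
rewrite /B; have -> : q%:R `^ (1 - s) = q'%:R `^ (1 - s) * (p ^ a)%:R `^ (1 - s) :> R.
  by rewrite {1}qq' natrM powRM.
(* The exponent balance: a s <= d s = 1 - d e <= 1 - e, so p^(a (1 - s)) exceeds p^(a-1) by at least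
   p^e, which is at least d. *)
have key : d%:R * p%:R ^+ a.-1 <= ((p ^ a)%:R : R) `^ (1 - s).
  rewrite natrX -powR_mulrn // -powRrM.
  have -> : a%:R * (1 - s) = (1 - a%:R * s) + a.-1%:R.
    have e1 : a%:R = a.-1%:R + 1 :> R by rewrite natr1 prednK.
    by rewrite {1}mulrBr mulr1 {1}e1; ring.
  rewrite powp powR_mulrn // ler_wpM2r ?exprn_ge0 //.
  apply: (@le_trans _ _ (p%:R `^ e)).
    apply: le_trans Dp; rewrite ler_nat -mulnA mulnCA leq_pmulr //.
    by rewrite muln_gt0 fact_gt0.
  apply: ler_powR => //.
  have h1 : a%:R * s <= d%:R * s by rewrite ler_wpM2r // ler_nat.
  have h2 : d%:R * s = 1 - d%:R * e by rewrite /s mulrBr mulfV // gt_eqF.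
  have h3 : e <= d%:R * e by rewrite ler_peMl ?(ltW e0) // ler1n.
  lra.
have pe : (p ^ (a - 2))%:R * p%:R = p%:R ^+ a.-1 :> R.
  by rewrite natrX -exprSr; rewrite -subSn // subSS subn1.
rewrite -(ler_pM2r (_ : 0 < p%:R :> R)) ?ltr0n // -(ler_pM2r dR).
have -> : p%:R^-1 * (d%:R^-1 * (q'%:R `^ (1 - s) * (p ^ a)%:R `^ (1 - s))) * p%:R * d%:R
    = q'%:R `^ (1 - s) * (p ^ a)%:R `^ (1 - s) :> R.
  have p0R : p%:R != 0 :> R by rewrite pnatr_eq0 -lt0n.
  by field; rewrite p0R gt_eqF.
have -> : (p ^ (a - 2))%:R * q'%:R `^ (1 - s) * p%:R * d%:R
    = q'%:R `^ (1 - s) * (d%:R * ((p ^ (a - 2))%:R * p%:R)) :> R by ring.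
by rewrite pe ler_wpM2l ?powR_ge0.
Qed.

(** If l divides q exactly once, the factor mod l is a nontrivial linear character sum; if l^2
    divides q, the derivative is the unit c mod l and there is no stationary point. *)
Lemma complete_sum_unit_linear l q f (c : int) : prime l -> (l %| q)%N -> (0 < q)%N ->
    coprimez c l -> red l f = (c%:~R)%:P * 'X ->
  complete_sum R q f = 0.
Proof.
move=> lp lq q0 cl hf; have l0 := prime_gt0 lp.
have [r qE] : exists r, q = (l * r)%N by exists (q %/ l)%N; rewrite mulnC divnK.
have r0 : (0 < r)%N by move: q0; rewrite qE muln_gt0 => /andP[].
have c0 u : coprimez u l -> u%:~R != 0 :> 'F_l.
  rewrite Fp_int_eq0 // coprimezE coprime_sym prime_coprime //.
have [lr|nlr] := boolP (l %| r)%N.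
  have [t rE] : exists t, r = (t * l)%N by exists (r %/ l)%N; rewrite divnK.
  have t0 : (0 < t)%N by move: r0; rewrite rE muln_gt0 => /andP[].
  rewrite qE rE complete_sum_stationary // big_pred0 ?mulr0 // => x.
  rewrite -(Fp_int_eq0 _ lp) -horner_red /red -deriv_map -/(red l f) hf.
  by rewrite derivM derivC mul0r add0r derivX mulr1 hornerC (negPf (c0 _ cl)).
have clr : coprime l r by rewrite prime_coprime.
have [u [v [cu cv hS]]] := complete_sum_mul R f l0 r0 clr; rewrite qE hS.
rewrite complete_sum_Fp // char_sum_linear ?mul0r //.
rewrite /red map_polyZ -/(red l f) hf -mul_polyC mulrA -polyCM mul_polyC size_scale.
  by rewrite size_polyX.
by rewrite mulf_neq0 // c0.
Qed.

End CompleteSumBound.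

(** * Weyl sums *)

Section DivisorBound.
Local Open Scope nat_scope.

Lemma size_divisors n : size (divisors n) = \prod_(f <- prime_decomp n) f.2.+1.
Proof.
rewrite /divisors; elim: (prime_decomp n) => [|[p e] s IH]; first by rewrite big_nil.
rewrite big_cons /= -{}IH; elim: e => [|e IHe]; first by rewrite mul1n.
by rewrite /= size_merge size_cat size_map IHe; ring.
Qed.

(** Raise e + 1 <= s * 2^(floor(e/s)) to the power s. This serves the small primes, for which only
    p^e >= 2^e is available. *)
Lemma leq_expS_exp2 s e : (0 < s) -> e.+1 ^ s <= s ^ s * 2 ^ e.
Proof.
move=> s0; have h : e.+1 <= s * 2 ^ (e %/ s).
  have h1 : e.+1 <= s * (e %/ s).+1 by rewrite mulnC -ltn_divLR.
  by apply: leq_trans h1 _; rewrite leq_mul2l ltn_expl ?orbT.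
rewrite -(leq_exp2r _ _ s0) in h; apply: (leq_trans h).
rewrite expnMn leq_mul2l -expnM leq_exp2l ?leq_trunc_div ?orbT //.
Qed.

(** Compare the two sides prime by prime. If p >= 2^s then (e + 1)^s <= 2^(e s) <= p^e without loss;
    each of the at most 2^s smaller primes loses a factor s^s, whence the constant. *)
Lemma divisor_bound s : 0 < s ->
  exists2 C, 0 < C & forall m, 0 < m -> size (divisors m) ^ s <= C * m.
Proof.
move=> s0; pose C0 := s ^ s; exists (C0 ^ (2 ^ s)).
  by rewrite !expn_gt0 s0.
move=> m m0; rewrite size_divisors (big_morph (expn^~ s) (fun x y => expnMn x y s) (exp1n s)).
pose c p := if p < 2 ^ s then C0 else 1.
have C00 : 0 < C0 by rewrite expn_gt0 s0.
have h1 : \prod_(f <- prime_decomp m) f.2.+1 ^ s <=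
    \prod_(f <- prime_decomp m) (c f.1 * f.1 ^ f.2).
  rewrite big_seq [leqRHS]big_seq; apply: leq_prod => -[p e].
  move=> /mem_prime_decomp[pp e0 _] /=; rewrite /c.
  case: ltnP => h.
    apply: (leq_trans (leq_expS_exp2 e s0)); rewrite leq_mul2l leq_exp2r ?prime_gt1 //.
    by rewrite orbT.
  rewrite mul1n; apply: (@leq_trans ((2 ^ e) ^ s)); first by rewrite leq_exp2r // ltn_expl.
  by rewrite -expnM mulnC expnM leq_exp2r.
apply: (leq_trans h1); rewrite big_split /= [X in _ * X](_ : _ = m); last first.
  by rewrite [RHS](prod_prime_decomp m0).
rewrite leq_mul2r; apply/orP; right.
have -> : \prod_(f <- prime_decomp m) c f.1 = C0 ^ count (fun p => p < 2 ^ s) (primes m).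
  rewrite /primes; elim: (prime_decomp m) => [|f t IH]; first by rewrite big_nil.
  by rewrite big_cons IH /= /c; case: ifP => _; rewrite ?mul1n ?add0n // add1n expnS.
rewrite leq_pexp2l // -size_filter -[leqRHS](size_iota 0).
apply: uniq_leq_size; first by rewrite filter_uniq ?primes_uniq.
by move=> p; rewrite mem_filter mem_iota => /andP[].
Qed.

End DivisorBound.

(** * Weyl differencing *)

Section WeylDifferencing.
Context (R : realType).
Implicit Types (f : {poly R}) (x y alpha : R) (z : nat -> R[i]).

(** The shifts range up to a fixed N rather than L, so that induction on L leaves the range alone;
    correlations with h >= L are empty sums. *)
Lemma autocorrelation_sum z N L : (L <= N)%N ->
  let A h := \sum_(h <= j < L) z j * (z (j - h)%N)^*%C in
  (\sum_(j < L) z j) * (\sum_(j < L) z j)^*%C =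
    \sum_(j < L) z j * (z j)^*%C + \sum_(1 <= h < N) (A h + (A h)^*%C).
Proof.
elim: L => [|L IH] LN /=.
  rewrite !big_ord0 mul0r add0r big_nat_cond big1 // => h /andP[/andP[h1 _] _].
  by rewrite big_geq // conjc0 addr0.
have conjD (u v : R[i]) : (u + v)^*%C = u^*%C + v^*%C by exact: rmorphD.
have step h : (1 <= h)%N -> \sum_(h <= j < L.+1) z j * (z (j - h)%N)^*%C =
    \sum_(h <= j < L) z j * (z (j - h)%N)^*%C
    + (if (h <= L)%N then z L * (z (L - h)%N)^*%C else 0).
  move=> h1; case: ifP => hL; first by rewrite big_nat_recr.
  by rewrite !big_geq ?addr0 //; lia.
pose B h := if (h <= L)%N then z L * (z (L - h)%N)^*%C else 0.
pose A h := \sum_(h <= j < L) z j * (z (j - h)%N)^*%C.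
have -> : \sum_(1 <= h < N) (\sum_(h <= j < L.+1) z j * (z (j - h)%N)^*%C +
      (\sum_(h <= j < L.+1) z j * (z (j - h)%N)^*%C)^*%C) =
    \sum_(1 <= h < N) (A h + (A h)^*%C) + \sum_(1 <= h < N) (B h + (B h)^*%C).
  rewrite -big_split /= big_nat_cond [RHS]big_nat_cond.
  apply: eq_bigr => h /andP[/andP[h1 _] _]; rewrite step // conjD.
  by rewrite -/(A h) -/(B h) addrACA.
have -> : \sum_(1 <= h < N) (B h + (B h)^*%C) =
    z L * (\sum_(j < L) z j)^*%C + (z L * (\sum_(j < L) z j)^*%C)^*%C.
  have e : \sum_(1 <= h < N) B h = z L * (\sum_(j < L) z j)^*%C.
    rewrite (@big_cat_nat _ _ _ L.+1) //= [X in _ + X]big_nat_cond [X in _ + X]big1 ?addr0.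
      rewrite big_nat_cond (eq_bigr (fun h => z L * (z (L - h)%N)^*%C)); last first.
        by move=> h /andP[/andP[h1 hL] _]; rewrite /B -ltnS hL.
      rewrite -big_nat_cond (rmorph_sum (@conjc _)) mulr_sumr big_add1 /= big_mkord.
      rewrite (reindex_inj rev_ord_inj) /=; apply: eq_bigr => j _.
      by congr (_ * (z _)^*%C); have := ltn_ord j; lia.
    by move=> h /andP[/andP[h1 _] _]; rewrite /B ifF //; lia.
  by rewrite big_split /= e -e (rmorph_sum (@conjc _)).
rewrite !big_ord_recr /= conjD mulrDl !mulrDr (IH (ltnW LN)) conjcM conjcK -/A.
by rewrite [X in _ = X]addrACA -!addrA; congr (_ + (_ + _)); rewrite [(z L)^*%C * _]mulrC; ring.
Qed.

Definition phase_sum (phi : nat -> R) a b : R[i] := \sum_(a <= n < b) cexp (phi n).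

Lemma differencing_bound (phi : nat -> R) a b N : (b - a <= N)%N ->
  cabs (phase_sum phi a b) ^+ 2 <=
    N%:R + 2 * \sum_(1 <= h < N)
      cabs (phase_sum (fun n => phi (n + h)%N - phi n) a (b - h)).
Proof.
move=> LN; set L := (b - a)%N in LN.
pose z j := cexp (phi (a + j)%N).
have zE : phase_sum phi a b = \sum_(j < L) z j.
  rewrite /phase_sum -{1}[a]add0n big_addn big_mkord; apply: eq_bigr => j _.
  by rewrite /z addnC.
pose A h := \sum_(h <= j < L) z j * (z (j - h)%N)^*%C.
have AE h : A h = phase_sum (fun n => phi (n + h)%N - phi n) a (b - h).
  rewrite /A /phase_sum -{1}[h]add0n big_addn -{1}[a in RHS]add0n big_addn.
  rewrite (_ : b - h - a = L - h)%N; last by rewrite /L; lia.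
  rewrite !big_mkord; apply: eq_bigr => j _.
  rewrite /z addnK -cexpN -cexpD; congr (cexp (phi _ - phi _)); lia.
have := autocorrelation_sum z LN; rewrite -zE mulC_conj -/A => h.
rewrite mulr_sumr -lecR h.
have e1 : \sum_(j < L) z j * (z j)^*%C = L%:R.
  rewrite (eq_bigr (fun=> 1)) ?sumr_const ?card_ord // => j _.
  by rewrite mulC_conj /z cabs_cexp expr1n.
rewrite e1 rmorphD rmorph_nat lerD ?ler_nat //.
rewrite (rmorph_sum (real_complex R)); apply: ler_sum => k _ /=.
rewrite -AE; move: (A k) => u.
have -> : u + u^*%C = (2 * complex.Re u)%:C%C.
  by case: u => p q; apply/eqP; rewrite eq_complex /=; apply/andP; split; apply/eqP; ring.
rewrite lecR ler_wpM2l //; exact: le_trans (ler_norm _) (abs_Re_le _).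
Qed.

Lemma sqr_sum_le (I : Type) (r : seq I) (F : I -> R) :
  (\sum_(i <- r) F i) ^+ 2 <= (size r)%:R * \sum_(i <- r) F i ^+ 2.
Proof.
elim: r => [|i r IH]; first by rewrite !big_nil expr0n /= mulr0.
rewrite !big_cons /=; set S := \sum_(j <- r) F j in IH *.
set Q := \sum_(j <- r) F j ^+ 2 in IH *; set n := (size r)%:R in IH *.
have -> : (size r).+1%:R = n + 1 :> R by rewrite natr1.
have h : 2 * F i * S <= n * F i ^+ 2 + Q.
  have : 0 <= \sum_(j <- r) (F i - F j) ^+ 2 by apply: sumr_ge0 => j _; exact: sqr_ge0.
  rewrite (eq_bigr (fun j => F i ^+ 2 - 2 * F i * F j + F j ^+ 2)); last by move=> j _; ring.
  have e : \sum_(j <- r) F i ^+ 2 = n * F i ^+ 2.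
    by rewrite big_const_seq count_predT iter_addr_0 mulr_natl.
  by rewrite big_split sumrB /= e -mulr_sumr -/S -/Q; lra.
have := IH; nra.
Qed.

Lemma power_mean (I : Type) (r : seq I) (F : I -> R) j : (forall i, 0 <= F i) ->
  (\sum_(i <- r) F i) ^+ (2 ^ j) <=
    (size r)%:R ^+ (2 ^ j).-1 * \sum_(i <- r) F i ^+ (2 ^ j).
Proof.
move=> F0; elim: j => [|j IH].
  by rewrite expn0 expr1 expr0 mul1r; under [leRHS]eq_bigr do rewrite expr1.
have S0 k : 0 <= \sum_(i <- r) F i ^+ k by apply: sumr_ge0 => i _; rewrite exprn_ge0.
rewrite expnS mulnC exprM.
apply: (@le_trans _ _ (((size r)%:R ^+ (2 ^ j).-1 * \sum_(i <- r) F i ^+ (2 ^ j)) ^+ 2)).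
  rewrite lerXn2r ?nnegrE ?exprn_ge0 ?sumr_ge0 //.
  by rewrite mulr_ge0 ?exprn_ge0.
rewrite exprMn -exprM; apply: (le_trans (ler_wpM2l _ (sqr_sum_le _ _))).
  by rewrite exprn_ge0.
rewrite mulrA -exprSr; under eq_bigr do rewrite -exprM.
rewrite (_ : ((2 ^ j).-1 * 2).+1 = (2 ^ j * 2).-1)%N //.
have : (0 < 2 ^ j)%N by rewrite expn_gt0.
by move: (2 ^ j)%N => K; lia.
Qed.

Lemma exprD_le x y K : 0 <= x -> 0 <= y -> (x + y) ^+ K <= 2 ^+ K * (x ^+ K + y ^+ K).
Proof.
move=> x0 y0; wlog xy : x y x0 y0 / x <= y.
  move=> H; have [/H->//|/ltW/H] := leP x y.
  by rewrite [y + x]addrC [y ^+ K + _]addrC; apply.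
apply: (@le_trans _ _ ((2 * y) ^+ K)).
  by rewrite lerXn2r ?nnegrE ?addr_ge0 ?mulr_ge0 //; lra.
by rewrite exprMn ler_wpM2l ?exprn_ge0 // lerDr exprn_ge0.
Qed.

Section WeylInduction.
Variables (N : nat) (g : R -> R).
Hypothesis g0 : forall x, 0 <= g x.
Hypothesis linear_le : forall c alpha a b, (b - a <= N)%N ->
  cabs (\sum_(a <= n < b) cexp (c + alpha * n%:R)) <= g alpha.

(** The sum of g(alpha h_1 ... h_j) over all shifts h_i in [1, N): the linear sums that remain after
    j differencings, with an abstract bound [g] for each of them. *)
Fixpoint weyl_sum j alpha : R :=
  if j is j'.+1 then \sum_(1 <= h < N) weyl_sum j' (alpha * h%:R) else g alpha.

Lemma weyl_sum_ge0 j alpha : 0 <= weyl_sum j alpha.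
Proof.
by elim: j alpha => [|j IH] alpha //=; apply: sumr_ge0 => h _; exact: IH.
Qed.

(** With K = 2^j', one factor 2^K comes from splitting the K-th power of a sum, another from the 2
    in the differencing bound; the last 2 merges the diagonal term with the rest. *)
Fixpoint weyl_const j : nat :=
  if j is j'.+1 then (4 ^ (2 ^ j') * (2 * weyl_const j'))%N else 1%N.

Lemma weyl_const_gt0 j : (0 < weyl_const j)%N.
Proof. by elim: j => //= j IH; rewrite !muln_gt0 expn_gt0. Qed.

(** One differencing lowers the degree by one and turns the leading coefficient c into (j + 2) c h.
    The factorial in the argument of [weyl_sum] absorbs these integers, so that only the shifts
    multiply [alpha]. *)
Lemma weyl_inequality j f a b : (b - a <= N)%N -> (size f <= j.+2)%N ->
  cabs (phase_sum (fun n => f.[n%:R]) a b) ^+ (2 ^ j) <=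
    (weyl_const j)%:R * (N%:R ^+ (2 ^ j).-1
      + N%:R ^+ (2 ^ j - j.+1) * weyl_sum j (j.+1`!%:R * f`_j.+1)).
Proof.
elim: j f a b => [|j IH] f a b ab sf.
  rewrite expn0 expr1 subnn !expr0 !mul1r /=.
  rewrite (_ : phase_sum _ a b = \sum_(a <= n < b) cexp (f`_0 + f`_1 * n%:R)); last first.
    apply: eq_bigr => n _; rewrite (horner_coef_wide _ sf) !big_ord_recl big_ord0.
    by rewrite expr0 mulr1 expr1 addr0.
  by rewrite (le_trans (linear_le _ _ ab)) // lerDr.
set K := (2 ^ j)%N in IH.
have K0 : (0 < K)%N by rewrite expn_gt0.
have jK : (j < K)%N by exact: ltn_expl.
set alpha := (j.+2`!)%:R * f`_j.+2.
pose Th h := cabs (phase_sum (fun n => f.[(n + h)%N%:R] - f.[n%:R]) a (b - h)).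
have Th0 h : 0 <= Th h by exact: cabs_ge0.
have hT h : Th h ^+ K <= (weyl_const j)%:R * (N%:R ^+ K.-1
      + N%:R ^+ (K - j.+1) * weyl_sum j (alpha * h%:R)).
  pose fh := f \Po (1 *: 'X + (h%:R)%:P) - f.
  have hE n : fh.[n%:R] = f.[(n + h)%N%:R] - f.[n%:R].
    by rewrite /fh !hornerE horner_comp !hornerE natrD.
  have sfh : (size fh <= j.+2)%N.
    apply/leq_sizeP => i; rewrite leq_eqVlt => /orP[/eqP <-|ji].
      by rewrite coefB coef_comp_affine_top // expr1n mulr1 subrr.
    rewrite coefB (@nth_default _ _ f) ?(leq_trans sf) // subr0 nth_default //.
    apply: leq_trans ji; rewrite scale1r; apply: leq_trans sf.
    by rewrite size_comp_poly2 // size_XaddC.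
  have -> : alpha * h%:R = (j.+1)`!%:R * fh`_j.+1.
    rewrite coefB coef_comp_affine_subtop // expr1n mul1r /alpha factS natrM; ring.
  have := IH fh a (b - h)%N _ sfh; rewrite /Th.
  rewrite (_ : phase_sum _ _ _ = phase_sum (fun n => fh.[n%:R]) a (b - h)); last first.
    by apply: eq_bigr => n _; rewrite hE.
  by apply; lia.
have N0 : 0 <= N%:R :> R by [].
have hd := differencing_bound (fun n => f.[n%:R]) ab.
have S0 : 0 <= \sum_(1 <= h < N) Th h by apply: sumr_ge0.
rewrite expnS exprM -/K.
apply: (@le_trans _ _ ((N%:R + 2 * \sum_(1 <= h < N) Th h) ^+ K)).
  by rewrite lerXn2r ?nnegrE ?exprn_ge0 ?cabs_ge0 ?addr_ge0 ?mulr_ge0.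
apply: le_trans (exprD_le _ _ _) _ => //; first by rewrite mulr_ge0.
have pm := power_mean (index_iota 1 N) j Th0.
rewrite -/K size_iota in pm.
have hS : (\sum_(1 <= h < N) Th h) ^+ K <= N%:R ^+ K.-1 * \sum_(1 <= h < N) Th h ^+ K.
  apply: (le_trans pm); rewrite ler_wpM2r ?sumr_ge0 // => [i _|]; first by rewrite exprn_ge0.
  by rewrite lerXn2r ?nnegrE // ler_nat; lia.
have hV : \sum_(1 <= h < N) Th h ^+ K <= (weyl_const j)%:R *
    (N%:R ^+ K + N%:R ^+ (K - j.+1) * weyl_sum j.+1 alpha).
  apply: (@le_trans _ _ (\sum_(1 <= h < N) (weyl_const j)%:R * (N%:R ^+ K.-1
      + N%:R ^+ (K - j.+1) * weyl_sum j (alpha * h%:R)))).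
    by apply: ler_sum => h _; exact: hT.
  rewrite -mulr_sumr ler_wpM2l // big_split /= -mulr_sumr lerD2r.
  rewrite big_const_nat iter_addr_0 -[leLHS]mulr_natl -[K in leRHS]prednK // exprS.
  by rewrite ler_wpM2r ?exprn_ge0 // ler_nat; lia.
set V := weyl_sum j.+1 alpha in hV *.
have V0 : 0 <= V by exact: weyl_sum_ge0.
have A1 : 1 <= (weyl_const j)%:R :> R by rewrite ler1n weyl_const_gt0.
set A := (weyl_const j)%:R in hV A1 *.
have -> : (weyl_const j.+1)%:R = 4 ^+ K * (2 * A) :> R.
  by rewrite /= !natrM natrX.
have e4 : 4 ^+ K = 2 ^+ K * 2 ^+ K :> R by rewrite -exprMn; congr (_ ^+ _); ring.
rewrite e4 -!mulrA ler_wpM2l ?exprn_ge0 //.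
rewrite exprMn; have two1 : 1 <= 2 ^+ K :> R by rewrite exprn_ege1 // ler1n.
have hK : (\sum_(1 <= h < N) Th h) ^+ K <=
   A * (N%:R ^+ (2 * K).-1 + N%:R ^+ (2 * K - j.+2) * V).
  apply: (le_trans hS); apply: (le_trans (ler_wpM2l _ hV)); rewrite ?exprn_ge0 //.
  rewrite mulrCA mulrDr mulrA -!exprD.
  rewrite (_ : (K.-1 + K = (2 * K).-1)%N); last by move: K0; clear; lia.
  by rewrite (_ : (K.-1 + (K - j.+1) = 2 * K - j.+2)%N) //; move: jK; clear; lia.
have hN : N%:R ^+ K <= N%:R ^+ (2 * K).-1 :> R.
  case: (N) => [|n]; first by rewrite !expr0n; move: K0; case: (K) => //= ? _; lra.
  apply: ler_weXn2l; first by rewrite ler1n.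
  by move: K0; clear; lia.
set X := N%:R ^+ (2 * K).-1 in hN hK *; set Y := N%:R ^+ _ * V in hK *.
have Y0 : 0 <= Y by rewrite mulr_ge0 ?exprn_ge0.
have X0 : 0 <= X by rewrite exprn_ge0.
apply: (@le_trans _ _ (2 ^+ K * X + 2 ^+ K * (A * (X + Y)))).
  rewrite lerD //; last by rewrite ler_wpM2l ?exprn_ge0.
  by apply: (le_trans hN); rewrite ler_peMl.
rewrite -mulrDr ler_wpM2l ?exprn_ge0 //.
nra.
Qed.

End WeylInduction.
End WeylDifferencing.

(** * Counting multiples near integers *)

Section WeylCounting.
Context (R : realType).
Implicit Types (x y alpha delta : R).

Lemma ler_sum_uniq (I : eqType) (s r : seq I) (G : I -> R) :
    uniq s -> uniq r -> {subset s <= r} -> (forall i, 0 <= G i) ->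
  \sum_(i <- s) G i <= \sum_(i <- r) G i.
Proof.
move=> us ur sr G0; rewrite [leRHS](bigID (mem s)) /= -[leLHS]addr0 lerD ?sumr_ge0 //.
rewrite -[leRHS]big_filter le_eqVlt; apply/orP; left; apply/eqP; apply: perm_big.
apply: uniq_perm; rewrite ?filter_uniq // => x; rewrite mem_filter /=.
by case: (boolP (x \in s)) => // /sr ->.
Qed.

(** An integer has at most as many factorisations h * m as it has divisors. *)
Lemma sum_products_le (A B : nat) (G : nat -> R) (t : R) : (forall m, 0 <= G m) ->
    (forall m, (0 < m < A * B)%N -> (size (divisors m))%:R <= t) ->
  \sum_(1 <= h < A) \sum_(1 <= m < B) G (h * m)%N <= t * \sum_(1 <= m < A * B) G m.
Proof.
move=> G0 ht.
apply: (@le_trans _ _ (\sum_(1 <= h < A) \sum_(1 <= m < A * B | (h %| m)%N) G m)).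
  rewrite big_nat_cond [leRHS]big_nat_cond; apply: ler_sum => h /andP[/andP[h1 hA] _].
  rewrite -[leLHS](big_map (muln h) predT) -[leRHS]big_filter; apply: ler_sum_uniq => //.
  - rewrite map_inj_uniq ?iota_uniq // => m n /eqP; rewrite eqn_pmul2l //.
    by move/eqP.
  - by rewrite filter_uniq // iota_uniq.
  move=> _ /mapP[m + ->]; rewrite mem_filter !mem_index_iota => /andP[m1 mB].
  rewrite dvdn_mulr //= muln_gt0 h1 m1 /=.
  by apply: (@leq_ltn_trans (h * B)); rewrite ?leq_mul2l ?ltn_pmul2r ?(ltnW mB) ?orbT //; lia.
rewrite (exchange_big_dep predT) //= mulr_sumr big_nat_cond [leRHS]big_nat_cond.
apply: ler_sum => m /andP[mAB _]; rewrite -big_filter big_const_seq count_predT iter_addr_0.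
rewrite -[leLHS]mulr_natl ler_wpM2r //; apply: le_trans (ht m mAB); rewrite ler_nat.
have m0 : (0 < m)%N by case/andP: mAB.
apply: uniq_leq_size; first by rewrite filter_uniq ?iota_uniq.
by move=> h; rewrite mem_filter -dvdn_divisors // => /andP[].
Qed.

(** The j + 1 shifts are merged into one variable by j products, each costing a factor [t]. *)
Lemma weyl_sum_le_divisors N (g : R -> R) j (t : R) alpha : (forall x, 0 <= g x) -> 0 <= t ->
    (forall m, (0 < m < N ^ j.+1)%N -> (size (divisors m))%:R <= t) ->
  weyl_sum N g j.+1 alpha <= t ^+ j * \sum_(1 <= m < N ^ j.+1) g (alpha * m%:R).
Proof.
move=> g0 t0; elim: j alpha => [|j IH] alpha ht; first by rewrite expr0 mul1r expn1.
case: (posnP N) => [N0|N0]; first by rewrite /= big_geq ?N0 // mulr_ge0 ?exprn_ge0 ?sumr_ge0.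
apply: (@le_trans _ _ (\sum_(1 <= h < N) t ^+ j *
    \sum_(1 <= m < N ^ j.+1) g (alpha * (h * m)%N%:R))).
  apply: ler_sum => h _; apply: (le_trans (IH (alpha * h%:R) _)).
    move=> m /andP[m0 mN]; apply: ht; rewrite m0 (leq_trans mN) //.
    by rewrite leq_pexp2l.
  rewrite ler_wpM2l ?exprn_ge0 // le_eqVlt; apply/orP; left; apply/eqP.
  by apply: eq_bigr => m _; rewrite natrM mulrA.
rewrite -mulr_sumr exprSr -mulrA ler_wpM2l ?exprn_ge0 // [in leRHS]expnS.
apply: (@sum_products_le N (N ^ j.+1) (fun m => g (alpha * m%:R))) => //.
Qed.

Lemma dist_int_rat_ge (k : int) (q : nat) : (0 < q)%N -> ~~ (q%:Z %| k)%Z ->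
  q%:R^-1 <= dist_int (k%:~R / q%:R : R).
Proof.
move=> q0 hk; have q0R : 0 < q%:R :> R by rewrite ltr0n.
rewrite /dist_int; set n := nint _.
have -> : k%:~R / q%:R - n%:~R = (k - n * q%:Z)%:~R / q%:R :> R.
  by rewrite rmorphB rmorphM /= -pmulrn; field; rewrite gt_eqF.
rewrite normrM normfV (gtr0_norm q0R) -{1}[q%:R^-1]mul1r ler_pM2r ?invr_gt0 //.
apply: int_ge1; apply: contra hk; rewrite subr_eq0 => /eqP ->.
exact: dvdz_mull.
Qed.

(** For r = n - m <= q/2, the fraction a r / q stays 1/q away from the integers, while replacing it
    by alpha r moves it by at most (q/2) / q^2. *)
Lemma spacing alpha (a : int) (q m n : nat) : (0 < q)%N -> coprimez a q ->
    `|alpha - a%:~R / q%:R| <= q%:R ^- 2 -> (m < n)%N -> (2 * (n - m) <= q)%N ->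
  (2 * q%:R)^-1 <= dist_int (alpha * n%:R - alpha * m%:R).
Proof.
move=> q0 caq ha mn nm; have q0R : 0 < q%:R :> R by rewrite ltr0n.
set r := (n - m)%N in nm; have r0 : (0 < r)%N by rewrite subn_gt0.
have -> : alpha * n%:R - alpha * m%:R = alpha * r%:R by rewrite -mulrBr natrB // ltnW.
have h1 : q%:R^-1 <= dist_int ((a * r%:Z)%:~R / q%:R : R).
  apply: dist_int_rat_ge => //; rewrite Gauss_dvdzr 1?coprimez_sym //.
  by rewrite dvdzE /= gtnNdvd //; lia.
have h2 : dist_int ((a * r%:Z)%:~R / q%:R - alpha * r%:R) <= (2 * q%:R)^-1.
  apply: (le_trans (dist_int_abs _)).
  have -> : (a * r%:Z)%:~R / q%:R - alpha * r%:R = (a%:~R / q%:R - alpha) * r%:R.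
    by rewrite rmorphM /= -pmulrn; field; rewrite gt_eqF.
  rewrite normrM distrC normr_nat; apply: (le_trans (ler_wpM2r _ ha)) => //.
  have : r%:R <= q%:R / 2 :> R by rewrite ler_pdivlMr // -natrM ler_nat mulnC.
  move=> h; have -> : (2 * q%:R)^-1 = q%:R ^- 2 * (q%:R / 2) :> R.
    by field; rewrite gt_eqF.
  by rewrite ler_wpM2l // invr_ge0 exprn_ge0.
have := dist_intD ((a * r%:Z)%:~R / q%:R - alpha * r%:R) (alpha * r%:R).
rewrite subrK; move: h1 h2.
have -> : q%:R^-1 = 2 * (2 * q%:R)^-1 :> R by field; rewrite gt_eqF.
by move: (2 * q%:R)^-1 => u; lra.
Qed.

(** The signed residues of the counted m lie in an interval of length 2 delta. In a block of
    floor(q/2) + 1 integers they are 1/(2q)-separated, so each cell of that length contains at most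
    one. *)
Lemma count_block alpha delta (a : int) (q m0 L : nat) : (0 < q)%N -> coprimez a q ->
    `|alpha - a%:~R / q%:R| <= q%:R ^- 2 -> (L <= q./2.+1)%N ->
  (count (fun m => (dist_int (alpha * m%:R) < delta)%R) (iota m0 L) <=
     (Num.truncn (4 * q%:R * delta)).+1)%N.
Proof.
move=> q0 caq ha Lq; have q0R : 0 < q%:R :> R by rewrite ltr0n.
pose x (m : nat) : R := alpha * m%:R - (nint (alpha * m%:R))%:~R.
pose P m := dist_int (alpha * m%:R) < delta.
have xP m : P m -> 0 <= x m + delta < 2 * delta.
  by rewrite /P /dist_int -/(x m) ltr_norml; lra.
pose h m := Num.truncn ((x m + delta) * (2 * q%:R)).
set s := [seq m <- iota m0 L | P m].
rewrite -size_filter -/s -(size_map h) -[leqRHS](size_iota 0).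
have q2 : 0 < 2 * q%:R :> R by rewrite mulr_gt0.
apply: uniq_leq_size; last first.
  move=> _ /mapP[m + ->]; rewrite mem_filter => /andP[/xP/andP[h1 h2] _].
  rewrite mem_iota add0n /= ltnS; apply: le_truncn.
  have -> : 4 * q%:R * delta = 2 * delta * (2 * q%:R) by ring.
  by rewrite ler_wpM2r ?ltW.
have us : uniq s by rewrite filter_uniq ?iota_uniq.
have main m n : m \in s -> n \in s -> (m < n)%N -> h m <> h n.
  rewrite !mem_filter !mem_iota => /andP[/xP/andP[m1 m2] /andP[mm mL]].
  move=> /andP[/xP/andP[n1 n2] /andP[nm nL]] mn hmn.
  have nmq : (2 * (n - m) <= q)%N.
    by have := odd_double_half q; move: Lq; rewrite -mul2n; move: (q./2); lia.
  have := spacing q0 caq ha mn nmq.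
  have -> : alpha * n%:R - alpha * m%:R =
      x n - x m + (nint (alpha * n%:R) - nint (alpha * m%:R))%:~R.
    by rewrite /x rmorphB /=; ring.
  rewrite dist_int_periodic => hs; have {hs} := le_trans hs (dist_int_abs _).
  have /andP[] := truncn_itv (mulr_ge0 m1 (ltW q2)); rewrite -/(h m).
  have /andP[] := truncn_itv (mulr_ge0 n1 (ltW q2)); rewrite -/(h n) -hmn.
  rewrite -natr1 => a1 a2 a3 a4; rewrite leNgt => /negP; apply.
  rewrite -(ltr_pM2r q2) mulVf ?gt_eqF // -(gtr0_norm q2) -normrM ltr_norml.
  by rewrite mulrBl; move: a1 a2 a3 a4; rewrite !mulrDl; lra.
rewrite map_inj_in_uniq // => m n ms ns e.
case: (ltngtP m n) => // mn; first by case: (main m n ms ns mn).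
by case: (main n m ns ms mn).
Qed.

Lemma count_all alpha delta (a : int) (q m0 M : nat) : (0 < q)%N -> coprimez a q ->
    `|alpha - a%:~R / q%:R| <= q%:R ^- 2 ->
  (count (fun m => (dist_int (alpha * m%:R) < delta)%R) (iota m0 M) <=
     (M %/ q./2.+1).+1 * (Num.truncn (4 * q%:R * delta)).+1)%N.
Proof.
move=> q0 caq ha; set B := q./2.+1; set c := (Num.truncn _).+1.
elim/ltn_ind: M m0 => M IH m0; have [MB|BM] := leqP M B.
  by apply: (leq_trans (count_block delta m0 q0 caq ha MB)); rewrite leq_pmull.
rewrite -(subnKC (ltnW BM)) iotaD count_cat.
apply: (leq_trans (leq_add (count_block delta m0 q0 caq ha (leqnn _)) (IH (M - B)%N _ _))).
  by rewrite ltn_subrL; lia.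
rewrite -/c subnKC ?(ltnW BM) // -[X in (_ <= (X %/ _).+1 * _)%N](subnKC (ltnW BM)).
by rewrite divnDl ?divnn //= add1n [in leqRHS]mulSn.
Qed.

Lemma count_all_real alpha delta (a : int) (q m0 M : nat) : (0 < q)%N -> coprimez a q ->
    `|alpha - a%:~R / q%:R| <= q%:R ^- 2 -> 0 <= delta ->
  (count (fun m => dist_int (alpha * m%:R) < delta) (iota m0 M))%:R <=
     (2 * M%:R / q%:R + 1) * (4 * q%:R * delta + 1) :> R.
Proof.
move=> q0 caq ha d0; have q0R : 0 < q%:R :> R by rewrite ltr0n.
have := count_all delta m0 M q0 caq ha; rewrite -(ler_nat R) => /le_trans; apply.
rewrite natrM ler_pM //.
  rewrite -natr1 lerD2r ler_pdivlMr // -!natrM ler_nat.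
  have := leq_trunc_div M q./2.+1; have := odd_double_half q; rewrite -mul2n.
  by move: (M %/ q./2.+1)%N (q./2) => u v; nia.
rewrite -natr1 lerD2r truncn_le.
by rewrite !mulr_ge0.
Qed.

End WeylCounting.

(** * Weyl's inequality with explicit exponents *)

Section WeylBound.
Context (R : realType).
Implicit Types (x y u alpha delta : R) (f : {poly R}).

(** For N = u^8 the relevant m are at most N^(j+1) = u^(8 (j+1)). The exponent s = 8 (j+1)^2 is
    chosen so that even the j-th power of the divisor bound costs only one factor u. *)
Lemma divisor_bound_real j : exists2 C : R, 1 <= C & forall u, 1 <= u ->
  exists t : R, [/\ 0 <= t, t ^+ j <= C * u &
    forall m, (0 < m)%N -> m%:R <= u ^+ (8 * j.+1) -> (size (divisors m))%:R <= t].
Proof.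
pose s := (8 * j.+1 * j.+1)%N; have s0 : (0 < s)%N by rewrite !muln_gt0.
have [C0 C00 hC] := divisor_bound s0.
have C1 : 1 <= C0%:R :> R by rewrite ler1n.
exists C0%:R => // u u1; pose X : R := C0%:R * u ^+ (8 * j.+1).
have u0 : 0 <= u by exact: le_trans u1.
have X1 : 1 <= X by rewrite mulr_ege1 // exprn_ege1.
have X0 : 0 <= X by exact: le_trans X1.
exists (X `^ (s%:R^-1)); split; first exact: powR_ge0.
  rewrite -powR_mulrn ?powR_ge0 // -powRrM.
  apply: (@le_trans _ _ (X `^ ((8 * j.+1)%:R^-1))).
    apply: ler_powR => //; rewrite mulrC ler_pdivrMr ?ltr0n //.
    have -> : s%:R = (8 * j.+1)%:R * j.+1%:R :> R by rewrite -natrM.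
    by rewrite mulKf ?pnatr_eq0 // ler_nat.
  rewrite /X powRM ?exprn_ge0 ?(le_trans ler01) //.
  rewrite -[u ^+ _]powR_mulrn // -powRrM mulfV ?pnatr_eq0 // powRr1 //.
  rewrite ler_wpM2r // -[leRHS]powRr1 ?(le_trans ler01) //; apply: ler_powR => //.
  by rewrite invf_le1 ?ltr0n // ler1n.
move=> m m0 mu; rewrite -(ler_pXn2r s0) ?nnegrE ?powR_ge0 //.
rewrite -[leRHS]powR_mulrn ?powR_ge0 // -powRrM mulVf ?pnatr_eq0 -?lt0n // powRr1 //.
rewrite -natrX; apply: (@le_trans _ _ (C0 * m)%:R); first by rewrite ler_nat hC.
by rewrite natrM ler_wpM2l // (le_trans ler01).
Qed.

Lemma phase_linear_le u N c alpha a b : 1 <= u -> (b - a <= N)%N ->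
  cabs (\sum_(a <= n < b) cexp (c + alpha * n%:R)) <=
    (if dist_int alpha < (u ^+ 4)^-1 then N%:R else u ^+ 4).
Proof.
move=> u1 ab; have u4 : 0 < u ^+ 4 by rewrite exprn_gt0 // (lt_le_trans ltr01).
case: ltP => h.
  apply: (@le_trans _ _ (\sum_(a <= n < b) 1)).
    by apply: cabs_le_sum => n _; rewrite cabs_cexp.
  by rewrite big_const_nat iter_addr_0 ler_nat.
have := geom_sum_bound c alpha a b; set S := cabs _ => hS.
have S0 : 0 <= S by exact: cabs_ge0.
have := ler_wpM2r S0 h; rewrite mulrC ler_pdivrMr // => h2.
by apply: (le_trans h2); rewrite ler_piMl // ltW.
Qed.

(** Terms within u^-4 of an integer are bounded by N and counted by rational approximation; all
    others are at most u^4 = N^(1/2). *)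
Lemma near_sum_le u (N M q : nat) (a : int) alpha : 1 <= u -> N%:R = u ^+ 8 ->
    (0 < q)%N -> coprimez a q -> `|alpha - a%:~R / q%:R| <= q%:R ^- 2 ->
  \sum_(1 <= m < M) (if dist_int (alpha * m%:R) < (u ^+ 4)^-1 then N%:R else u ^+ 4) <=
    M%:R * u ^+ 4 + u ^+ 8 * ((2 * M%:R / q%:R + 1) * (4 * q%:R / u ^+ 4 + 1)).
Proof.
move=> u1 Nu q0 caq ha; have u0 : 0 < u by exact: lt_le_trans u1.
have u4 : 0 < u ^+ 4 by rewrite exprn_gt0.
set P := fun m => dist_int (alpha * m%:R) < (u ^+ 4)^-1.
apply: (@le_trans _ _ (\sum_(1 <= m < M) (u ^+ 4 + u ^+ 8 * (P m)%:R))).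
  apply: ler_sum => m _; rewrite /P Nu; case: ifP => _; rewrite ?mulr1 ?mulr0 ?addr0 //.
  by rewrite lerDr ltW.
have e : \sum_(1 <= m < M) u ^+ 8 * (P m)%:R = u ^+ 8 * \sum_(1 <= m < M) (P m)%:R.
  by rewrite mulr_sumr.
rewrite big_split /= e lerD //.
  rewrite big_const_nat iter_addr_0; apply: (@le_trans _ _ ((M - 1)%:R * u ^+ 4)).
    by rewrite mulr_natl.
  by rewrite ler_wpM2r ?(ltW u4) // ler_nat leq_subr.
rewrite ler_wpM2l ?exprn_ge0 ?(ltW u0) // -natr_sum.
apply: (@le_trans _ _ (count P (iota 1 M))%:R); last first.
  by apply: (count_all_real 1 M q0 caq ha); rewrite invr_ge0 ltW.
rewrite ler_nat -sum1_count [leqRHS]big_mkcond /= /index_iota.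
have -> : (\sum_(m <- iota 1 (M - 1)) P m = \sum_(m <- iota 1 (M - 1)) if P m then 1 else 0)%N.
  by apply: eq_bigr => m _; case: (P m).
case: (M) => [|n]; first by rewrite !big_nil.
have -> : iota 1 n.+1 = iota 1 n ++ [:: n.+1] by rewrite -[in LHS](addn1 n) iotaD add1n.
by rewrite subSS subn0 big_cat leq_addr.
Qed.

Lemma weyl_bound j : exists2 C : R, 1 <= C &
  forall (u : R) (N : nat) f (a : int) (q A B : nat),
    1 <= u -> N%:R = u ^+ 8 -> (B - A <= N)%N -> (size f <= j.+3)%N ->
    (0 < q)%N -> coprimez a q ->
    `|(j.+2)`!%:R * f`_j.+2 - a%:~R / q%:R| <= q%:R ^- 2 ->
    u ^+ 2 <= q%:R -> q%:R <= u ^+ (8 * j + 10) ->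
  cabs (phase_sum (fun n => f.[n%:R]) A B) ^+ (2 ^ j.+1) <= C * u ^+ (8 * 2 ^ j.+1 - 1).
Proof.
have n1 : (8 * j.+1 = 8 * j + 8)%N by lia.
have n2 : (8 * j + 8 + 4 <= 8 * j + 14)%N by lia.
have n3 : (8 + (8 * j + 8) <= 8 * j + 14 + 2)%N by lia.
have n4 : (4 + (8 * j + 10) <= 8 * j + 14)%N by lia.
have n5 : (8 <= 8 * j + 14)%N by lia.
have [C1 C11 hC1] := divisor_bound_real j.
set K := (2 ^ j.+1)%N; pose c : R := (weyl_const j.+1)%:R.
have c1 : 1 <= c by rewrite ler1n weyl_const_gt0.
have jK : (j.+2 <= K)%N by exact: ltn_expl.
exists (c * (1 + 16 * C1)); first by nra.
move=> u N f a q A B u1 Nu AB sf q0 caq; set alpha := _ * f`_ _ => ha uq qu.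
have u0 : 0 < u by exact: lt_le_trans u1.
have q0R : 0 < q%:R :> R by rewrite ltr0n.
have u_mono m n : (m <= n)%N -> u ^+ m <= u ^+ n by move=> h; exact: ler_weXn2l.
have up m : 0 < u ^+ m by rewrite exprn_gt0.
pose g x := if dist_int x < (u ^+ 4)^-1 then N%:R else u ^+ 4 : R.
have g0 x : 0 <= g x by rewrite /g; case: ifP => _ //; exact: ltW.
have glin cc al a' b' : (b' - a' <= N)%N ->
    cabs (\sum_(a' <= n < b') cexp (cc + al * n%:R)) <= g al.
  exact: phase_linear_le.
have := weyl_inequality g0 glin AB sf; rewrite -/K -/c -/alpha.
move=> h; apply: (le_trans h); rewrite -mulrA ler_wpM2l ?(le_trans ler01) //.
have [t [t0 tj ht]] := hC1 u u1.
have hV : weyl_sum N g j.+1 alpha <= t ^+ j * \sum_(1 <= m < N ^ j.+1) g (alpha * m%:R).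
  apply: weyl_sum_le_divisors => // m /andP[m0 mN]; apply: ht => //.
  by rewrite exprM -Nu -natrX ler_nat ltnW.
have hS := near_sum_le (N ^ j.+1) u1 Nu q0 caq ha.
have NjE : (N ^ j.+1)%:R = u ^+ (8 * j + 8) :> R.
  by rewrite natrX Nu -exprM n1.
rewrite NjE in hS.
(* The coefficients 1 + 8 + 2 + 4 + 1 add up to 16. The lower bound on q controls the term with 1/q,
   the upper bound the term with q. *)
have hB : u ^+ (8 * j + 8) * u ^+ 4 + u ^+ 8 *
     ((2 * u ^+ (8 * j + 8) / q%:R + 1) * (4 * q%:R / u ^+ 4 + 1)) <= 16 * u ^+ (8 * j + 14).
  have -> : u ^+ 8 * ((2 * u ^+ (8 * j + 8) / q%:R + 1) * (4 * q%:R / u ^+ 4 + 1)) =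
      8 * (u ^+ 4 * u ^+ (8 * j + 8)) + 2 * (u ^+ 8 * (u ^+ (8 * j + 8) / q%:R))
      + 4 * (u ^+ 4 * q%:R) + u ^+ 8.
    have -> : u ^+ 8 = u ^+ 4 * u ^+ 4 by rewrite -exprD.
    have := up 4%N; move: (u ^+ (8 * j + 8)) (u ^+ 4) => z v v0.
    by field; rewrite !gt_eqF.
  have e1 : u ^+ (8 * j + 8) * u ^+ 4 <= u ^+ (8 * j + 14).
    by rewrite -exprD; exact: u_mono.
  have e2 : u ^+ 8 * (u ^+ (8 * j + 8) / q%:R) <= u ^+ (8 * j + 14).
    rewrite mulrA ler_pdivrMr //; apply: (@le_trans _ _ (u ^+ (8 * j + 14) * u ^+ 2)).
      by rewrite -!exprD; exact: u_mono.
    by rewrite ler_wpM2l // ltW.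
  have e3 : u ^+ 4 * q%:R <= u ^+ (8 * j + 14).
    apply: (le_trans (ler_wpM2l (ltW (up 4)) qu)); rewrite -exprD.
    exact: u_mono.
  have e4 : u ^+ 8 <= u ^+ (8 * j + 14) by exact: u_mono.
  by move: e1 e2 e3 e4; rewrite [u ^+ 4 * u ^+ _]mulrC; lra.
have hV2 : weyl_sum N g j.+1 alpha <= (C1 * u) * (16 * u ^+ (8 * j + 14)).
  apply: (le_trans hV); apply: ler_pM => //.
  - by rewrite exprn_ge0.
  - by apply: sumr_ge0.
  - exact: le_trans hS hB.
rewrite !Nu -!exprM.
have k1 : u ^+ (8 * K.-1) <= u ^+ (8 * K - 1).
  by apply: u_mono; move: jK; clear; lia.
have k2 : u ^+ (8 * (K - j.+2)) * weyl_sum N g j.+1 alpha <= 16 * C1 * u ^+ (8 * K - 1).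
  apply: (le_trans (ler_wpM2l (ltW (up _)) hV2)).
  have -> : (8 * K - 1 = 8 * (K - j.+2) + (1 + (8 * j + 14)))%N by move: jK; clear; lia.
  by rewrite !exprD expr1 le_eqVlt; apply/orP; left; apply/eqP; ring.
apply: (le_trans (lerD k1 k2)); rewrite le_eqVlt; apply/orP; left; apply/eqP; ring.
Qed.

End WeylBound.

(** * The size of W *)

Section LcmBound.
Local Open Scope nat_scope.

Lemma lcm_uptoS w : lcm_upto w.+1 = lcmn (lcm_upto w) w.+1.
Proof. by rewrite /lcm_upto big_nat_recr. Qed.

Lemma lcm_upto_gt0 w : 0 < lcm_upto w.
Proof.
elim: w => [|w IH]; first by rewrite /lcm_upto big_geq.
by rewrite lcm_uptoS lcmn_gt0 IH.
Qed.

Lemma dvdn_lcm_upto w m : 0 < m <= w -> m %| lcm_upto w.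
Proof.
elim: w => [|w IH] /andP[m0 mw]; first by move: m0 mw; case: m.
rewrite lcm_uptoS; move: mw; rewrite leq_eqVlt => /orP[/eqP->|mw].
  exact: dvdn_lcmr.
by apply: dvdn_trans (dvdn_lcml _ _); apply: IH; rewrite m0.
Qed.

Lemma lcm_upto_dvdn w n : (forall m, 0 < m <= w -> m %| n) -> lcm_upto w %| n.
Proof.
elim: w => [|w IH] h; first by rewrite /lcm_upto big_geq // dvd1n.
rewrite lcm_uptoS dvdn_lcm; apply/andP; split; last by apply: h; rewrite leqnn.
by apply: IH => m /andP[m0 mw]; apply: h; rewrite m0 leqW.
Qed.

Lemma logn_fact_widen p n N : prime p -> n <= N ->
  logn p n`! = \sum_(1 <= i < N.+1) n %/ p ^ i.
Proof.
move=> pp nN; rewrite logn_fact // [RHS](@big_cat_nat _ _ _ n.+1) //=.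
rewrite [X in _ + X]big_nat_cond [X in _ + X]big1 ?addn0 // => i /andP[/andP[ni _] _].
by rewrite divn_small // (leq_trans ni) // ltnW // ltn_expl // prime_gt1.
Qed.

(** In Legendre's formula the k-th term contributes at least 1, as floor(2n / p^k) >= 1 while
    floor(n / p^k) = 0, and no other term is negative. *)
Lemma prime_dvd_central_bin p k n : prime p -> n < p ^ k <= n.*2 -> p %| 'C(n.*2, n).
Proof.
move=> pp /andP[npk pk2n]; have p0 := prime_gt0 pp.
have n2 : n <= n.*2 by rewrite -addnn leq_addr.
have k0 : 0 < k.
  rewrite lt0n; apply/eqP => k0; move: npk pk2n; rewrite k0 expn0 ltnS leqn0.
  by move=> /eqP ->.
have kN : k < n.*2.+1.
  by rewrite ltnS (leq_trans _ pk2n) // ltnW // ltn_expl // prime_gt1.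
have C0 : 0 < 'C(n.*2, n) by rewrite bin_gt0.
suff : 0 < logn p 'C(n.*2, n) by rewrite logn_gt0 mem_primes => /and3P[].
have e := bin_fact n2; rewrite [n.*2 - n](_ : _ = n) in e; last by rewrite -addnn addnK.
have := congr1 (logn p) e; rewrite !lognM ?muln_gt0 ?fact_gt0 //.
rewrite (logn_fact_widen pp n2) (logn_fact_widen pp (leqnn n.*2)) => h.
rewrite -(ltn_add2r (\sum_(1 <= i < n.*2.+1) n %/ p ^ i
  + \sum_(1 <= i < n.*2.+1) n %/ p ^ i)) add0n h -big_split /=.
have mem_k : k \in index_iota 1 n.*2.+1 by rewrite mem_index_iota k0.
rewrite !(big_rem k mem_k) /= -addSn leq_add //.
  rewrite divn_small // addn0 divn_gt0 // ?expn_gt0 ?p0 //.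
by apply: leq_sum => i _; rewrite addnn -!muln2 leq_divRL ?expn_gt0 ?p0 // mulnAC leq_mul2r leq_trunc_div.
Qed.

(** A prime power up to 2n is either at most n, or a prime power at most n times one more p, and
    that p divides the central binomial coefficient. *)
Lemma lcm_upto_double n : lcm_upto n.*2 %| lcm_upto n * 'C(n.*2, n).
Proof.
apply: lcm_upto_dvdn => m /andP[m0 m2n]; apply/dvdn_partP => // p.
rewrite mem_primes => /and3P[pp _ pm]; rewrite p_part.
have pk2n : p ^ logn p m <= n.*2.
  by apply: leq_trans m2n; apply: dvdn_leq => //; exact: pfactor_dvdnn.
have k0 : 0 < logn p m by rewrite logn_gt0 mem_primes pp m0.
have [le_n|gt_n] := leqP (p ^ logn p m) n.
  by rewrite dvdn_mulr // dvdn_lcm_upto // expn_gt0 prime_gt0.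
rewrite -(prednK k0) expnSr dvdn_mul //.
  apply: dvdn_lcm_upto; rewrite expn_gt0 prime_gt0 //=.
  rewrite -leq_double; apply: leq_trans pk2n; rewrite -{2}(prednK k0) expnS -mul2n.
  by rewrite leq_mul2r prime_gt1 ?orbT.
by apply: (@prime_dvd_central_bin p (logn p m)) => //; rewrite gt_n.
Qed.

Lemma bin_le_exp2 n m : 'C(n, m) <= 2 ^ n.
Proof.
elim: n m => [|n IH] [|m]; rewrite ?bin0 ?bin0n ?expn_gt0 //.
by rewrite binS expnS mul2n -addnn leq_add.
Qed.

(** Doubling with n = ceil(w/2) gives 16^n * 4^n = 2^(6n), and 6n <= 3w + 3 <= 4w as soon as w >= 3:
    this is what the base 16 and the initial cases are for. *)
Lemma lcm_upto_le w : lcm_upto w <= 16 ^ w.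
Proof.
elim/ltn_ind: w => w IH; have [w3|w3] := leqP 3 w; last first.
  by case: w w3 {IH} => [|[|[|]]] // _; rewrite ?lcm_uptoS /lcm_upto big_geq.
set n := uphalf w.
have nw : n < w by rewrite /n; lia.
have w2n : w <= n.*2 by rewrite /n; lia.
have h1 : lcm_upto w <= lcm_upto n.*2.
  apply: dvdn_leq; first exact: lcm_upto_gt0.
  by apply: lcm_upto_dvdn => m /andP[m0 mw]; apply: dvdn_lcm_upto; rewrite m0 (leq_trans mw).
apply: (leq_trans h1).
apply: (leq_trans (dvdn_leq _ (lcm_upto_double n))).
  by rewrite muln_gt0 lcm_upto_gt0 bin_gt0 -addnn leq_addr.
apply: (leq_trans (leq_mul (IH n nw) (bin_le_exp2 _ _))).
rewrite -[16]/(2 ^ 4) -!expnM -expnD leq_exp2l //.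
by rewrite /n; lia.
Qed.

End LcmBound.

(** * Major and minor arcs *)

Section MajorArc.
Context (R : realType).
Implicit Types (beta : R).

Lemma sum_full_period (chi : nat -> R[i]) q a : (forall n, chi (n + q)%N = chi n) ->
  \sum_(a <= n < a + q) chi n = \sum_(n < q) chi n.
Proof.
move=> per; elim: a => [|a IH]; first by rewrite add0n big_mkord.
case: q per IH => [|q] per IH; first by rewrite addn0 big_geq // big_ord0.
have lt_a : (a < a + q.+1)%N by rewrite addnS ltnS leq_addr.
by rewrite -IH addSn big_nat_recr //= [in RHS](big_ltn lt_a) addrC per.
Qed.

Lemma cabs_phase_diff_le beta a b : (a <= b)%N ->
  cabs (\sum_(a <= m < b) cexp (beta * m%:R) - (b%:R - a%:R)%:C%C * cexp (beta * a%:R)) <=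
    16 * `|beta| * (b%:R - a%:R) ^+ 2.
Proof.
move=> ab; have -> : (b%:R - a%:R)%:C%C * cexp (beta * a%:R) =
    \sum_(a <= m < b) cexp (beta * a%:R).
  by rewrite big_const_nat iter_addr_0 -natrB // rmorph_nat mulr_natl.
rewrite -sumrB; apply: (@le_trans _ _ (\sum_(a <= m < b) 16 * (`|beta| * (b%:R - a%:R)))).
  rewrite big_nat_cond [leRHS]big_nat_cond; apply: cabs_le_sum => m /andP[/andP[am mb] _].
  apply: (le_trans (cexp_lip _ _)); rewrite ler_wpM2l // -mulrBr normrM ler_wpM2l //.
  by rewrite -[m%:R - _]natrB // normr_nat -natrB // ler_nat leq_sub2r // ltnW.
rewrite big_const_nat iter_addr_0 -[leLHS]mulr_natl natrB // le_eqVlt; apply/orP; left; apply/eqP.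
by ring.
Qed.

Section Telescoping.
Variables (q Y N : nat) (chi : nat -> R[i]) (V : nat -> nat) (D : nat -> R).
Variables (beta M1 M2 : R).
Hypothesis chi_per : forall n, chi (n + q)%N = chi n.
Hypothesis chi_le1 : forall n, cabs (chi n) <= 1.
Hypothesis YN : (Y <= N)%N.
Hypothesis Vmono : forall m n, (Y <= m)%N -> (m <= n)%N -> (V m <= V n)%N.
Hypothesis V1 : forall m n, (Y <= m <= N)%N -> (n <= q)%N ->
  (V (m + n))%:R - (V m)%:R <= q%:R * M1.
Hypothesis V2 : forall n, (Y <= n < N)%N ->
  `|(V (n + q))%:R - (V n)%:R - q%:R * D n| <= q%:R ^+ 2 * M2.

Let E n := \sum_(0 <= m < V n) cexp (beta * m%:R).

Let Ediff m n : (V m <= V n)%N -> E n - E m = \sum_(V m <= k < V n) cexp (beta * k%:R).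
Proof.
by move=> mn; rewrite /E (@big_cat_nat _ _ _ (V m)) //= addrAC subrr add0r.
Qed.

Let E_le m n : (Y <= m <= N)%N -> (n <= q)%N -> cabs (E (m + n)%N - E m) <= q%:R * M1.
Proof.
move=> YmN nq; have mn : (V m <= V (m + n))%N.
  by case/andP: YmN => Ym _; rewrite Vmono ?leq_addr.
rewrite Ediff //; apply: le_trans (V1 YmN nq); rewrite -natrB //.
rewrite -[leRHS]mulr1 mulr_natl -sumr_const_nat.
by apply: cabs_le_sum => k _; rewrite cabs_cexp.
Qed.

(* E (n + q) - E n is close to q D(n) e(beta V(n)); since chi has period q, the sum
   of chi(n) (E (n + q) - E n) telescopes to two blocks of length q. *)
Lemma telescoping_bound :
  cabs (q%:R * (\sum_(Y <= n < N) chi n * ((D n)%:C%C * cexp (beta * (V n)%:R)))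
        - (\sum_(n < q) chi n) * \sum_(V Y <= m < V N) cexp (beta * m%:R)) <=
    (N - Y)%:R * (16 * `|beta| * (q%:R * M1) ^+ 2 + q%:R ^+ 2 * M2)
    + 2 * (q%:R ^+ 2 * M1).
Proof.
rewrite -(Ediff (Vmono (leqnn Y) YN)); set S := \sum_(n < q) chi n.
have tele : \sum_(Y <= n < N) chi n * (E (n + q)%N - E n) =
    \sum_(N <= n < N + q) chi n * E n - \sum_(Y <= n < Y + q) chi n * E n.
  under eq_bigr => n _ do rewrite mulrBr -{1}chi_per.
  rewrite sumrB; have -> : \sum_(Y <= n < N) chi (n + q)%N * E (n + q)%N =
      \sum_(Y + q <= n < N + q) chi n * E n.
    by rewrite [RHS]big_addn addnK.
  have h1 : \sum_(Y <= n < N + q) chi n * E n =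
      \sum_(Y <= n < N) chi n * E n + \sum_(N <= n < N + q) chi n * E n.
    by rewrite -big_cat_nat ?leq_addr.
  have h2 : \sum_(Y <= n < N + q) chi n * E n =
      \sum_(Y <= n < Y + q) chi n * E n + \sum_(Y + q <= n < N + q) chi n * E n.
    by rewrite -big_cat_nat ?leq_addr ?leq_add2r.
  have := h1; rewrite h2; move: (\sum_(Y <= n < Y + q) _) (\sum_(Y + q <= n < N + q) _).
  move: (\sum_(Y <= n < N) _) (\sum_(N <= n < N + q) _) => x y z t h.
  have -> : t = x + y - z by rewrite -h; ring.
  by ring.
(* Over a block of length q each E(n) differs from E(m) by at most q M1, and the q values of chi add
   up to S. *)
have block m : (Y <= m <= N)%N ->
    cabs (\sum_(m <= n < m + q) chi n * E n - S * E m) <= q%:R ^+ 2 * M1.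
  move=> mYN; rewrite /S -(sum_full_period m chi_per) mulr_suml -sumrB.
  apply: (@le_trans _ _ (\sum_(m <= n < m + q) q%:R * M1)).
    rewrite big_nat_cond [leRHS]big_nat_cond; apply: cabs_le_sum => n /andP[/andP[mn nq] _].
    rewrite -mulrBr cabsM -[leRHS]mul1r ler_pM ?cabs_ge0 //.
    by rewrite -(subnKC mn) E_le // leq_subLR ltnW.
  by rewrite sumr_const_nat addKn -[leLHS]mulr_natl expr2 mulrA.
(* Two errors: freezing the phase on [V(n), V(n+q)) gives the term with beta, and replacing V(n+q) -
   V(n) by q D(n) gives the term with M2. *)
have err n : (Y <= n < N)%N ->
    cabs (q%:R * ((D n)%:C%C * cexp (beta * (V n)%:R)) - (E (n + q)%N - E n)) <=
      16 * `|beta| * (q%:R * M1) ^+ 2 + q%:R ^+ 2 * M2.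
  move=> nYN; have /andP[Yn nN] := nYN.
  have mn : (V n <= V (n + q))%N by rewrite Vmono ?leq_addr.
  have h1 := cabs_phase_diff_le beta mn; rewrite -Ediff // in h1.
  set x : R := (V (n + q))%:R - (V n)%:R in h1.
  have x0 : 0 <= x by rewrite subr_ge0 ler_nat.
  have xq : x <= q%:R * M1 by apply: V1; rewrite ?Yn ?(ltnW nN).
  have -> : q%:R * ((D n)%:C%C * cexp (beta * (V n)%:R)) - (E (n + q)%N - E n) =
      - (E (n + q)%N - E n - x%:C%C * cexp (beta * (V n)%:R))
      - (x - q%:R * D n)%:C%C * cexp (beta * (V n)%:R).
    by rewrite (rmorphB (real_complex R) x) (rmorphM (real_complex R)) rmorph_nat; ring.
  apply: (le_trans (cabsB _ _)); rewrite cabsN cabsM cabs_cexp mulr1 cabs_real lerD ?V2 //.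
  apply: (le_trans h1); rewrite ler_wpM2l ?mulr_ge0 //.
  by rewrite lerXn2r ?nnegrE // (le_trans x0).
have -> : q%:R * (\sum_(Y <= n < N) chi n * ((D n)%:C%C * cexp (beta * (V n)%:R)))
        - S * (E N - E Y) =
    \sum_(Y <= n < N) chi n * (q%:R * ((D n)%:C%C * cexp (beta * (V n)%:R))
       - (E (n + q)%N - E n))
    + ((\sum_(N <= n < N + q) chi n * E n - S * E N)
       - (\sum_(Y <= n < Y + q) chi n * E n - S * E Y)).
  have -> : \sum_(Y <= n < N) chi n * (q%:R * ((D n)%:C%C * cexp (beta * (V n)%:R))
       - (E (n + q)%N - E n)) =
      q%:R * (\sum_(Y <= n < N) chi n * ((D n)%:C%C * cexp (beta * (V n)%:R)))
      - \sum_(Y <= n < N) chi n * (E (n + q)%N - E n).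
    rewrite mulr_sumr -sumrB; apply: eq_bigr => n _; rewrite mulrBr; congr (_ - _).
    by rewrite mulrCA.
  by rewrite tele; ring.
apply: (le_trans (cabsD _ _)); apply: lerD.
  rewrite [leRHS]mulr_natl -sumr_const_nat big_nat_cond [leRHS]big_nat_cond.
  apply: cabs_le_sum => n /andP[nYN _]; rewrite cabsM -[leRHS]mul1r ler_pM ?cabs_ge0 //.
  exact: err.
apply: (le_trans (cabsB _ _)); rewrite mulr_natl mulr2n lerD // block ?YN ?leqnn //.
Qed.

End Telescoping.
End MajorArc.

(** * Dirichlet approximation, Abel summation and increments of powers *)

Section RealEstimates.
Context (R : realType).

Lemma reduced_fraction (a : int) (q : nat) : (0 < q)%N ->
  exists (b : int) (r : nat), [/\ (0 < r <= q)%N, coprimez b r &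
    b%:~R / r%:R = a%:~R / q%:R :> R].
Proof.
move=> q0; pose g := gcdn `|a|%N q.
have g0 : (0 < g)%N by rewrite gcdn_gt0 q0 orbT.
have gq : (g %| q)%N by rewrite dvdn_gcdr.
have ga : (g%:Z %| a)%Z by rewrite dvdzE /= dvdn_gcdl.
exists (a %/ g%:Z)%Z, (q %/ g)%N; split.
- by rewrite divn_gt0 // dvdn_leq //= leq_div.
- have e : `|a|%N = (`|(a %/ g%:Z)%Z| * g)%N by rewrite -{1}(divzK ga) abszM.
  by rewrite coprimezE /= /coprime -(eqn_pmul2r g0) mul1n muln_gcdl -e divnK.
have gR : g%:R != 0 :> R by rewrite pnatr_eq0 -lt0n.
have qR : q%:R != 0 :> R by rewrite pnatr_eq0 -lt0n.
have qgR : (q %/ g)%:R != 0 :> R by rewrite pnatr_eq0 -lt0n divn_gt0 // dvdn_leq.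
rewrite -[in RHS](divzK ga) -[in RHS](divnK gq) rmorphM natrM /= -pmulrn.
by field; rewrite gR qgR.
Qed.

(** Pigeonhole for the n + 1 fractional parts of 0, c, ..., n c in n boxes. Passing to lowest terms
    can only decrease the denominator, so the bound also holds with the reduced one. *)
Lemma dirichlet (c : R) (n : nat) : (0 < n)%N ->
  exists (a : int) (q : nat), [/\ (0 < q <= n)%N, coprimez a q &
    `|c - a%:~R / q%:R| <= (q%:R * n%:R)^-1].
Proof.
move=> n0; have nR : 0 < n%:R :> R by rewrite ltr0n.
pose x (i : nat) : R := i%:R * c - (Num.floor (i%:R * c))%:~R.
have x01 i : 0 <= x i < 1.
  by have := floor_itv (i%:R * c); rewrite /x rmorphD /=; lra.
pose h (i : 'I_n.+1) := Num.truncn (x i * n%:R).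
have hn i : (h i < n)%N.
  have /andP[x0 x1] := x01 i.
  rewrite /h truncn_lt_nat ?mulr_ge0 // -[ltRHS]mul1r ltr_pM2r //.
have [i [j [ij hij]]] : exists i j : 'I_n.+1, (i < j)%N /\ h i = h j.
  have : ~~ injectiveb (fun i => Ordinal (hn i)).
    apply/negP => /injectiveP /leq_card; by rewrite !card_ord ltnn.
  case/injectivePn => i [j ij] [e].
  have : (i : nat) != j by [].
  by rewrite neq_ltn => /orP[?|?]; [exists i, j | exists j, i].
pose q := (j - i)%N.
pose a : int := Num.floor (j%:R * c) - Num.floor (i%:R * c).
have q0 : (0 < q)%N by rewrite subn_gt0.
have qn : (q <= n)%N by rewrite (leq_trans (leq_subr _ _)) // -ltnS.
have qR : 0 < q%:R :> R by rewrite ltr0n.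
have close : `|q%:R * c - a%:~R| <= n%:R^-1.
  have -> : q%:R * c - a%:~R = x j - x i.
    by rewrite /x /a /q natrB ?(ltnW ij) // rmorphB /=; ring.
  have /andP[xi0 _] := x01 i; have /andP[xj0 _] := x01 j.
  have := truncn_itv (mulr_ge0 xi0 (ltW nR)); rewrite -/(h i) hij => /andP[a1 a2].
  have := truncn_itv (mulr_ge0 xj0 (ltW nR)); rewrite -/(h j) => /andP[b1 b2].
  rewrite -(ler_pM2r nR) mulVf ?gt_eqF // -(gtr0_norm nR) -normrM ler_norml.
  by rewrite mulrBl; move: a1 a2 b1 b2; rewrite -natr1; lra.
have [b [r [/andP[r0 rq] cbr e]]] := reduced_fraction a q0.
exists b, r; rewrite r0 (leq_trans rq) //; split=> //; rewrite e.
have -> : c - a%:~R / q%:R = (q%:R * c - a%:~R) / q%:R by field; rewrite gt_eqF.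
rewrite normrM normfV (gtr0_norm qR) ler_pdivrMr //.
apply: (le_trans close); have rR : 0 < r%:R :> R by rewrite ltr0n.
have -> : (r%:R * n%:R)^-1 * q%:R = n%:R^-1 * (q%:R / r%:R) :> R.
  by field; rewrite !gt_eqF.
by rewrite ler_peMr ?invr_ge0 ?(ltW nR) // ler_pdivlMr // mul1r ler_nat.
Qed.

Lemma abel_summation_bound (D : nat -> R) (z : nat -> R[i]) (T : R) a b : 0 <= T ->
    (a <= b)%N -> (forall n, (a <= n <= b)%N -> cabs (\sum_(a <= m < n) z m) <= T) ->
  cabs (\sum_(a <= n < b) (D n)%:C%C * z n) <=
    T * (`|D b| + \sum_(a <= n < b) `|D n.+1 - D n|).
Proof.
move=> T0 ab hT; pose S n := \sum_(a <= m < n) z m.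
have -> : \sum_(a <= n < b) (D n)%:C%C * z n =
    (D b)%:C%C * S b - \sum_(a <= n < b) (D n.+1 - D n)%:C%C * S n.+1.
  rewrite -(subnKC ab); elim: (b - a)%N => [|k IH].
    by rewrite addn0 /S !big_geq // mulr0 subr0.
  rewrite addnS !big_nat_recr ?leq_addr //= IH /S big_nat_recr ?leq_addr //=.
  by rewrite (rmorphB (real_complex R)) /=; ring.
apply: (le_trans (cabsB _ _)); rewrite mulrDr lerD //.
  by rewrite cabsM cabs_real mulrC ler_wpM2r // hT ?ab ?leqnn.
rewrite mulr_sumr big_nat_cond [leRHS]big_nat_cond; apply: cabs_le_sum.
move=> n /andP[/andP[an nb] _]; rewrite cabsM cabs_real mulrC ler_wpM2r //.
by rewrite hT // nb leqW.
Qed.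

Lemma exprD_sub_le (x h Z : R) j : 0 <= x -> 0 <= h -> x + h <= Z ->
  0 <= (x + h) ^+ j.+1 - x ^+ j.+1 <= j.+1%:R * h * Z ^+ j.
Proof.
move=> x0 h0 xhZ; elim: j => [|j /andP[IH1 IH2]].
  by rewrite !expr1 expr0 mulr1 mul1r addrAC subrr add0r h0 lexx.
have Z0 : 0 <= Z by apply: le_trans xhZ; rewrite addr_ge0.
have -> : (x + h) ^+ j.+2 - x ^+ j.+2 =
    (x + h) * ((x + h) ^+ j.+1 - x ^+ j.+1) + h * x ^+ j.+1.
  by rewrite !(exprS _ j.+1); ring.
have hx : 0 <= h * x ^+ j.+1 <= h * Z ^+ j.+1.
  rewrite mulr_ge0 ?exprn_ge0 //= ler_wpM2l // lerXn2r ?nnegrE //.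
  by apply: le_trans xhZ; rewrite lerDl.
have /andP[hx1 hx2] := hx.
have xh0 : 0 <= x + h by rewrite addr_ge0.
apply/andP; split; first by rewrite addr_ge0 // mulr_ge0.
have -> : j.+2%:R * h * Z ^+ j.+1 = Z * (j.+1%:R * h * Z ^+ j) + h * Z ^+ j.+1.
  by rewrite -natr1 exprS; ring.
by rewrite lerD // ler_pM.
Qed.

Lemma exprD_taylor_le (x h Z : R) j : 0 <= x -> 0 <= h -> x + h <= Z ->
  0 <= (x + h) ^+ j.+2 - x ^+ j.+2 - j.+2%:R * h * x ^+ j.+1
    <= j.+2%:R ^+ 2 * h ^+ 2 * Z ^+ j.
Proof.
move=> x0 h0 xhZ; have Z0 : 0 <= Z by apply: le_trans xhZ; rewrite addr_ge0.
have xZ : x <= Z by apply: le_trans xhZ; rewrite lerDl.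
elim: j => [|j /andP[IH1 IH2]].
  have -> : (x + h) ^+ 2 - x ^+ 2 - 2%:R * h * x ^+ 1 = h ^+ 2 by ring.
  by rewrite sqr_ge0 /= expr0 mulr1 ler_peMl ?sqr_ge0 //; lra.
have -> : (x + h) ^+ j.+3 - x ^+ j.+3 - j.+3%:R * h * x ^+ j.+2 =
    (x + h) * ((x + h) ^+ j.+2 - x ^+ j.+2 - j.+2%:R * h * x ^+ j.+1)
    + j.+2%:R * h ^+ 2 * x ^+ j.+1.
  rewrite -[j.+3%:R]natr1 !(exprS _ j.+2) [x ^+ j.+2]exprS; ring.
have xh0 : 0 <= x + h by rewrite addr_ge0.
have r0 : 0 <= j.+2%:R * h ^+ 2 * x ^+ j.+1.
  by apply: mulr_ge0; [apply: mulr_ge0; rewrite // exprn_ge0 | exact: exprn_ge0].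
apply/andP; split; first exact: addr_ge0 (mulr_ge0 xh0 IH1) r0.
apply: (@le_trans _ _ (Z * (j.+2%:R ^+ 2 * h ^+ 2 * Z ^+ j)
    + j.+2%:R * h ^+ 2 * Z ^+ j.+1)).
  rewrite lerD //; first by rewrite ler_pM.
  rewrite ler_wpM2l ?lerXn2r ?nnegrE //.
  by apply: mulr_ge0; rewrite // exprn_ge0.
rewrite -[j.+3%:R]natr1 [Z ^+ j.+1]exprS -subr_ge0.
have -> : (j.+2%:R + 1) ^+ 2 * h ^+ 2 * (Z * Z ^+ j) -
    (Z * (j.+2%:R ^+ 2 * h ^+ 2 * Z ^+ j) + j.+2%:R * h ^+ 2 * (Z * Z ^+ j)) =
    (j.+2%:R + 1) * (h ^+ 2 * (Z * Z ^+ j)) by ring.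
apply: mulr_ge0; first by rewrite addr_ge0.
by apply: mulr_ge0 (sqr_ge0 h) _; apply: mulr_ge0 => //; exact: exprn_ge0.
Qed.

End RealEstimates.

(** * Increments of integer polynomials *)

Section PolynomialIncrements.
Context (R : realType).
Implicit Types (Q : {poly int}) (x h Z A : R).

Definition coef_norm (d : nat) Q : nat := (\sum_(j < d.+1) absz (Q`_j)%R)%N.

Lemma eval_real_wide n Q x : (size Q <= n)%N ->
  eval_real Q x = \sum_(j < n) (Q`_j)%:~R * x ^+ j.
Proof.
move=> sQ; rewrite /eval_real (@horner_coef_wide _ n) ?(leq_trans (size_poly _ _)) //.
by apply: eq_bigr => j _; rewrite coef_map.
Qed.

Lemma eval_real_int Q (n : int) : eval_real Q (n%:~R : R) = (Q.[n])%:~R.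
Proof. by rewrite /eval_real horner_map. Qed.

Lemma eval_real_nat Q (n : nat) : eval_real Q (n%:R : R) = (Q.[n%:Z])%:~R.
Proof. by rewrite -eval_real_int -pmulrn. Qed.

Lemma weighted_coef_le d Q (g : nat -> R) (G : R) : 0 <= G ->
    (forall j, (j < d.+1)%N -> `|g j| <= G) ->
  `|\sum_(j < d.+1) (Q`_j)%:~R * g j| <= (coef_norm d Q)%:R * G.
Proof.
move=> G0 hg; apply: (le_trans (ler_norm_sum _ _ _)).
rewrite /coef_norm natr_sum mulr_suml; apply: ler_sum => j _.
by rewrite normrM -intr_norm -abszE -pmulrn ler_wpM2l // hg.
Qed.

Lemma coef_norm_deriv d Q : (coef_norm d Q^`() <= d.+1 * coef_norm d.+1 Q)%N.
Proof.
rewrite /coef_norm [X in (_ <= _ * X)%N]big_ord_recl mulnDr big_distrr /=.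
apply: leq_trans (leq_addl _ _); apply: leq_sum => j _.
by rewrite coef_deriv -mulr_natr abszM mulnC natz /= leq_mul2r ltn_ord orbT.
Qed.

(** Here and in the next bounds, 1 <= Z lets one power of Z dominate the contributions of all
    degrees, so that only the sum of the absolute coefficients matters. *)
Lemma increment_le d Q x h Z : (size Q <= d.+2)%N -> 0 <= x -> 0 <= h -> x + h <= Z ->
    1 <= Z ->
  `|eval_real Q (x + h) - eval_real Q x| <=
    (coef_norm d.+1 Q)%:R * (d.+1%:R * h * Z ^+ d).
Proof.
move=> sQ x0 h0 xhZ Z1; rewrite !(eval_real_wide _ sQ) -sumrB.
have Z0 : 0 <= Z by exact: le_trans Z1.
under eq_bigr do rewrite -mulrBr.
apply: (@weighted_coef_le _ _ (fun j => (x + h) ^+ j - x ^+ j)).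
  by rewrite !mulr_ge0 ?exprn_ge0.
move=> [|j] jd; first by rewrite !expr0 subrr normr0 !mulr_ge0 ?exprn_ge0.
have /andP[h1 h2] := exprD_sub_le j x0 h0 xhZ.
rewrite ger0_norm //; apply: (le_trans h2).
by apply: ler_pM; rewrite ?mulr_ge0 ?exprn_ge0 ?ler_wpM2r ?ler_nat ?ler_weXn2l.
Qed.

Lemma eval_real_deriv d Q x : (size Q <= d.+2)%N ->
  eval_real Q^`() x = \sum_(j < d.+1) (Q`_j.+1)%:~R * (j.+1%:R * x ^+ j).
Proof.
move=> sQ; rewrite (@eval_real_wide d.+1).
  by apply: eq_bigr => j _; rewrite coef_deriv rmorphMn /= mulrA mulr_natr.
apply/leq_sizeP => j jd; rewrite coef_deriv nth_default ?mul0rn //.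
by rewrite (leq_trans sQ).
Qed.

Lemma taylor_le d Q x h Z : (size Q <= d.+3)%N -> 0 <= x -> 0 <= h -> x + h <= Z ->
    1 <= Z ->
  `|eval_real Q (x + h) - eval_real Q x - h * eval_real Q^`() x| <=
    (coef_norm d.+2 Q)%:R * (d.+2%:R ^+ 2 * h ^+ 2 * Z ^+ d).
Proof.
move=> sQ x0 h0 xhZ Z1; rewrite (eval_real_deriv _ sQ) !(eval_real_wide _ sQ) -sumrB.
have Z0 : 0 <= Z by exact: le_trans Z1.
have -> : h * \sum_(j < d.+2) (Q`_j.+1)%:~R * (j.+1%:R * x ^+ j) =
    \sum_(j < d.+3) (Q`_j)%:~R * (j%:R * h * x ^+ j.-1).
  rewrite [RHS]big_ord_recl !mul0r mulr0 add0r mulr_sumr.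
  by apply: eq_bigr => j _; rewrite lift0 /=; ring.
rewrite -sumrB; under eq_bigr do rewrite -mulrBr -mulrBr.
have G0 : 0 <= d.+2%:R ^+ 2 * h ^+ 2 * Z ^+ d.
  by apply: mulr_ge0; [apply: mulr_ge0; exact: sqr_ge0 | exact: exprn_ge0].
apply: (@weighted_coef_le _ _ (fun j => (x + h) ^+ j - x ^+ j - j%:R * h * x ^+ j.-1)) => //.
move=> [|[|j]] jd.
- by rewrite !expr0 subrr !mul0r subrr normr0.
- by rewrite !expr1 expr0 mulr1 mul1r addrAC addrK subrr normr0.
have /andP[h1 h2] := exprD_taylor_le j x0 h0 xhZ.
rewrite ger0_norm //; apply: (le_trans h2).
have jd2 : j.+2%:R ^+ 2 <= d.+2%:R ^+ 2 :> R by rewrite lerXn2r ?nnegrE // ler_nat.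
apply: ler_pM; rewrite ?exprn_ge0 //.
- by apply: mulr_ge0; exact: sqr_ge0.
- by apply: ler_wpM2r; rewrite ?sqr_ge0.
- by rewrite ler_weXn2l.
Qed.

Lemma deriv_le d Q x Z : (size Q <= d.+2)%N -> 0 <= x <= Z -> 1 <= Z ->
  `|eval_real Q^`() x| <= (coef_norm d.+1 Q)%:R * (d.+1%:R * Z ^+ d).
Proof.
move=> sQ /andP[x0 xZ] Z1; rewrite (eval_real_deriv _ sQ).
have Z0 : 0 <= Z by exact: le_trans Z1.
have -> : \sum_(j < d.+1) (Q`_j.+1)%:~R * (j.+1%:R * x ^+ j) =
    \sum_(j < d.+2) (Q`_j)%:~R * (j%:R * x ^+ j.-1).
  by rewrite [RHS]big_ord_recl mul0r mulr0 add0r.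
apply: (@weighted_coef_le _ _ (fun j => j%:R * x ^+ j.-1)).
  by rewrite mulr_ge0 ?exprn_ge0.
move=> [|j] jd; first by rewrite mul0r normr0 mulr_ge0 ?exprn_ge0.
rewrite ger0_norm ?mulr_ge0 ?exprn_ge0 //= ler_pM ?exprn_ge0 ?ler_nat //.
by apply: (@le_trans _ _ (Z ^+ j)); rewrite ?lerXn2r ?nnegrE ?ler_weXn2l.
Qed.

Lemma deriv_increment_le d Q x h Z : (size Q <= d.+3)%N -> 0 <= x -> 0 <= h ->
    x + h <= Z -> 1 <= Z ->
  `|eval_real Q^`() (x + h) - eval_real Q^`() x| <=
    (coef_norm d.+2 Q)%:R * (d.+2%:R ^+ 2 * h * Z ^+ d).
Proof.
move=> sQ x0 h0 xhZ Z1; have Z0 : 0 <= Z by exact: le_trans Z1.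
have sQ' : (size Q^`() <= d.+2)%N.
  apply/leq_sizeP => j jd; rewrite coef_deriv nth_default ?mul0rn //.
  by rewrite (leq_trans sQ).
apply: (le_trans (increment_le sQ' x0 h0 xhZ Z1)).
have hz : 0 <= h * Z ^+ d by rewrite mulr_ge0 ?exprn_ge0.
have h1 : (coef_norm d.+1 Q^`())%:R <= d.+2%:R * (coef_norm d.+2 Q)%:R :> R.
  by rewrite -natrM ler_nat coef_norm_deriv.
apply: (@le_trans _ _ ((d.+2%:R * (coef_norm d.+2 Q)%:R) * (d.+2%:R * (h * Z ^+ d)))).
  rewrite -[d.+1%:R * h * _]mulrA ler_pM //; first by rewrite mulr_ge0.
  by rewrite ler_wpM2r // ler_nat.
by rewrite le_eqVlt; apply/orP; left; apply/eqP; ring.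
Qed.

End PolynomialIncrements.

(** * Comparison of the two phase sums *)

Section ExponentialSumBound.
Context (R : realType).
Implicit Types (Q : {poly int}) (x y v omega theta beta : R).

(** A natural number, so that it can bound summation ranges and count iterates of [T]; it agrees
    with Q at n >= 1 once Q is known to be nonnegative there. *)
Definition poly_val Q (n : nat) : nat := absz (Q.[n%:Z])%R.

Lemma dist_int_near_rat (q : nat) (a : int) beta : (1 < q)%N -> coprimez a q ->
    `|beta| <= (2 * q%:R)^-1 -> (2 * q%:R)^-1 <= dist_int (a%:~R / q%:R + beta : R).
Proof.
move=> q1 caq hb; have q0 : (0 < q)%N by exact: ltnW.
have qR : 0 < q%:R :> R by rewrite ltr0n.
have ndvd : ~~ (q%:Z %| a)%Z.
  apply/negP => qa; move: caq; rewrite coprimezE /= /coprime => /eqP h.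
  move: qa; rewrite dvdzE /= => qa; have : (q %| gcdn `|a| q)%N by rewrite dvdn_gcd qa dvdnn.
  by rewrite h dvdn1 => /eqP q1'; rewrite q1' in q1.
have h1 := dist_int_rat_ge R q0 ndvd.
set th := _ + beta; have := dist_intB th beta; rewrite /th addrK => h3.
have h4 := dist_int_abs beta; move: h1 h3 hb h4; rewrite -/th.
have -> : q%:R^-1 = 2 * (2 * q%:R)^-1 :> R by field; rewrite gt_eqF.
by move: (2 * q%:R)^-1 => z; lra.
Qed.

Lemma linear_sum_le theta (z : R) (a b : nat) : 0 < z -> z^-1 <= dist_int theta ->
  cabs (\sum_(a <= m < b) cexp (theta * m%:R)) <= z.
Proof.
move=> z0 hz; have := geom_sum_bound 0 theta a b.
rewrite (eq_bigr (fun m => cexp (theta * m%:R))); last by move=> m _; rewrite add0r.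
set S := cabs _ => hS; have S0 : 0 <= S by exact: cabs_ge0.
have := le_trans (ler_wpM2r S0 hz) hS.
by rewrite mulrC ler_pdivrMr // mul1r.
Qed.

Lemma dist_int_natmul (m : nat) x : dist_int (m%:R * x) <= m%:R * dist_int x.
Proof.
apply: (le_trans (dist_int_le _ (m%:Z * nint x))).
by rewrite rmorphM /= -pmulrn -mulrBr normrM normr_nat.
Qed.

Section Arcs.
(* The degree is d = e + 2, and v stands for N^eps; N is a power of y, so that
   the exponents in the Weyl bound are integers. *)
Variables (e : nat) (Q : {poly int}) (N Y : nat) (y v omega : R).
Hypothesis sQ : (size Q <= e.+3)%N.
Hypothesis Qlead : 0 < Q`_e.+2.
Hypothesis Qpos : forall n : nat, (1 <= n)%N -> 0 <= Q.[n%:Z].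
Hypothesis Qmono : forall m n : nat, (1 <= m)%N -> (m <= n)%N -> Q.[m%:Z] <= Q.[n%:Z].
Hypothesis Y1 : (1 <= Y)%N.
Hypothesis YN : (Y <= N)%N.
Hypothesis v2 : 2 <= v.
Hypothesis v_fact : (e.+2)`!%:R <= v.
Hypothesis vy : v ^+ 6 <= y.
Hypothesis yN : y ^+ (8 * 2 ^ e.+1) = N%:R.
Hypothesis Qv : (coef_norm e.+2 Q)%:R <= v.
Hypothesis omega0 : 0 <= omega.
Hypothesis complete_le : forall (a : int) (q : nat), (1 < q)%N -> coprimez a q ->
  cabs (complete_sum R q (a *: Q)) <= q%:R * omega.

Let d := e.+2.
Let D (n : nat) : R := eval_real Q^`() n%:R.
Let V := poly_val Q.
Let n : R := N%:R.
(** This is N^(1/8), and y is its 2^(d-1)-th root. *)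
Let u : R := y ^+ (2 ^ e.+1).
(** The powers of 2 arise because a point shifted by at most N may reach 2N. [M1] then bounds Q' and
    its increments per unit step, [M2] the second-order errors. *)
Let k1 : R := d%:R * 2 ^+ e.+1.
Let k2 : R := d%:R ^+ 2 * 2 ^+ e.
Let M1 : R := k1 * (v * n ^+ e.+1).
Let M2 : R := k2 * (v * n ^+ e).

Let v1 : 1 <= v. Proof. by apply: le_trans v2; rewrite ler1n. Qed.
Let v0 : 0 < v. Proof. exact: lt_le_trans v1. Qed.
Let y1 : 1 <= y. Proof. by apply: le_trans vy; rewrite exprn_ege1. Qed.
Let y0 : 0 < y. Proof. exact: lt_le_trans y1. Qed.
Let u1 : 1 <= u. Proof. by rewrite exprn_ege1. Qed.
Let u0 : 0 < u. Proof. exact: lt_le_trans u1. Qed.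
Let un : n = u ^+ 8. Proof. by rewrite /n /u -yN mulnC exprM. Qed.
Let n1 : 1 <= n. Proof. by rewrite un exprn_ege1. Qed.
Let n0 : 0 < n. Proof. exact: lt_le_trans n1. Qed.
Let yu : y <= u. Proof. by rewrite /u ler_eXnr // expn_gt0. Qed.
Let N0 : (0 < N)%N. Proof. exact: leq_trans YN. Qed.
Let k10 : 0 <= k1. Proof. by rewrite mulr_ge0 ?exprn_ge0. Qed.
Let k20 : 0 <= k2. Proof. by rewrite mulr_ge0 ?exprn_ge0. Qed.
Let M10 : 0 <= M1. Proof. by rewrite !mulr_ge0 ?exprn_ge0 // ltW. Qed.
Let M20 : 0 <= M2. Proof. by rewrite !mulr_ge0 ?exprn_ge0 // ltW. Qed.
Let vpow (j : nat) : (j <= 6)%N -> v ^+ j <= y.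
Proof. by move=> j6; apply: le_trans vy; exact: ler_weXn2l. Qed.

Lemma poly_valE m : (1 <= m)%N -> (V m)%:R = eval_real Q m%:R :> R.
Proof. by move=> m1; rewrite eval_real_nat pmulrn /V /poly_val gez0_abs // Qpos. Qed.

Let twoN : 1 <= 2 * n. Proof. by rewrite (le_trans n1) // ler_peMl ?ler1n // ltW. Qed.

Lemma increment_M1 m h : (1 <= m)%N -> (m <= N)%N -> (h <= N)%N ->
  (V (m + h))%:R - (V m)%:R <= h%:R * M1.
Proof.
move=> m1 mN hN; rewrite !poly_valE ?ltn_addr // natrD; apply: (le_trans (ler_norm _)).
have mh : m%:R + h%:R <= 2 * n :> R by rewrite /n -!natrD -natrM ler_nat mul2n -addnn leq_add.
apply: (le_trans (increment_le sQ _ _ mh twoN)) => //.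
rewrite /M1 /k1 exprMn; apply: (le_trans (ler_wpM2r _ Qv)).
  by rewrite !mulr_ge0 ?exprn_ge0 // ltW.
by rewrite le_eqVlt; apply/orP; left; apply/eqP; rewrite /d; ring.
Qed.

Lemma taylor_M2 m h : (1 <= m)%N -> (m <= N)%N -> (h <= N)%N ->
  `|(V (m + h))%:R - (V m)%:R - h%:R * D m| <= h%:R ^+ 2 * M2.
Proof.
move=> m1 mN hN; rewrite !poly_valE ?ltn_addr // natrD.
have mh : m%:R + h%:R <= 2 * n :> R by rewrite /n -!natrD -natrM ler_nat mul2n -addnn leq_add.
apply: (le_trans (taylor_le sQ _ _ mh twoN)) => //.
rewrite /M2 /k2 exprMn; apply: (le_trans (ler_wpM2r _ Qv)).
  apply: mulr_ge0; first by apply: mulr_ge0; exact: sqr_ge0.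
  by apply: mulr_ge0; apply: exprn_ge0 => //; exact: ltW.
by rewrite le_eqVlt; apply/orP; left; apply/eqP; rewrite /d; ring.
Qed.

Lemma deriv_M1 m : (m <= N)%N -> `|D m| <= M1.
Proof.
move=> mN; have hm : 0 <= (m%:R : R) <= 2 * n.
  by rewrite ler0n /n -natrM ler_nat mul2n -addnn (leq_trans mN) ?leq_addr.
apply: (le_trans (deriv_le sQ hm twoN)).
rewrite /M1 /k1 exprMn; apply: (le_trans (ler_wpM2r _ Qv)).
  by rewrite !mulr_ge0 ?exprn_ge0 // ltW.
by rewrite le_eqVlt; apply/orP; left; apply/eqP; rewrite /d; ring.
Qed.

Lemma deriv_M2 m : (m < N)%N -> `|D m.+1 - D m| <= M2.
Proof.
move=> mN; have hm : m%:R + 1 <= 2 * n :> R.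
  by rewrite natr1 /n -natrM ler_nat mul2n -addnn (leq_trans mN) ?leq_addr.
rewrite /D -natr1; apply: (le_trans (deriv_increment_le sQ _ _ hm twoN)) => //.
rewrite /M2 /k2 exprMn; apply: (le_trans (ler_wpM2r _ Qv)).
  apply: mulr_ge0; first by apply: mulr_ge0 => //; exact: sqr_ge0.
  by apply: mulr_ge0; apply: exprn_ge0 => //; exact: ltW.
by rewrite le_eqVlt; apply/orP; left; apply/eqP; rewrite /d; ring.
Qed.

(** Abel summation removes the weight [D], whose final value is at most [M1] and whose variation is
    at most n [M2]; hence the hypothesis on all truncations B. *)
Lemma weighted_sum_le theta (T : R) : 0 <= T ->
    (forall B, (Y <= B)%N -> (B <= N)%N ->
      cabs (\sum_(Y <= m < B) cexp (theta * (V m)%:R)) <= T) ->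
  cabs (\sum_(Y <= m < N) (D m)%:C%C * cexp (theta * (V m)%:R)) <= T * (M1 + n * M2).
Proof.
move=> T0 hT; apply: (le_trans (abel_summation_bound D T0 YN _)).
  by move=> B /andP[YB BN]; exact: hT.
apply: ler_wpM2l => //; apply: lerD; first exact: deriv_M1.
apply: (@le_trans _ _ (\sum_(Y <= m < N) M2)).
  rewrite big_nat_cond [leRHS]big_nat_cond; apply: ler_sum => m /andP[/andP[_ mN] _].
  exact: deriv_M2.
by rewrite sumr_const_nat -[leLHS]mulr_natl ler_wpM2r // ler_nat leq_subr.
Qed.

(** Telescoping approximates the first sum by S/q times the sum at beta. For q > 1 both sides of the
    comparison are small: |S|/q <= omega, and theta is at least 1/(2q) away from the integers, so
    the geometric sum is at most 2q. For q = 1, S = 1 and the two main terms coincide. *)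
Lemma major_arc_bound theta (a : int) (q : nat) beta : (0 < q)%N -> (q <= N)%N ->
    coprimez a q -> theta = a%:~R / q%:R + beta -> `|beta| <= (2 * q%:R)^-1 ->
  cabs (\sum_(Y <= m < N) (D m)%:C%C * cexp (theta * (V m)%:R)
        - \sum_(V Y <= m < V N) cexp (theta * m%:R)) <=
    omega * ((V N)%:R - (V Y)%:R)
    + (n * (16 * (`|beta| * q%:R) * M1 ^+ 2 + q%:R * M2) + 2 * (q%:R * M1) + 2 * q%:R).
Proof.
move=> q0 qN caq thE hb; have qR : 0 < q%:R :> R by rewrite ltr0n.
pose chi m : R[i] := cexp (((a *: Q).[m%:Z])%:~R / q%:R).
have chi_per m : chi (m + q)%N = chi m.
  by apply: complete_term_periodic => //; rewrite modnDr.
have chi1 m : cabs (chi m) <= 1 by rewrite cabs_cexp.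
have Vmono i j : (Y <= i)%N -> (i <= j)%N -> (V i <= V j)%N.
  move=> Yi ij; have i1 := leq_trans Y1 Yi.
  by rewrite -lez_nat /V /poly_val !gez0_abs ?Qpos ?Qmono // (leq_trans i1).
have H1 i j : (Y <= i <= N)%N -> (j <= q)%N -> (V (i + j))%:R - (V i)%:R <= q%:R * M1.
  move=> /andP[Yi iN] jq; apply: (le_trans (increment_M1 _ iN _)).
  - exact: leq_trans Yi.
  - exact: leq_trans qN.
  - by rewrite ler_wpM2r // ler_nat.
have H2 i : (Y <= i < N)%N -> `|(V (i + q))%:R - (V i)%:R - q%:R * D i| <= q%:R ^+ 2 * M2.
  move=> /andP[Yi iN]; apply: taylor_M2 => //; first exact: leq_trans Yi.
  exact: ltnW.
have := telescoping_bound beta chi_per chi1 YN Vmono H1 H2.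
have -> : \sum_(Y <= i < N) chi i * ((D i)%:C%C * cexp (beta * (V i)%:R)) =
    \sum_(Y <= m < N) (D m)%:C%C * cexp (theta * (V m)%:R).
  rewrite big_nat_cond [RHS]big_nat_cond; apply: eq_bigr => m /andP[/andP[Ym _] _].
  rewrite mulrCA -cexpD; congr (_ * cexp _).
  rewrite /chi hornerZ rmorphM /= thE poly_valE ?(leq_trans Y1) // eval_real_nat.
  by ring.
rewrite -[\sum_(i < q) chi i]/(complete_sum R q (a *: Q)).
set X := \sum_(Y <= m < N) _; set S := complete_sum _ _ _.
set G := \sum_(V Y <= m < V N) cexp (beta * m%:R); set F := \sum_(V Y <= m < V N) _ => tele.
have VYN : (V Y <= V N)%N by apply: Vmono.
have G_le : cabs G <= (V N)%:R - (V Y)%:R.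
  rewrite -natrB // -[leRHS]mulr1 mulr_natl -sumr_const_nat.
  by apply: cabs_le_sum => k _; rewrite cabs_cexp.
set err := n * _ + _.
have tele2 : cabs (X - q%:R^-1 * S * G) <= err.
  rewrite -(ler_pM2l qR) -{1}(cabs_nat R q) -cabsM mulrBr !mulrA mulfV ?mul1r; last first.
    by rewrite pnatr_eq0 -lt0n.
  apply: (le_trans tele); rewrite /err [leRHS]mulrDr; apply: lerD.
    rewrite [leRHS]mulrCA; apply: ler_pM => //.
    - apply: addr_ge0; last by apply: mulr_ge0 => //; exact: sqr_ge0.
      by apply: mulr_ge0; [exact: mulr_ge0 | exact: sqr_ge0].
    - by rewrite /n ler_nat leq_subr.
    - by rewrite le_eqVlt; apply/orP; left; apply/eqP; ring.
  by rewrite le_eqVlt; apply/orP; left; apply/eqP; ring.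
have D_ge0 : 0 <= (V N)%:R - (V Y)%:R :> R by rewrite subr_ge0 ler_nat.
have [q1|q1] := ltnP 1 q.
  have F_le : cabs F <= 2 * q%:R.
    by apply: linear_sum_le; rewrite ?mulr_gt0 // thE dist_int_near_rat.
  have SG : cabs (q%:R^-1 * S * G) <= omega * ((V N)%:R - (V Y)%:R).
    rewrite !cabsM; apply: ler_pM; rewrite ?mulr_ge0 ?cabs_ge0 //.
    have -> : cabs (q%:R^-1 : R[i]) = q%:R^-1.
      by rewrite -(rmorph_nat (real_complex R)) -fmorphV cabs_real normfV normr_nat.
    by rewrite mulrC ler_pdivrMr // mulrC complete_le.
  have -> : X - F = q%:R^-1 * S * G + (X - q%:R^-1 * S * G) - F by ring.
  apply: (le_trans (cabsB _ _)); rewrite [leRHS]addrA; apply: lerD => //.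
  by apply: (le_trans (cabsD _ _)); apply: lerD.
have qE : q = 1%N by apply/eqP; rewrite eqn_leq q1 q0.
have FG : F = q%:R^-1 * S * G.
  rewrite /S /complete_sum qE big_ord1 invr1 mul1r.
  have -> : cexp (((a *: Q).[0%N%:Z])%:~R / 1%:R : R) = 1 by rewrite divr1 cexp_int.
  rewrite mul1r; apply: eq_bigr => m _.
  rewrite thE qE divr1 mulrDl addrC; apply: (@cexp_eq _ _ _ (a * m%:Z)).
  by rewrite rmorphM /= -pmulrn.
rewrite FG; apply: (le_trans tele2); rewrite /err.
by rewrite -[leLHS]add0r; apply: lerD; [exact: mulr_ge0 | rewrite lerDl mulr_ge0].
Qed.

Variable Cw : R.
Hypothesis Cw1 : 1 <= Cw.
Hypothesis weyl : forall (u : R) (N : nat) (f : {poly R}) (a : int) (q A B : nat),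
  1 <= u -> N%:R = u ^+ 8 -> (B - A <= N)%N -> (size f <= e.+3)%N ->
  (0 < q)%N -> coprimez a q ->
  `|(e.+2)`!%:R * f`_e.+2 - a%:~R / q%:R| <= q%:R ^- 2 ->
  u ^+ 2 <= q%:R -> q%:R <= u ^+ (8 * e + 10) ->
  cabs (phase_sum (fun n => f.[n%:R]) A B) ^+ (2 ^ e.+1) <= Cw * u ^+ (8 * 2 ^ e.+1 - 1).

Let D0 : nat := (d`! * absz (Q`_d)%R)%N.

Let D0pos : (0 < D0)%N.
Proof. by rewrite muln_gt0 fact_gt0 /= absz_gt0 gt_eqF. Qed.

Let D0v : D0%:R <= v ^+ 2.
Proof.
rewrite natrM expr2; apply: ler_pM => //; apply: le_trans Qv; rewrite ler_nat.
by rewrite /coef_norm big_ord_recr /= leq_addl.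
Qed.

Let Qd_R : (Q`_d)%:~R = (absz (Q`_d)%R)%:R :> R.
Proof. by rewrite pmulrn gez0_abs // ltW. Qed.

(** The Weyl bound for theta Q; since u = y^K with K = 2^(d-1), the K-th root of u^(8K - 1) is y^(8K
    - 1) = n / y. *)
Lemma minor_phase_bound theta (a : int) (q B : nat) : (0 < q)%N -> coprimez a q ->
    `|D0%:R * theta - a%:~R / q%:R| <= q%:R ^- 2 -> u ^+ 2 <= q%:R ->
    q%:R <= u ^+ (8 * e + 10) -> (B <= N)%N ->
  cabs (\sum_(Y <= m < B) cexp (theta * (V m)%:R)) <= Cw * (n / y).
Proof.
move=> q0 caq ha uq qu BN; pose f : {poly R} := theta *: map_poly intr Q.
have sf : (size f <= e.+3)%N.
  by apply: leq_trans (size_scale_leq _ _) (leq_trans (size_poly _ _) sQ).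
have fd : (e.+2)`!%:R * f`_e.+2 = D0%:R * theta.
  have -> : f`_e.+2 = theta * (Q`_d)%:~R by rewrite coefZ coef_map.
  by rewrite Qd_R /D0 natrM; ring.
have BYN : (B - Y <= N)%N by rewrite (leq_trans (leq_subr _ _)).
have := weyl u1 un BYN sf q0 caq; rewrite fd => /(_ ha uq qu).
have -> : phase_sum (fun m => f.[m%:R]) Y B = \sum_(Y <= m < B) cexp (theta * (V m)%:R).
  rewrite /phase_sum big_nat_cond [RHS]big_nat_cond.
  apply: eq_bigr => m /andP[/andP[Ym _] _]; congr cexp.
  by rewrite hornerZ poly_valE // (leq_trans Y1).
have K0 : (0 < 2 ^ e.+1)%N by rewrite expn_gt0.
move=> h; rewrite -(ler_pXn2r K0) ?nnegrE ?cabs_ge0 //; last first.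
  by rewrite mulr_ge0 ?divr_ge0 ?(ltW n0) ?(ltW y0) // (le_trans ler01).
apply: (le_trans h); rewrite exprMn; apply: ler_pM.
- exact: le_trans Cw1.
- by rewrite exprn_ge0 // ltW.
- by rewrite ler_eXnr.
rewrite /u -exprM.
have -> : n / y = y ^+ (8 * 2 ^ e.+1 - 1).
  rewrite /n -yN; have -> : (8 * 2 ^ e.+1 = (8 * 2 ^ e.+1 - 1).+1)%N.
    by rewrite subn1 prednK // muln_gt0.
  by rewrite exprSr mulfK ?gt_eqF // -[in RHS]addn1 addnK.
by rewrite -[leRHS]exprM [X in _ <= _ ^+ X]mulnC.
Qed.

(** The constants of the minor and major arcs added together, so that a single one serves both
    cases; it depends only on the degree and on [Cw]. *)
Definition arc_const : R := Cw * (k1 + k2) + 32 * k1 ^+ 2 + k2 + 2 * k1 + 4.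

(** The error target N^d / v^2; divided by a main term of size at least N^d / (2v), it leaves a
    relative error 2/v. *)
Let Tg : R := n ^+ e.+2 / v ^+ 2.

(** There is room for v^3 because v^5 <= y <= u and u^3 <= u^8 = n. *)
Let Tg_small x j : (j <= 3)%N -> x <= v ^+ j * (u ^+ 2 * n ^+ e.+1) -> x <= Tg.
Proof.
move=> j3 hx; apply: (le_trans hx); rewrite /Tg ler_pdivlMr ?exprn_gt0 //.
have -> : v ^+ j * (u ^+ 2 * n ^+ e.+1) * v ^+ 2 = (v ^+ (j + 2) * u ^+ 2) * n ^+ e.+1.
  by rewrite exprD; ring.
rewrite [n ^+ e.+2]exprS ler_wpM2r ?exprn_ge0 ?(ltW n0) //.
apply: (@le_trans _ _ (u * u ^+ 2)).
  apply: ler_wpM2r; first by rewrite exprn_ge0 // ltW.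
  apply: le_trans yu; apply: vpow.
  by rewrite (@leq_trans (3 + 2)) // leq_add2r.
by rewrite -exprS un; exact: ler_weXn2l.
Qed.

(** Dirichlet is applied to D0 theta, the quantity that governs Weyl sums. Its denominator q
    separates the arcs at u^2, the lower limit of the Weyl bound; the major arcs then need a
    denominator of theta itself. *)
Lemma exp_sum_arcs theta :
  cabs (\sum_(Y <= m < N) (D m)%:C%C * cexp (theta * (V m)%:R)
        - \sum_(V Y <= m < V N) cexp (theta * m%:R)) <=
    omega * ((V N)%:R - (V Y)%:R) + arc_const * Tg.
Proof.
have u2 : 2 <= u by apply: (le_trans v2); apply: le_trans yu; rewrite -[v]expr1 vpow.
have VYN : (V Y)%:R <= (V N)%:R :> R.
  by rewrite ler_nat -lez_nat /V /poly_val !gez0_abs ?Qpos ?Qmono.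
have main0 : 0 <= omega * ((V N)%:R - (V Y)%:R) by rewrite mulr_ge0 // subr_ge0.
have Tg0 : 0 <= Tg by rewrite divr_ge0 ?exprn_ge0 // ltW.
have uX : u ^+ (8 * e + 10) = n ^+ e.+1 * u ^+ 2.
  by rewrite un -exprM -exprD; congr (_ ^+ _); rewrite mulnS [RHS]addnAC [LHS]addnC.
(* The upper limit for q in the Weyl bound, equal to n^(d-1) u^2 before truncation. *)
pose R0 := Num.truncn (u ^+ (8 * e + 10)).
have uX0 : 0 <= u ^+ (8 * e + 10) by rewrite exprn_ge0 // ltW.
have /andP[R0u uR0] := truncn_itv uX0; rewrite -/R0 in R0u uR0.
have R02 : (2 <= R0)%N.
  rewrite /R0 truncn_ge_nat //; apply: (le_trans u2); rewrite ler_eXnr //.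
  by rewrite addnS.
have R0pos : (0 < R0)%N by exact: ltnW.
have R0R : 0 < R0%:R :> R by rewrite ltr0n.
have [a [q [/andP[q0 qR0] caq hc]]] := dirichlet (D0%:R * theta) R0pos.
have qR : 0 < q%:R :> R by rewrite ltr0n.
have D0R : 0 < D0%:R :> R by rewrite ltr0n.
have qu : q%:R <= u ^+ (8 * e + 10) by apply: le_trans R0u; rewrite ler_nat.
have [uq|qu2] := leP (u ^+ 2) q%:R.
  have q1 : (1 < q)%N.
    rewrite -(ltr_nat R); apply: lt_le_trans uq; rewrite exprn_egt1 //.
    by apply: lt_le_trans u2; rewrite ltr1n.
  have hq2 : `|D0%:R * theta - a%:~R / q%:R| <= q%:R ^- 2.
    apply: (le_trans hc); rewrite expr2 lef_pV2 ?posrE ?mulr_gt0 //.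
    by rewrite ler_wpM2l // ler_nat.
  have Cw0 : 0 <= Cw by exact: le_trans Cw1.
  have T0 : 0 <= Cw * (n / y) by rewrite mulr_ge0 ?divr_ge0 // ltW.
  have h1 := weighted_sum_le T0 (fun B _ BN => minor_phase_bound q0 caq hq2 uq qu BN).
  (* The distance of D0 theta from the integers is at most D0 times that of theta, and it is at
     least 1/(2q). *)
  have h2 : cabs (\sum_(V Y <= m < V N) cexp (theta * m%:R)) <= 2 * q%:R * D0%:R.
    apply: linear_sum_le; first by rewrite !mulr_gt0.
    rewrite invfM ler_pdivrMr //; apply: le_trans (_ : _ <= dist_int (D0%:R * theta)) _; last first.
      by rewrite [leRHS]mulrC; exact: dist_int_natmul.
    have -> : D0%:R * theta = a%:~R / q%:R + (D0%:R * theta - a%:~R / q%:R) by ring.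
    apply: dist_int_near_rat => //; apply: (le_trans hc).
    rewrite lef_pV2 ?posrE ?mulr_gt0 // [leLHS]mulrC ler_pM2l //.
    by rewrite ler_nat.
  apply: (le_trans (cabsB _ _)); apply: (le_trans (lerD h1 h2)).
  rewrite -[leLHS]add0r; apply: lerD => //.
  have e1 : Cw * (n / y) * (M1 + n * M2) <= Cw * (k1 + k2) * Tg.
    have -> : Cw * (n / y) * (M1 + n * M2) = Cw * (k1 + k2) * (n ^+ e.+2 * (v / y)).
      by rewrite /M1 /M2 !exprS; field; rewrite gt_eqF.
    apply: ler_wpM2l; first by rewrite mulr_ge0 ?addr_ge0.
    rewrite /Tg ler_wpM2l ?exprn_ge0 ?(ltW n0) // ler_pdivrMr // mulrC ler_pdivlMr ?exprn_gt0 //.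
    by rewrite -exprS vpow.
  have e2 : q%:R * D0%:R <= Tg.
    apply: (@Tg_small _ 2) => //; rewrite mulrC; apply: ler_pM => //.
    by apply: (le_trans qu); rewrite uX mulrC.
  have a1 : 0 <= k1 ^+ 2 * Tg by rewrite mulr_ge0 // sqr_ge0.
  have a2 : 0 <= k2 * Tg by rewrite mulr_ge0.
  have a3 : 0 <= k1 * Tg by rewrite mulr_ge0.
  by rewrite /arc_const; move: e1 e2 a1 a2 a3; lra.
(* Dividing the approximation of D0 theta by D0 gives theta a denominator of at most q D0 <= u^2
   v^2, still below N. *)
pose beta := theta - a%:~R / (q * D0)%:R.
have qD0 : (0 < q * D0)%N by rewrite muln_gt0 q0.
have [b [r [/andP[r0 rq] cbr hbr]]] := reduced_fraction R a qD0.
have rR : 0 < r%:R :> R by rewrite ltr0n.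
have hbeta : `|beta| * r%:R <= R0%:R^-1.
  have -> : beta = (D0%:R * theta - a%:~R / q%:R) / D0%:R.
    by rewrite /beta natrM; field; rewrite !gt_eqF.
  rewrite normrM normfV (gtr0_norm D0R).
  apply: (@le_trans _ _ ((q%:R * R0%:R)^-1 / D0%:R * (q * D0)%:R)).
    apply: ler_pM; rewrite ?divr_ge0 ?ler_nat // ?ler_wpM2r ?invr_ge0 //.
  rewrite natrM le_eqVlt; apply/orP; left; apply/eqP.
  by field; rewrite !gt_eqF.
have thE : theta = b%:~R / r%:R + beta by rewrite hbr /beta; ring.
have r_le : r%:R <= u ^+ 2 * v ^+ 2.
  apply: (@le_trans _ _ (q * D0)%:R); first by rewrite ler_nat.
  by rewrite natrM; apply: ler_pM => //; exact: ltW.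
have rN : (r <= N)%N.
  rewrite -(ler_nat R) -/n; apply: (le_trans r_le); rewrite un.
  apply: (@le_trans _ _ (u ^+ 2 * u)); last by rewrite -exprSr; exact: ler_weXn2l.
  apply: ler_wpM2l; first by rewrite exprn_ge0 // ltW.
  by apply: le_trans yu; exact: vpow.
have hb2 : `|beta| <= (2 * r%:R)^-1.
  rewrite invfM ler_pdivlMr //; apply: (le_trans hbeta).
  by rewrite lef_pV2 ?posrE // ler_nat.
apply: (le_trans (major_arc_bound r0 rN cbr thE hb2)); apply: lerD => //.
have n0' := ltW n0.
(* Here the length of Dirichlet's range pays: n M1^2 has order v^2 n^(2d-1), and |beta| r <= 2 /
   (n^(d-1) u^2) brings it down to v^2 n^d / u^2. *)
have e1 : n * (16 * (`|beta| * r%:R) * M1 ^+ 2) <= 32 * k1 ^+ 2 * Tg.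
  have hR : R0%:R^-1 <= 2 / (n ^+ e.+1 * u ^+ 2).
    rewrite -uX ler_pdivlMr ?exprn_gt0 // mulrC ler_pdivrMr //.
    apply: (le_trans (ltW uR0)); rewrite mulr_natl mulr2n -natr1 lerD2l.
    by rewrite ler1n.
  apply: (@le_trans _ _ (n * (16 * (2 / (n ^+ e.+1 * u ^+ 2)) * M1 ^+ 2))).
    apply: ler_wpM2l => //; apply: ler_wpM2r; first exact: sqr_ge0.
    by apply: ler_wpM2l => //; exact: le_trans hbeta hR.
  have -> : n * (16 * (2 / (n ^+ e.+1 * u ^+ 2)) * M1 ^+ 2) =
      32 * k1 ^+ 2 * (n ^+ e.+2 * (v ^+ 2 / u ^+ 2)).
    rewrite /M1 [n ^+ e.+2]exprS.
    have := expf_neq0 e.+1 (lt0r_neq0 n0); move: (n ^+ e.+1) => z z0.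
    by field; rewrite z0 gt_eqF.
  apply: ler_wpM2l; first by rewrite mulr_ge0 // sqr_ge0.
  rewrite /Tg ler_wpM2l ?exprn_ge0 // ler_pdivrMr ?exprn_gt0 // mulrC ler_pdivlMr ?exprn_gt0 //.
  rewrite -exprD; apply: (@le_trans _ _ u); first by apply: le_trans yu; exact: vpow.
  by rewrite ler_eXnr.
have one_le x : 0 <= x -> x <= x * n ^+ e.+1.
  by move=> x0; rewrite ler_peMr // exprn_ege1.
have e2 : n * (r%:R * M2) <= k2 * Tg.
  have -> : n * (r%:R * M2) = k2 * (r%:R * (v * n ^+ e.+1)).
    by rewrite /M2 exprS; ring.
  apply: ler_wpM2l => //; apply: (@Tg_small _ 3) => //.
  have -> : v ^+ 3 * (u ^+ 2 * n ^+ e.+1) = (u ^+ 2 * v ^+ 2) * (v * n ^+ e.+1) by ring.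
  by apply: ler_wpM2r => //; rewrite mulr_ge0 ?exprn_ge0 // ltW.
have e3 : r%:R * M1 <= k1 * Tg.
  have -> : r%:R * M1 = k1 * (r%:R * (v * n ^+ e.+1)) by rewrite /M1; ring.
  apply: ler_wpM2l => //; apply: (@Tg_small _ 3) => //.
  have -> : v ^+ 3 * (u ^+ 2 * n ^+ e.+1) = (u ^+ 2 * v ^+ 2) * (v * n ^+ e.+1) by ring.
  by apply: ler_wpM2r => //; rewrite mulr_ge0 ?exprn_ge0 // ltW.
have e4 : r%:R <= Tg.
  apply: (@Tg_small _ 2) => //; apply: (le_trans r_le).
  rewrite [_ * v ^+ 2]mulrC mulrA one_le // mulr_ge0 ?exprn_ge0 // ltW //.
have hCk : 0 <= Cw * (k1 + k2) * Tg.
  apply: mulr_ge0 => //; apply: mulr_ge0; last exact: addr_ge0.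
  exact: le_trans Cw1.
by rewrite /arc_const; move: e1 e2 e3 e4 hCk Tg0; lra.
Qed.

End Arcs.
End ExponentialSumBound.

(** * The polynomial P / W *)

Section ReducedDilate.
Implicit Types (p : {poly int}).

Lemma admissible_coefs d p : (2 <= d)%N -> admissible d p ->
  [/\ (size p <= d.+1)%N, p`_0 = 0, (p`_1 = 1 \/ p`_1 = -1) & 0 < p`_d].
Proof.
move=> d2; rewrite /admissible gtn_eqF //; case=> [b [u [b1 hu ->]]].
have coefE j : (poly_with_coefs d b u)`_j =
    \sum_(1 <= i < d) b i * (j == (d.+1 - i)%N)%:R + u * (j == 1%N)%:R.
  rewrite /poly_with_coefs coefD coef_sum coefZ coefX.
  by congr (_ + _); apply: eq_bigr => i _; rewrite coefZ coefXn.
have low j : (j <= 1)%N -> \sum_(1 <= i < d) b i * (j == (d.+1 - i)%N)%:R = 0 :> int.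
  move=> j1; rewrite big_nat_cond big1 // => i /andP[/andP[i1 id] _].
  by rewrite (_ : (j == _) = false) ?mulr0 //; lia.
split.
- apply/leq_sizeP => j dj; rewrite coefE (_ : (j == 1%N) = false) ?mulr0 ?addr0; last by lia.
  rewrite big_nat_cond big1 // => i /andP[/andP[i1 id] _].
  by rewrite (_ : (j == _) = false) ?mulr0 //; lia.
- by rewrite coefE low // mulr0 addr0.
- by rewrite coefE low // add0r mulr1; case: hu => ->; [left | right].
- rewrite coefE (_ : (d == 1%N) = false) ?mulr0 ?addr0; last by lia.
  rewrite big_ltn // subn1 /= eqxx mulr1 big_nat_cond big1 ?addr0 //.
  move=> i /andP[/andP[i1 id] _].
  by rewrite (_ : (d == _) = false) ?mulr0 //; lia.
Qed.

(* p(W x) / W *)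
Definition reduced_dilate (W : nat) p : {poly int} :=
  \poly_(j < size p) (p`_j * W%:Z ^+ j.-1).

Lemma coef_reduced_dilate W p j : (reduced_dilate W p)`_j = p`_j * W%:Z ^+ j.-1.
Proof.
by rewrite coef_poly; case: ltnP => // h; rewrite nth_default // mul0r.
Qed.

Lemma dilateE W p : p`_0 = 0 -> dilate W p = W%:Z *: reduced_dilate W p.
Proof.
move=> p0; apply/polyP => j; rewrite /dilate coef_comp_scaleX coefZ coef_reduced_dilate.
case: j => [|j] /=; first by rewrite p0 !mul0r mulr0.
by rewrite exprS mulrCA.
Qed.

Lemma red_reduced_dilate l W p (a : int) : prime l -> (l %| W)%N -> p`_0 = 0 ->
  red l (a *: reduced_dilate W p) = ((a * p`_1)%:~R)%:P * 'X.
Proof.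
move=> lp lW p0; apply/polyP => j; rewrite coef_red coefZ coef_reduced_dilate.
rewrite mul_polyC coefZ coefX; case: j => [|[|j]] /=.
- by rewrite p0 mul0r !mulr0.
- by rewrite expr0 !mulr1.
rewrite mulr0 exprS; apply/eqP; rewrite Fp_int_eq0 //.
by rewrite dvdz_mull // dvdz_mull // dvdz_mulr.
Qed.

Lemma coef_norm_reduced_dilate d W p : (0 < W)%N ->
  (coef_norm d.+1 (reduced_dilate W p) <= coef_norm d.+1 p * W ^ d)%N.
Proof.
move=> W0; rewrite /coef_norm big_distrl /=; apply: leq_sum => j _.
rewrite coef_reduced_dilate abszM abszX /= leq_mul2l leq_pexp2l ?orbT //.
by have := ltn_ord j; case: (nat_of_ord j).
Qed.

Lemma prime_dvd_lcm_upto l w : prime l -> (l %| lcm_upto w)%N -> (l <= w)%N.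
Proof.
move=> lp; elim: w => [|w IH].
  by rewrite /lcm_upto big_geq // dvdn1 => /eqP l1; rewrite l1 in lp.
rewrite lcm_uptoS => h.
have : (l %| lcm_upto w * w.+1)%N.
  by apply: dvdn_trans h _; rewrite -muln_lcm_gcd dvdn_mulr.
rewrite Euclid_dvdM // => /orP[/IH/leqW //|]; exact: dvdn_leq.
Qed.

Section RealBounds.
Context (R : realType).

Lemma complete_sum_reduced_dilate d w p (eps : R) (a : int) q : (2 <= d)%N ->
    admissible d p -> 0 < eps -> eps <= d%:R^-1 -> (0 < w)%N -> (d <= w)%N ->
    p`_d <= w%:Z -> mordell_const R d <= w%:R `^ eps -> (1 < q)%N -> coprimez a q ->
  cabs (complete_sum R q (a *: reduced_dilate (lcm_upto w) p)) <=
    q%:R * w%:R `^ (- (d%:R^-1 - eps)).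
Proof.
move=> d2 adm eps0 epsd w0 dw pdw mw q1 caq; set W := lcm_upto w.
have [sp p0 p1 pd] := admissible_coefs d2 adm.
set s := _ - eps; have s0 : 0 <= s by rewrite subr_ge0.
have q0 : (0 < q)%N by exact: ltnW.
have wR : 0 < w%:R :> R by rewrite ltr0n.
have cal l : (l %| q)%N -> coprimez a l.
  by move: caq; rewrite !coprimezE => h lq; exact: coprime_dvdr lq h.
have [/hasP[l lq lw]|/hasPn big] := boolP (has (fun l => l <= w)%N (primes q)).
  move: lq; rewrite mem_primes => /and3P[lp _ lq].
  have lW : (l %| W)%N by rewrite dvdn_lcm_upto // lw prime_gt0.
  rewrite (complete_sum_unit_linear R lp lq q0 _ (red_reduced_dilate a lp lW p0)).
    by rewrite cabs0 mulr_ge0 ?powR_ge0.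
  have := cal l lq; rewrite !coprimezE abszM /=.
  by case: p1 => ->; rewrite ?absz1 ?abszN1 muln1.
have bigp l : prime l -> (l %| q)%N -> (w < l)%N.
  by move=> lp lq; rewrite ltnNge; apply: big; rewrite mem_primes lp q0.
have sQ : (size (a *: reduced_dilate W p) <= d.+1)%N.
  by apply: leq_trans (size_scale_leq _ _) (leq_trans (size_poly _ _) sp).
have hq : cabs (complete_sum R q (a *: reduced_dilate W p)) <= q%:R `^ (1 - s).
  apply: complete_sum_bound => //; first exact: ltnW.
  move=> l lp lq; have wl := bigp l lp lq; split; first exact: leq_ltn_trans wl.
    apply: (le_trans mw); apply: ge0_ler_powR; rewrite ?nnegrE ?(ltW eps0) //.
    by rewrite ler_nat ltnW.
  (* The leading coefficient a p_d W^(d-1) survives mod l: a is coprime to q, 0 < p_d <= w < l, and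
     W has no prime factor above w. *)
  apply/nonconst_modP => //; exists d; first exact: ltnW.
  rewrite coefZ coef_reduced_dilate dvdzE !abszM abszX !Euclid_dvdM // !negb_or.
  apply/and3P; split.
  - have := cal l lq; rewrite coprimezE coprime_sym prime_coprime //.
  - rewrite gtnNdvd // ?absz_gt0 ?gt_eqF //=; apply: leq_ltn_trans wl.
    by rewrite -lez_nat gez0_abs // ltW.
  - rewrite Euclid_dvdX // negb_and; apply/orP; left.
    by apply/negP => /(prime_dvd_lcm_upto lp); rewrite leqNgt wl.
apply: (le_trans hq).
have qR : 0 < q%:R :> R by rewrite ltr0n.
rewrite powRD ?(gt_eqF qR) ?implybT // powRr1 ?(ltW qR) // ler_wpM2l ?(ltW qR) //.
rewrite !powRN lef_pV2 ?posrE ?powR_gt0 // ge0_ler_powR ?nnegrE ?(ltW wR) ?(ltW qR) //.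
rewrite ler_nat ltnW //; apply: (leq_trans (bigp (pdiv q) _ (pdiv_dvd q))).
  exact: pdiv_prime.
exact: dvdn_leq (pdiv_dvd q).
Qed.

(** Lets the increment in top degree dominate those in lower degrees; the case x = 0 serves the full
    average. *)
Lemma expr_sub_le (x y : R) j d : (0 < j <= d)%N -> 1 <= y -> x = 0 \/ 1 <= x <= y ->
  y ^+ j - x ^+ j <= y ^+ d - x ^+ d.
Proof.
move=> /andP[j0 jd] y1 hx; have y0 : 0 <= y by exact: le_trans y1.
case: hx => [->|/andP[x1 xy]].
  by rewrite !expr0n !gtn_eqF ?(leq_trans j0) // !subr0 ler_weXn2l.
have x0 : 0 <= x by exact: le_trans x1.
rewrite -(subnKC jd) !exprD.
have h1 : 0 <= y ^+ j - x ^+ j by rewrite subr_ge0 lerXn2r ?nnegrE.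
have h2 : 1 <= y ^+ (d - j) by rewrite exprn_ege1.
have h3 : x ^+ (d - j) <= y ^+ (d - j) by rewrite lerXn2r ?nnegrE.
have h4 : 0 <= x ^+ j by rewrite exprn_ge0.
move: h1 h2 h3 h4; move: (y ^+ j) (x ^+ j) (y ^+ (d - j)) (x ^+ (d - j)) => a b c e.
by move=> h1 h2 h3 h4; nra.
Qed.

(** The leading coefficient is at least W^(d-1), the lower ones add up to at most B W^(d-2) with 2B
    <= W, so at least half of the leading increment remains. This makes Q nonnegative and increasing
    at positive integers and bounds the main term from below. *)
Lemma reduced_dilate_growth e W p (x y : R) : (size p <= e.+3)%N -> p`_0 = 0 ->
    0 < p`_e.+2 -> (2 * coef_norm e.+2 p <= W)%N -> (0 < W)%N ->
    1 <= y -> x = 0 \/ 1 <= x <= y ->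
  (y ^+ e.+2 - x ^+ e.+2) / 2 <=
    eval_real (reduced_dilate W p) y - eval_real (reduced_dilate W p) x.
Proof.
move=> sp p0 pd BW W0 y1 hx; set d := e.+2; set B := coef_norm d p in BW.
have sQ : (size (reduced_dilate W p) <= e.+3)%N by exact: leq_trans (size_poly _ _) sp.
rewrite !(eval_real_wide _ sQ) -sumrB.
pose g j : R := W%:R ^+ j.-1 * (y ^+ j - x ^+ j).
rewrite (eq_bigr (fun j : 'I_e.+3 => (p`_j)%:~R * g j)); last first.
  move=> j _; rewrite coef_reduced_dilate rmorphM rmorphXn /= /g -pmulrn.
  by rewrite -mulrBr mulrA.
set X := y ^+ d - x ^+ d.
have X0 : 0 <= X.
  rewrite subr_ge0; case: hx => [->|/andP[x1 xy]].
    by rewrite expr0n /= exprn_ge0 // (le_trans ler01).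
  by rewrite lerXn2r ?nnegrE // (le_trans ler01) // (le_trans x1).
have WR : 1 <= W%:R :> R by rewrite ler1n.
have W0R : 0 <= W%:R :> R by [].
rewrite big_ord_recr /=.
have low : `|\sum_(j < d) (p`_j)%:~R * g j| <= B%:R * (W%:R ^+ e * X).
  apply: (@le_trans _ _ ((coef_norm e.+1 p)%:R * (W%:R ^+ e * X))).
    apply: weighted_coef_le; first by rewrite mulr_ge0 ?exprn_ge0.
    move=> [|j] jd; first by rewrite /g !expr0 subrr mulr0 normr0 mulr_ge0 ?exprn_ge0.
    have jd1 : (0 < j.+1 <= d)%N by exact: ltnW jd.
    have hj := expr_sub_le jd1 y1 hx.
    have gj0 : 0 <= y ^+ j.+1 - x ^+ j.+1.
      rewrite subr_ge0; case: hx => [->|/andP[x1 xy]].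
        by rewrite expr0n /= exprn_ge0 // (le_trans ler01).
      by rewrite lerXn2r ?nnegrE // (le_trans ler01) // (le_trans x1).
    rewrite ger0_norm /g ?mulr_ge0 ?exprn_ge0 //=.
    by apply: ler_pM; rewrite ?exprn_ge0 // ler_weXn2l.
  rewrite ler_wpM2r ?mulr_ge0 ?exprn_ge0 // ler_nat /B /coef_norm [leqRHS]big_ord_recr /=.
  exact: leq_addr.
have BW2 : 2 * B%:R <= W%:R :> R by rewrite -natrM ler_nat.
have top : W%:R * (W%:R ^+ e * X) <= (p`_d)%:~R * g d.
  rewrite /g /= exprS -!mulrA ler_peMl ?mulr_ge0 ?exprn_ge0 //.
  by rewrite ler1z -gtz0_ge1.
have Z1 : X <= W%:R ^+ e * X by rewrite ler_peMl // exprn_ege1.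
move: low; rewrite ler_norml => /andP[low _].
set S := \sum_(_ < _) _ in low *; set Z := W%:R ^+ e * X in low top Z1.
have Z0 : 0 <= Z by exact: le_trans Z1.
have h1 : 2 * (B%:R * Z) <= W%:R * Z by rewrite mulrA ler_wpM2r.
have h2 : Z <= W%:R * Z by rewrite ler_peMl.
rewrite ler_pdivrMr //.
by move: low top Z1 h1 h2; move: (_ * g d) (B%:R * Z) (W%:R * Z) => t1 t2 t3; lra.
Qed.

End RealBounds.
End ReducedDilate.

(** * Ergodic averages *)

Section ReductionToPhases.
Context (R : realType).

Lemma int_co_sum (F : int -> R[i]) (a b : R) (A B : nat) :
    (forall n : int, (a <= n%:~R < b) = (A%:Z <= n < B%:Z)) ->
  \sum_(n \in int_co a b) F n = \sum_(A <= n < B) F n%:Z.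
Proof.
move=> h; have u : uniq [seq Posz i | i <- index_iota A B].
  by rewrite map_inj_uniq ?iota_uniq // => m n [].
rewrite -(big_map Posz predT F) (fsbig_seq _ F u).
have <- : int_co a b = [set` [seq Posz i | i <- index_iota A B]]%classic.
  apply/seteqP; split=> [n|n] /=; rewrite /int_co /= h.
    move=> /andP[An nB]; apply/mapP; exists `|n|%N; last by lia.
    by rewrite mem_index_iota; apply/andP; split; lia.
  by move=> /mapP[m + ->]; rewrite mem_index_iota.
by [].
Qed.

(** Since P = W Q, all exponents of T are multiples of W, and the trigonometric polynomial at t is
    the phase difference at theta = W t. *)
Lemma transfer_to_phases (disp : measure_display) (X : measurableType disp)
    (mu : probability X R) (T : mp_map mu) (f : X -> R[i]) (W Y0 N A : nat)
    (V : nat -> nat) (D : nat -> R) (Delta M : R) :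
    in_L2 mu f -> (0 < W)%N -> 0 < Delta -> 0 <= M ->
    (forall theta : R, cabs (\sum_(Y0 <= n < N) (D n)%:C%C * cexp (theta * (V n)%:R)
      - \sum_(A <= m < V N) cexp (theta * m%:R)) <= Delta * M) ->
  (L2norm mu (fun x =>
      ((W%:R * Delta)^-1)%:C%C *
         \sum_(Y0 <= n < N) (W%:R * D n)%:C%C * f (iter (W * V n) T x)
      - (W%:R / (W%:R * Delta))%:C%C * \sum_(A <= m < V N) f (iter (W * m) T x))%R
    <= M%:E * L2norm mu f)%E.
Proof.
move=> fL2 W0 Delta0 M0 hyp; have WR : 0 < W%:R :> R by rewrite ltr0n.
pose s : seq (R[i] * nat) :=
  [seq ((D n / Delta)%:C%C, (W * V n)%N) | n <- index_iota Y0 N] ++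
  [seq ((- Delta^-1)%:C%C, (W * m)%N) | m <- index_iota A (V N)].
have -> : (fun x => ((W%:R * Delta)^-1)%:C%C *
         \sum_(Y0 <= n < N) (W%:R * D n)%:C%C * f (iter (W * V n) T x)
      - (W%:R / (W%:R * Delta))%:C%C * \sum_(A <= m < V N) f (iter (W * m) T x)) =
    (fun x => \sum_(c <- s) c.1 * f (iter c.2 T x)).
  apply/funext => x; rewrite big_cat !big_map /= !mulr_sumr -sumrN.
  congr (_ + _); apply: eq_bigr => n _.
    rewrite mulrA -rmorphM; congr (_%:C%C * _).
    by field; rewrite !gt_eqF.
  rewrite -mulNr -rmorphN; congr (_%:C%C * _).
  by field; rewrite !gt_eqF.
apply: transference => // t; rewrite big_cat !big_map /=.
have -> : \sum_(n <- index_iota Y0 N) (D n / Delta)%:C%C * cexp ((W * V n)%N%:R * t) +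
    \sum_(m <- index_iota A (V N)) (- Delta^-1)%:C%C * cexp ((W * m)%N%:R * t) =
    (Delta^-1)%:C%C * (\sum_(Y0 <= n < N) (D n)%:C%C * cexp (W%:R * t * (V n)%:R)
      - \sum_(A <= m < V N) cexp (W%:R * t * m%:R)).
  rewrite mulrBr !mulr_sumr -sumrN; congr (_ + _); apply: eq_bigr => n _.
    rewrite mulrA -rmorphM [_ / Delta]mulrC; congr (_ * cexp _).
    by rewrite natrM; ring.
  rewrite -mulNr -rmorphN; congr (_ * cexp _).
  by rewrite natrM; ring.
rewrite cabsM cabs_real ger0_norm ?invr_ge0 ?(ltW Delta0) //.
by rewrite mulrC ler_pdivrMr // [leRHS]mulrC; exact: hyp.
Qed.

Lemma phase_sum_shift_le (theta : R) (A B C : nat) : (A <= C)%N -> (B <= C)%N ->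
  cabs (\sum_(A <= m < C) cexp (theta * m%:R) - \sum_(B <= m < C) cexp (theta * m%:R)) <=
    `|A%:R - B%:R|.
Proof.
move=> AC BC; wlog AB : A B AC BC / (A <= B)%N.
  move=> H; case/orP: (leq_total A B) => [/H|/H]; first exact.
  by rewrite cabs_distC distrC; apply.
rewrite (big_cat_nat AB BC) /= addrK distrC -natrB // normr_nat.
rewrite -[leRHS]mulr1 mulr_natl -sumr_const_nat.
by apply: cabs_le_sum => k _; rewrite cabs_cexp.
Qed.

(** * Choice of parameters *)

Section ParameterChoice.
Variable e : nat.
Let d := e.+2.
Let eps : R := 100 ^- (d ^ 2)%N.
Let E : R := 100 ^+ (d ^ 2)%N.

Lemma E_gt0 : 0 < E. Proof. by rewrite exprn_gt0. Qed.

Lemma eps_gt0 : 0 < eps. Proof. by rewrite invr_gt0 exprn_gt0. Qed.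

Lemma E_large : d%:R <= E /\ 48 * 2 ^+ e.+1 <= E.
Proof.
have h : (d <= d ^ 2)%N by rewrite -mulnn leq_pmulr.
split.
  apply: (@le_trans _ _ ((100 ^ d ^ 2)%N%:R)); last by rewrite natrX.
  rewrite ler_nat; apply: (leq_trans h); rewrite ltnW // ltn_expl //.
apply: (@le_trans _ _ (100 ^+ d)); last by rewrite /E ler_weXn2l // ler1n.
have h2 : 2 ^+ e.+1 <= 100 ^+ e.+1 :> R by rewrite lerXn2r ?nnegrE // ler_nat.
rewrite /d [leRHS]exprS; have h48 : 48 <= 100 :> R by rewrite ler_nat.
by apply: ler_pM => //; rewrite exprn_ge0.
Qed.

Lemma eps_le_inv : eps <= d%:R^-1.
Proof. by rewrite lef_pV2 ?posrE ?exprn_gt0 //; case: E_large. Qed.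

(** The smallness of eps against 2^(-d), which yields v^6 <= y. *)
Lemma eps_small : 6 * eps <= (8 * 2 ^ e.+1)%:R^-1.
Proof.
have [_ h] := E_large; rewrite natrM natrX.
have p2 : 0 < 2 ^+ e.+1 :> R by rewrite exprn_gt0.
rewrite -[_^-1]mul1r ler_pdivlMr ?mulr_gt0 // /eps -/E mulrAC ler_pdivrMr ?E_gt0 //.
by rewrite mul1r; move: h; lra.
Qed.

Lemma eps_sqr : 4 * d%:R * eps ^+ 2 <= 1.
Proof.
have [h1 h2] := E_large; have E0 := E_gt0.
have E4 : 4 <= E.
  apply: le_trans h2; have : 1 <= 2 ^+ e.+1 :> R by rewrite exprn_ege1 // ler1n.
  by lra.
rewrite /eps -/E exprVn ler_pdivrMr ?exprn_gt0 // mul1r expr2.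
by apply: ler_pM.
Qed.

Variables (w N : nat).
Hypothesis w2 : (2 <= w)%N.
Hypothesis N1 : (1 <= N)%N.
Hypothesis hw : w%:Z <= Num.floor (eps ^+ 3 * ln (N%:R : R)).
Let v : R := N%:R `^ eps.

Let NR : 0 < N%:R :> R. Proof. by rewrite ltr0n. Qed.

Let vE : v = expR (eps * ln N%:R).
Proof. by rewrite /v /powR gt_eqF. Qed.

Lemma w_le_log : w%:R <= eps ^+ 3 * ln (N%:R : R).
Proof. by move: hw; rewrite floor_ge_int -pmulrn. Qed.

Let eps1 : eps <= 1.
Proof.
apply: (le_trans eps_le_inv); rewrite invf_le1 ?ltr0n //.
by rewrite ler1n.
Qed.

Lemma w_le_v : w%:R <= v.
Proof.
have lnN : 0 <= ln (N%:R : R) by rewrite ln_ge0 // ler1n.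
apply: (le_trans w_le_log); rewrite vE.
apply: (@le_trans _ _ (eps * ln N%:R)).
  rewrite ler_wpM2r // exprS ler_piMr ?(ltW eps_gt0) //.
  by rewrite exprn_ile1 // ltW // eps_gt0.
by apply: le_trans (expR_ge1Dx _); rewrite lerDr.
Qed.

(** This uses the full strength of w <= eps^3 log N: as 16 <= e^4, the logarithm of the left side is
    at most 4 d eps^2 times eps log N, and 4 d eps^2 <= 1. *)
Lemma exp16_le_v : (16 ^ (w * d))%:R <= v.
Proof.
have e16 : 16 <= expR 4 :> R.
  have h : 2 <= expR 1 :> R by have := expR_ge1Dx (1 : R); lra.
  have -> : expR 4 = expR 1 ^+ 4 :> R by rewrite -expRM_natl mulr1.
  apply: (@le_trans _ _ (2 ^+ 4)); last by rewrite lerXn2r ?nnegrE // expR_ge0.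
  by rewrite -natrX ler_nat.
rewrite natrX; apply: (@le_trans _ _ (expR 4 ^+ (w * d))).
  by rewrite lerXn2r ?nnegrE ?expR_ge0.
rewrite -expRM_natl vE ler_expR natrM.
have lnN : 0 <= ln (N%:R : R) by rewrite ln_ge0 // ler1n.
have h1 := w_le_log; have h2 := eps_sqr; have e0 := eps_gt0.
apply: (@le_trans _ _ (eps ^+ 3 * ln N%:R * d%:R * 4)).
  by rewrite !ler_wpM2r.
have -> : eps ^+ 3 * ln N%:R * d%:R * 4 = eps * ln N%:R * (4 * d%:R * eps ^+ 2) by ring.
by rewrite ler_piMr // mulr_ge0 // ltW.
Qed.

Let y : R := N%:R `^ ((8 * 2 ^ e.+1)%:R^-1).

Lemma v6_le_y : v ^+ 6 <= y.
Proof.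
rewrite -powR_mulrn ?powR_ge0 // -powRrM mulrC ler_powR ?ler1n //.
exact: eps_small.
Qed.

Lemma y_pow : y ^+ (8 * 2 ^ e.+1) = N%:R.
Proof.
by rewrite -powR_mulrn ?powR_ge0 // -powRrM mulVf ?powRr1 ?(ltW NR) //.
Qed.

Lemma N_powR_sub : N%:R `^ (1 - eps) = N%:R / v.
Proof. by rewrite powRD ?(gt_eqF NR) ?implybT // powRr1 ?(ltW NR) // powRN. Qed.

(** Dilation multiplies the norm by at most W^(d-1); the norm of p itself is charged to one more
    factor W, and W^d <= 16^(w d). *)
Lemma coef_norm_le_v p : (coef_norm d p <= lcm_upto w)%N ->
  (coef_norm d (reduced_dilate (lcm_upto w) p))%:R <= v.
Proof.
move=> h; apply: le_trans exp16_le_v; rewrite ler_nat.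
apply: (leq_trans (coef_norm_reduced_dilate e.+1 p (lcm_upto_gt0 w))).
apply: (leq_trans (leq_mul h (leqnn _))); rewrite -expnS expnM.
by rewrite leq_exp2r // lcm_upto_le.
Qed.

End ParameterChoice.
End ReductionToPhases.

Lemma eval_realZ (R : realType) (c : int) (Q : {poly int}) (x : R) :
  eval_real (c *: Q) x = c%:~R * eval_real Q x.
Proof. by rewrite /eval_real map_polyZ hornerZ. Qed.

Lemma ceil_absz (R : realType) (x : R) (n : int) : 0 <= x ->
  (x <= n%:~R) = ((absz (Num.ceil x)) %:Z <= n).
Proof. by move=> x0; rewrite gez0_abs -?ceil_le_int // ceil_ge0 // (lt_le_trans _ x0). Qed.

Lemma ceil_abszP (R : realType) (x : R) : 0 <= x ->
  x <= (absz (Num.ceil x))%:R /\ (absz (Num.ceil x))%:R < x + 1.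
Proof.
move=> x0; have c0 : 0 <= Num.ceil x by rewrite ceil_ge0 // (lt_le_trans _ x0).
rewrite pmulrn gez0_abs // ceil_ge; split=> //.
by have := ceilB1_lt x; rewrite intrB; lra.
Qed.

Lemma arc_const_ge0 (R : realType) (e : nat) (Cw : R) : 1 <= Cw -> 0 <= arc_const e Cw.
Proof.
move=> Cw1.
have k0 : 0 <= e.+2%:R * 2 ^+ e.+1 :> R by rewrite mulr_ge0 ?exprn_ge0.
have k1 : 0 <= e.+2%:R ^+ 2 * 2 ^+ e :> R by rewrite mulr_ge0 ?exprn_ge0.
have C0 : 0 <= Cw by exact: le_trans Cw1.
by rewrite /arc_const; do !apply: addr_ge0 => //; apply: mulr_ge0; rewrite // ?addr_ge0 ?exprn_ge0.
Qed.

(** * The averages of a fixed polynomial *)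

Section Averages.
Context (R : realType) (e : nat) (p : {poly int}) (w N : nat) (Cw : R).
Let d := e.+2.
Let eps : R := 100 ^- (d ^ 2)%N.
Let W := lcm_upto w.
Let Q := reduced_dilate W p.
Let V := poly_val Q.
Let q : R -> R := eval_real Q.
Let v : R := N%:R `^ eps.
Let omega : R := w%:R `^ (- (d%:R^-1 - eps)).
(** The 1 is for the complete sums, [arc_const] for the arcs, d for moving the lower endpoint; the
    factor 2 is the one in Delta >= N^d / (2v). *)
Let Kc : R := 1 + 2 * (arc_const e Cw + d%:R).

Hypothesis adm : admissible d p.
Hypothesis N1 : (1 <= N)%N.
Hypothesis hw : w%:Z <= Num.floor (eps ^+ 3 * ln (N%:R : R)).
Hypothesis w2 : (2 <= w)%N.
Hypothesis wfact : (d`! <= w)%N.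
Hypothesis wcoef : (2 * coef_norm d p <= w)%N.
Hypothesis wmordell : mordell_const R d <= w%:R `^ eps.
Hypothesis Cw1 : 1 <= Cw.
Hypothesis weyl : forall (u : R) (N : nat) (f : {poly R}) (a : int) (q A B : nat),
  1 <= u -> N%:R = u ^+ 8 -> (B - A <= N)%N -> (size f <= e.+3)%N ->
  (0 < q)%N -> coprimez a q ->
  `|(e.+2)`!%:R * f`_e.+2 - a%:~R / q%:R| <= q%:R ^- 2 ->
  u ^+ 2 <= q%:R -> q%:R <= u ^+ (8 * e + 10) ->
  cabs (phase_sum (fun n => f.[n%:R]) A B) ^+ (2 ^ e.+1) <= Cw * u ^+ (8 * 2 ^ e.+1 - 1).

Let w0 : (0 < w)%N. Proof. exact: ltnW. Qed.
Let W0 : (0 < W)%N. Proof. exact: lcm_upto_gt0. Qed.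
Let wW : (w <= W)%N.
Proof. by rewrite dvdn_leq // dvdn_lcm_upto // w0 leqnn. Qed.
Let coefs := admissible_coefs (isT : (2 <= d)%N) adm.
Let sp : (size p <= d.+1)%N. Proof. by case: coefs. Qed.
Let p0 : p`_0 = 0. Proof. by case: coefs. Qed.
Let pd : 0 < p`_d. Proof. by case: coefs. Qed.
Let sQ : (size Q <= d.+1)%N. Proof. exact: leq_trans (size_poly _ _) sp. Qed.
Let Qlead : 0 < Q`_d.
Proof. by rewrite coef_reduced_dilate mulr_gt0 // exprn_gt0. Qed.
Let eps0 : 0 < eps. Proof. exact: eps_gt0. Qed.
Let NR : 1 <= N%:R :> R. Proof. by rewrite ler1n. Qed.
Let v2 : 2 <= v.
Proof. by apply: le_trans (w_le_v N1 hw); rewrite ler_nat. Qed.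
Let v0 : 0 < v. Proof. exact: lt_le_trans v2. Qed.
Let pdw : p`_d <= w%:Z.
Proof.
rewrite -[p`_d]gez0_abs ?(ltW pd) // lez_nat; apply: leq_trans wcoef.
rewrite /coef_norm big_ord_recr /= mulnDr; apply: leq_trans (leq_addl _ _).
by rewrite leq_pmull.
Qed.
Let omega0 : 0 <= omega. Proof. exact: powR_ge0. Qed.
(** Analytic errors of relative size 1/v are thus no larger than the saving from complete sums:
    w^(1/d - eps) <= w <= v. *)
Let v_omega : v^-1 <= omega.
Proof.
rewrite /omega powRN lef_pV2 ?posrE ?powR_gt0 ?ltr0n //.
apply: le_trans (w_le_v N1 hw); rewrite -[leRHS]powRr1 // ler_powR ?ler1n //.
apply: (@le_trans _ _ (d%:R^-1)); first by rewrite gerBl ltW.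
by rewrite invf_le1 ?ltr0n // ler1n.
Qed.
Let growth (x z : R) : 1 <= z -> x = 0 \/ 1 <= x <= z -> (z ^+ d - x ^+ d) / 2 <= q z - q x.
Proof. by apply: reduced_dilate_growth => //; exact: leq_trans wW. Qed.
Let q0 : q 0 = 0.
Proof.
rewrite /q /eval_real horner_coef0 coef_map /= coef_reduced_dilate p0 mul0r //.
Qed.
Let growth_ge0 (x z : R) : 1 <= z -> x = 0 \/ 1 <= x <= z -> q x <= q z.
Proof.
move=> z1 hx; rewrite -subr_ge0; apply: le_trans (growth z1 hx).
rewrite divr_ge0 // subr_ge0; have z0 : 0 <= z by exact: le_trans z1.
case: hx => [->|/andP[x1 xz]]; first by rewrite expr0n exprn_ge0.
by rewrite lerXn2r ?nnegrE // (le_trans ler01).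
Qed.
Let Qmono (m n : nat) : (1 <= m)%N -> (m <= n)%N -> Q.[m%:Z] <= Q.[n%:Z].
Proof.
move=> m1 mn; rewrite -(ler_int R) -!eval_real_nat; apply: growth_ge0.
  by rewrite ler1n (leq_trans m1).
by right; rewrite ler1n ler_nat m1.
Qed.
Let Qpos (n : nat) : (1 <= n)%N -> 0 <= Q.[n%:Z].
Proof.
move=> n1; rewrite -(ler_int R) -eval_real_nat -[leLHS]q0.
by apply: growth_ge0; [rewrite ler1n | left].
Qed.
Let VE (n : nat) : (1 <= n)%N -> (V n)%:R = q n%:R.
Proof. by move=> n1; rewrite /q eval_real_nat pmulrn /V /poly_val gez0_abs // Qpos. Qed.

(** * A range with lower endpoint x, to be taken as 0 or as Y *)

Section Range.
Variables (x : R) (Y0 A : nat).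
Hypothesis hx : x = 0 \/ 1 <= x.
Hypothesis xN : x <= N%:R - N%:R / v.
Hypotheses (Y01 : (1 <= Y0)%N) (Y0N : (Y0 <= N)%N).
Hypotheses (xY0 : x <= Y0%:R) (Y0x : Y0%:R <= x + 1).
Hypotheses (xA : q x <= A%:R) (Ax : A%:R <= q x + 1) (AN : (A <= V N)%N).
Let Delta := q N%:R - q x.

Let x0 : 0 <= x. Proof. by case: hx => [->|/(le_trans ler01)]. Qed.

(** The distance of x from N enters here: N^d - x^d >= N^(d-1) (N - x) >= N^d / v, and [growth]
    keeps half of it. *)
Let Delta_ge : N%:R ^+ d / (2 * v) <= Delta.
Proof.
have Nv0 : 0 <= N%:R / v by rewrite divr_ge0 // ltW.
have xN1 : x <= N%:R by apply: le_trans xN _; rewrite gerBl.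
have hx2 : x = 0 \/ 1 <= x <= N%:R by case: hx => [|x1]; [left | right; rewrite x1].
apply: le_trans (growth NR hx2).
have h : x ^+ d <= N%:R ^+ e.+1 * x.
  by rewrite [leLHS]exprSr ler_wpM2r // lerXn2r ?nnegrE.
have h2 : N%:R ^+ e.+1 * (N%:R / v) <= N%:R ^+ d - x ^+ d.
  apply: (@le_trans _ _ (N%:R ^+ e.+1 * (N%:R - x))).
    by rewrite ler_wpM2l ?exprn_ge0 //; move: xN; lra.
  by rewrite mulrBr -exprSr lerD2l lerN2.
have -> : N%:R ^+ d / (2 * v) = N%:R ^+ e.+1 * (N%:R / v) / 2.
  by rewrite [N%:R ^+ d]exprSr; field; rewrite gt_eqF.
by rewrite ler_wpM2r.
Qed.

Let Delta_gt0 : 0 < Delta.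
Proof.
apply: lt_le_trans Delta_ge; apply: divr_gt0; last by rewrite mulr_gt0.
by rewrite exprn_gt0 // ltr0n.
Qed.

(** Telescoping starts the linear sum at V(Y0), the statement at A. Both are close to q(x): A within
    1, V(Y0) within d v N^(d-1), the increment of q over a step of at most 1. The target absorbs
    this because v^3 <= N. *)
Let endpoint_shift : `|A%:R - (V Y0)%:R| <= d%:R * (N%:R ^+ d / v ^+ 2).
Proof.
have v1 : 1 <= v by apply: le_trans v2; rewrite ler1n.
have v3N : v ^+ 3 <= N%:R.
  have := v6_le_y R e N1; rewrite -/v => h.
  apply: (@le_trans _ _ (v ^+ 6)); first by rewrite ler_weXn2l.
  apply: (le_trans h); rewrite -[leRHS]powRr1 // ler_powR //.
  by rewrite invf_le1 ?ler1n ?ltr0n ?muln_gt0 ?expn_gt0.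
have big : d%:R * v * N%:R ^+ e.+1 <= d%:R * (N%:R ^+ d / v ^+ 2).
  rewrite -mulrA ler_wpM2l // ler_pdivlMr ?exprn_gt0 //.
  have -> : v * N%:R ^+ e.+1 * v ^+ 2 = v ^+ 3 * N%:R ^+ e.+1 by ring.
  by rewrite [leRHS]exprS ler_wpM2r ?exprn_ge0.
apply: le_trans big; rewrite VE //.
have mono : q x <= q Y0%:R.
  apply: growth_ge0; first by rewrite ler1n.
  by case: hx => [|x1]; [left | right; rewrite x1].
have inc : q Y0%:R - q x <= d%:R * v * N%:R ^+ e.+1.
  have h0 : 0 <= Y0%:R - x by rewrite subr_ge0.
  have hZ : x + (Y0%:R - x) <= N%:R by rewrite addrC subrK ler_nat.
  have := increment_le sQ x0 h0 hZ NR; rewrite [x + _]addrC subrK => /(le_trans (ler_norm _)) h.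
  apply: (le_trans h).
  have Qv : (coef_norm d Q)%:R <= v.
    apply: coef_norm_le_v => //; apply: leq_trans wW; apply: leq_trans wcoef.
    by rewrite leq_pmull.
  rewrite [d%:R * v]mulrC -[leRHS]mulrA; apply: ler_pM => //.
    by rewrite !mulr_ge0 ?exprn_ge0.
  rewrite ler_wpM2r ?exprn_ge0 // ler_piMr //.
  by move: Y0x; lra.
have one : 1 <= d%:R * v * N%:R ^+ e.+1.
  by apply: mulr_ege1; [apply: mulr_ege1; rewrite ?ler1n | rewrite exprn_ege1].
move: xA Ax mono inc one; move: (q x) (q Y0%:R) (d%:R * v * _) => s t K h1 h2 h3 h4 h5.
by rewrite ler_norml; apply/andP; split; lra.
Qed.

Lemma phase_difference_le (theta : R) :
  cabs (\sum_(Y0 <= n < N) (eval_real Q^`() n%:R)%:C%C * cexp (theta * (V n)%:R)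
      - \sum_(A <= m < V N) cexp (theta * m%:R)) <= Delta * (Kc * omega).
Proof.
have complete_le (a : int) (k : nat) : (1 < k)%N -> coprimez a k ->
    cabs (complete_sum R k (a *: Q)) <= k%:R * omega.
  apply: complete_sum_reduced_dilate => //; first exact: eps_le_inv.
  by apply: leq_trans wfact; rewrite factS leq_pmulr // fact_gt0.
have dv : (e.+2)`!%:R <= v by apply: le_trans (w_le_v N1 hw); rewrite ler_nat.
have Qv : (coef_norm d Q)%:R <= v.
  apply: coef_norm_le_v => //; apply: leq_trans wW; apply: leq_trans wcoef.
  by rewrite leq_pmull.
have arcs := exp_sum_arcs sQ Qlead Qpos Qmono Y01 Y0N v2 dv (v6_le_y R e N1)
  (y_pow R e N1) Qv omega0 complete_le Cw1 weyl theta.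
have VY0N : (V Y0 <= V N)%N.
  by rewrite -lez_nat /V /poly_val !gez0_abs ?Qpos ?Qmono.
have shift := phase_sum_shift_le theta VY0N AN.
rewrite distrC in shift.
have -> : \sum_(Y0 <= n < N) (eval_real Q^`() n%:R)%:C%C * cexp (theta * (V n)%:R)
      - \sum_(A <= m < V N) cexp (theta * m%:R) =
   (\sum_(Y0 <= n < N) (eval_real Q^`() n%:R)%:C%C * cexp (theta * (V n)%:R)
      - \sum_(V Y0 <= m < V N) cexp (theta * m%:R))
   + (\sum_(V Y0 <= m < V N) cexp (theta * m%:R) - \sum_(A <= m < V N) cexp (theta * m%:R)).
  by rewrite addrA subrK.
apply: (le_trans (cabsD _ _)); apply: (le_trans (lerD arcs (le_trans shift endpoint_shift))).
(* One factor N^d / (2v) is paid by Delta, the other, 2/v, by 2 omega. *)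
have T2 : N%:R ^+ d / v ^+ 2 <= Delta * (2 * omega).
  have -> : N%:R ^+ d / v ^+ 2 = (N%:R ^+ d / (2 * v)) * (2 * v^-1).
    by field; rewrite gt_eqF.
  apply: ler_pM => //; last by rewrite ler_wpM2l.
    by rewrite divr_ge0 ?exprn_ge0 // mulr_ge0 // ltW.
  by rewrite mulr_ge0 // invr_ge0 ltW.
have VD : (V N)%:R - (V Y0)%:R <= Delta.
  rewrite !VE // lerD2l lerN2; apply: growth_ge0; first by rewrite ler1n.
  by case: hx => [|x1]; [left | right; rewrite x1].
have h1 : omega * ((V N)%:R - (V Y0)%:R) <= omega * Delta by rewrite ler_wpM2l.
have h2 : (arc_const e Cw + d%:R) * (N%:R ^+ d / v ^+ 2) <=
    (arc_const e Cw + d%:R) * (Delta * (2 * omega)).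
  by rewrite ler_wpM2l // addr_ge0 // arc_const_ge0.
have -> : Delta * (Kc * omega) =
    omega * Delta + (arc_const e Cw + d%:R) * (Delta * (2 * omega)) by rewrite /Kc; ring.
by rewrite mulrDl in h2; rewrite -addrA; exact: lerD.
Qed.

Lemma average_difference_le (a b D : R)
    (disp : measure_display) (X : measurableType disp)
    (mu : probability X R) (T : mp_map mu) (f : X -> R[i]) :
    in_L2 mu f -> D = W%:R * Delta ->
    (forall n : int, (a <= n%:~R < (N%:R : R)) = (Y0%:Z <= n < N%:Z)) ->
    (forall m : int, (b <= m%:~R < q N%:R) = (A%:Z <= m < (V N)%:Z)) ->
  (L2norm mu (fun x =>
      (D^-1)%:C%C * poly_sum T (dilate W p) a N%:R f x
      - (W%:R / D)%:C%C * linear_sum T W b (q N%:R) f x)%R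
    <= (Kc / w%:R `^ (d%:R^-1 - eps))%R%:E * L2norm mu f)%E.
Proof.
move=> fL2 -> ha hb.
have Kc0 : 0 <= Kc by rewrite /Kc addr_ge0 // mulr_ge0 // addr_ge0 // arc_const_ge0.
have M0 : 0 <= Kc * omega by rewrite mulr_ge0.
have := transfer_to_phases T fL2 W0 Delta_gt0 M0 phase_difference_le.
have -> : Kc * omega = Kc / w%:R `^ (d%:R^-1 - eps) by rewrite /omega powRN.
congr (L2norm mu _ <= _)%E; apply/funext => z.
rewrite /poly_sum /linear_sum (int_co_sum _ ha) (int_co_sum _ hb).
congr (_ * _ - _ * _).
apply: eq_big_nat => n /andP[Yn nN].
have n1 : (1 <= n)%N by exact: leq_trans Yn.
rewrite dilateE // derivZ !hornerZ -/Q; congr (_ * _).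
  rewrite -(rmorph_int (real_complex R)) /=; congr (_%:C)%C.
  by rewrite rmorphM /= eval_real_nat -pmulrn.
by rewrite -[Q.[_]]gez0_abs ?Qpos // -PoszM.
Qed.

End Range.

Let PR : R -> R := eval_real (dilate W p).

Let WR : W%:R != 0 :> R. Proof. by rewrite pnatr_eq0 -lt0n. Qed.

Let PRE (x : R) : PR x = W%:R * q x.
Proof. by rewrite /PR dilateE // eval_realZ -pmulrn. Qed.

Let PRW (x : R) : PR x / W%:R = q x.
Proof. by rewrite PRE mulrAC mulfV ?mul1r. Qed.

Let V_upper (m : int) : (m%:~R < q N%:R) = (m < (V N)%:Z).
Proof. by rewrite -VE // pmulrn ltr_int. Qed.

Let Nv (x : R) : x <= N%:R - N%:R `^ (1 - eps) -> x <= N%:R - N%:R / v.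
Proof. by rewrite /eps N_powR_sub. Qed.

Section Systems.
Variables (disp : measure_display) (X : measurableType disp).
Variables (mu : probability X R) (T : mp_map mu) (f : X -> R[i]).
Hypothesis fL2 : in_L2 mu f.

Lemma full_average_difference_le :
  (L2norm mu (fun x =>
      ((PR N%:R)^-1)%:C%C * poly_sum T (dilate W p) 1 N%:R f x
      - (W%:R / PR N%:R)%:C%C * linear_sum T W 1 (PR N%:R / W%:R) f x)%R
    <= (Kc / w%:R `^ (d%:R^-1 - eps))%R%:E * L2norm mu f)%E.
Proof.
rewrite PRW.
(* Needed for the start A = 1 of the linear sum not to exceed V(N). *)
have V1 : (0 < V 1)%N.
  rewrite -(ltr_nat R) VE //.
  have := growth (lexx 1) (or_introl (erefl 0)).
  by rewrite q0 subr0 expr1n expr0n /= subr0; apply: lt_le_trans; rewrite divr_gt0.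
have V1N : (V 1 <= V N)%N by rewrite -lez_nat /V /poly_val !gez0_abs ?Qpos ?Qmono.
(* As P(0) = 0, the full average has x = 0 as lower endpoint, although both sums start at 1; the
   bounds Y0 <= x + 1 and A <= q x + 1 allow this. *)
apply: (@average_difference_le 0 1 1) => //.
- by left.
- rewrite subr_ge0 ler_pdivrMr // ler_peMr //.
  by apply: le_trans v2; rewrite ler1n.
- by rewrite add0r.
- by rewrite q0.
- by rewrite q0 add0r.
- exact: leq_trans V1N.
- by rewrite PRE q0 subr0.
- by move=> n; rewrite -[1 in LHS]/(1%:~R) ler_int pmulrn ltr_int.
- by move=> n; rewrite V_upper -[1 in LHS]/(1%:~R) ler_int.
Qed.

Lemma tail_average_difference_le (Y : R) :
    1 <= Y -> Y <= N%:R - N%:R `^ (1 - eps) ->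
  (L2norm mu (fun x =>
      ((PR N%:R - PR Y)^-1)%:C%C * poly_sum T (dilate W p) Y N%:R f x
      - (W%:R / (PR N%:R - PR Y))%:C%C
        * linear_sum T W (PR Y / W%:R) (PR N%:R / W%:R) f x)%R
    <= (Kc / w%:R `^ (d%:R^-1 - eps))%R%:E * L2norm mu f)%E.
Proof.
move=> Y1 /Nv YN; rewrite !PRW.
have Y0 : 0 <= Y by exact: le_trans Y1.
have YN1 : Y <= N%:R by apply: (le_trans YN); rewrite gerBl divr_ge0 // ltW.
have qY0 : 0 <= q Y by rewrite -q0; apply: growth_ge0 => //; left.
have qYN : q Y <= q N%:R by apply: growth_ge0 => //; right; rewrite Y1.
have [YA YB] := ceil_abszP Y0; have [qA qB] := ceil_abszP qY0.
(* An integer is at least a real bound exactly when it is at least its ceiling, so the two sums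
   start at the ceilings of Y and q(Y). *)
apply: (@average_difference_le Y (absz (Num.ceil Y)) (absz (Num.ceil (q Y)))) => //.
- by right.
- by rewrite -(ltr_nat R) (lt_le_trans _ YA) // (lt_le_trans _ Y1).
- by rewrite -lez_nat -ceil_absz // -pmulrn.
- exact: ltW YB.
- exact: ltW qB.
- by rewrite -lez_nat -ceil_absz // -pmulrn VE.
- by rewrite !PRE mulrBr.
- by move=> n; rewrite ceil_absz // pmulrn ltr_int.
- by move=> n; rewrite ceil_absz // V_upper.
Qed.

End Systems.
End Averages.

Lemma linear_average_difference (R : realType) (W : nat) (a b D : R)
    (disp : measure_display) (X : measurableType disp)
    (mu : probability X R) (T : mp_map mu) (f : X -> R[i]) :
  L2norm mu (fun x =>
      (D^-1)%:C%C * poly_sum T (dilate W 'X) a b f x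
      - (W%:R / D)%:C%C * linear_sum T W a b f x) = 0%E.
Proof.
have -> : (fun x => (D^-1)%:C%C * poly_sum T (dilate W 'X) a b f x
      - (W%:R / D)%:C%C * linear_sum T W a b f x) = fun=> 0.
  apply/funext => x; apply/eqP; rewrite subr_eq0; apply/eqP.
  have WE : (W%:R : R)%:C%C = W%:R :> R[i] by rewrite rmorph_nat.
  rewrite mulrC [_%:R / D]mulrC rmorphM /= mulrC -mulrA WE; congr (_ * _).
  rewrite /poly_sum /linear_sum /dilate comp_polyX mulr_fsumr.
  apply: eq_fsbigr => n _.
  by rewrite derivZ derivX !hornerZ hornerX hornerC mulr1 -pmulrn.
rewrite /L2norm -[RHS](Lnorm0 mu (p := 2%:E)) //; congr Lnorm.
by apply/funext => x; rewrite /= expr0n /= addr0 sqrtr0.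
Qed.

Theorem theorem5p1 (R : realType) (d : nat) (hd : (1 <= d)%N) :
  let eps : R := 100 ^- (d ^ 2)%N in
  exists2 C : R, 0 < C &
  forall p : {poly int}, admissible d p ->
  exists2 w0 : nat, (1 <= w0)%N &
  forall w N : nat, (1 <= N)%N -> (w0 <= w)%N ->
    (1 <= w)%N -> w%:Z <= Num.floor (eps ^+ 3 * ln (N%:R : R)) ->
  let W := lcm_upto w in
  let P := dilate W p in
  let PR := eval_real P : R -> R in
  forall (disp : measure_display) (X : measurableType disp)
    (mu : probability X R) (T : mp_map mu) (f : X -> R[i]), in_L2 mu f ->
  (L2norm mu (fun x =>
      ((PR N%:R)^-1)%:C%C * poly_sum T P 1 N%:R f x
      - (W%:R / PR N%:R)%:C%C * linear_sum T W 1 (PR N%:R / W%:R) f x)%R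
    <= (C / w%:R `^ (d%:R^-1 - eps))%R%:E * L2norm mu f)%E
  /\
  (forall Y : R, 1 <= Y -> Y <= N%:R - N%:R `^ (1 - eps) ->
   (L2norm mu (fun x =>
      ((PR N%:R - PR Y)^-1)%:C%C * poly_sum T P Y N%:R f x
      - (W%:R / (PR N%:R - PR Y))%:C%C
        * linear_sum T W (PR Y / W%:R) (PR N%:R / W%:R) f x)%R
    <= (C / w%:R `^ (d%:R^-1 - eps))%R%:E * L2norm mu f)%E).
Proof.
case: d hd => [//|[|e]] _ eps.
  exists 1; first by [].
  move=> p; rewrite /admissible eqxx => ->.
  exists 1%N; first by [].
  move=> w N _ _ w1 _; set W := lcm_upto w.
  move=> disp X mu T f _.
  have WR : W%:R != 0 :> R by rewrite pnatr_eq0 -lt0n lcm_upto_gt0.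
  have PRW (y : R) : eval_real (dilate W 'X) y / W%:R = y.
    rewrite /dilate comp_polyX eval_realZ /eval_real map_polyX hornerX -pmulrn.
    by rewrite mulrAC mulfV ?mul1r.
  have r0 : (0 <= (1 / w%:R `^ (1%:R^-1 - eps))%R%:E * L2norm mu f)%E.
    by rewrite mule_ge0 ?Lnorm_ge0 // lee_fin divr_ge0 // powR_ge0.
  by split=> [|Y _ _]; rewrite !PRW linear_average_difference.
have [Cw Cw1 weyl] := weyl_bound R e.
have eps0 : 0 < eps by exact: eps_gt0.
exists (1 + 2 * (arc_const e Cw + e.+2%:R)).
  by rewrite ltr_wpDr // mulr_ge0 // addr_ge0 // arc_const_ge0.
move=> p adm.
(* m + 1 exceeds the (1/eps)-th power of Mordell's constant. The summands of w0 give in turn 2 <= w,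
   d! <= w, twice the coefficient norm of p at most w, and Mordell's constant at most w^eps; the
   dependence on p stays in w0, outside the constant chosen before p. *)
pose m := Num.truncn (mordell_const R e.+2 `^ eps^-1).
exists (2 + (e.+2)`! + 2 * coef_norm e.+2 p + m.+1)%N; first by [].
move=> w N N1 w0w w1 hw W P PR disp X mu T f fL2.
have w2 : (2 <= w)%N by apply: leq_trans w0w; rewrite -!addnA leq_addr.
have wfact : ((e.+2)`! <= w)%N.
  by apply: leq_trans w0w; rewrite -addnA addnAC leq_addl.
have wcoef : (2 * coef_norm e.+2 p <= w)%N.
  by apply: leq_trans w0w; rewrite addnAC leq_addl.
have wmordell : mordell_const R e.+2 <= w%:R `^ eps.
  have h : mordell_const R e.+2 `^ eps^-1 <= w%:R.
    apply: (@le_trans _ _ m.+1%:R); first by rewrite ltW // truncnS_gt.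
    by rewrite ler_nat; apply: leq_trans w0w; rewrite leq_addl.
  have -> : mordell_const R e.+2 = (mordell_const R e.+2 `^ eps^-1) `^ eps.
    by rewrite -powRrM mulVf ?lt0r_neq0 // powRr1.
  by rewrite ge0_ler_powR ?nnegrE ?powR_ge0 // ltW.
by split=> [|Y]; [exact: full_average_difference_le | exact: tail_average_difference_le].
Qed.
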